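(* Let $(Y^7,\varphi,g)$ be a $G_2$-manifold with Hodge dual $*_7\varphi\in\Omega^4(Y)$. Then $X^8=S^1\times Y^7$, with the 4-form $\Phi=dx\wedge\varphi+*_7\varphi$ ($x$ the coordinate of $S^1$), is a $\mathrm{Spin}(7)$-manifold. Let $L\to Y$ be a smooth complex line bundle with a Hermitian metric $h$, let $\nabla$ be a Hermitian connection of $(L,h)$, and identify $\nabla$ with its pullback to $X^8$. Then the following are equivalent. (1) $\nabla$ is a deformed Donaldson--Thomas connection in the $G_2$ sense, i.e. $*_7\varphi\wedge F_\nabla+\frac16F_\nabla^3=0$ on $Y$. (2) $\mathcal{F}^1_{\mathrm{Spin}(7)}(\nabla)=0$ on $X$. (3) $\mathcal{F}^1_{\mathrm{Spin}(7)}(\nabla)=0$ and $\mathcal{F}^2_{\mathrm{Spin}(7)}(\nabla)=0$ on $X$.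
   Context: The curvature $F_\nabla$ of a Hermitian connection of a Hermitian line bundle is regarded as a $\sqrt{-1}\,\mathbb{R}$-valued closed 2-form; powers are wedge powers. $G_2$-structure: a 3-form $\varphi$ on an oriented 7-manifold which at each point equals $e^{123}+e^{145}+e^{167}+e^{246}-e^{257}-e^{347}-e^{356}$ for some positively oriented basis with dual basis $e^1,\dots,e^7$ (where $e^{ijk}=e^i\wedge e^j\wedge e^k$); it determines a unique metric $g$ for which such bases are orthonormal. A $G_2$-manifold is a 7-manifold with a torsion-free $G_2$-structure, i.e. $\varphi$ is parallel for the Levi-Civita connection of $g$. $*_7$ is the Hodge star on $Y$. $\mathrm{Spin}(7)$-structure: a 4-form $\Phi$ on an 8-manifold which at each point has the form $e^0\wedge\varphi_0+*_7\varphi_0$ for a positively oriented basis with dual basis $e^0,\dots,e^7$, where $\varphi_0=e^{123}+e^{145}+e^{167}+e^{246}-e^{257}-e^{347}-e^{356}$ and $*_7$ is the Hodge star on $\mathrm{span}(e^1,\dots,e^7)$ for the metric making this an oriented orthonormal basis; it determines a metric (making $e^0,\dots,e^7$ orthonormal) and orientation. A $\mathrm{Spin}(7)$-manifold is an 8-manifold with a $\mathrm{Spin}(7)$-structure parallel for the Levi-Civita connection of the induced metric. $\pi^k_\ell:\Omega^k\to\Omega^k_\ell$ is the orthogonal projection (extended complex linearly) onto the forms with values in the subbundle of $\Lambda^kT^*X$ corresponding to the $\ell$-dimensional irreducible $\mathrm{Spin}(7)$-representation; $\Lambda^2\cong W_7\oplus W_{21}$, $\Lambda^4\cong W_1\oplus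 W_7\oplus W_{27}\oplus W_{35}$. Explicitly $\pi^2_7(\alpha)=\frac14(\alpha+*(\Phi\wedge\alpha))$ and $\Lambda^4_7=\{e^0\wedge i(\alpha^\sharp)*_7\varphi_0-\alpha\wedge\varphi_0\mid\alpha\in\mathrm{span}(e^1,\dots,e^7)\}$, with $*$ the Hodge star on $X$, $i(\cdot)$ the interior product and $\alpha^\sharp$ the metric dual. For a Hermitian connection $\nabla$ of a Hermitian complex line bundle over $X$: $\mathcal{F}^1_{\mathrm{Spin}(7)}(\nabla)=\pi^2_7\big(F_\nabla+\frac16*F_\nabla^3\big)$ and $\mathcal{F}^2_{\mathrm{Spin}(7)}(\nabla)=\pi^4_7(F_\nabla^2)$. $\nabla$ is called a $\mathrm{Spin}(7)$-dDT connection if both vanish. *)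

(* Defs.v *)
From HB Require Import structures.
From mathcomp Require Import all_boot all_order all_fingroup all_algebra.
From mathcomp Require Import complex.
From mathcomp Require Import all_classical all_reals all_analysis.
Import Order.TTheory GRing.Theory Num.Theory.
Import numFieldNormedType.Exports.

Set Implicit Arguments.
Unset Strict Implicit.
Unset Printing Implicit Defensive.

Local Open Scope classical_set_scope.
Local Open Scope ring_scope.
Local Open Scope complex_scope.

(* A [k]-form on [R^n] is a function of a [k x n] matrix whose rows are the
   [k] vector arguments; [alternating_form] says that it is multilinear and
   alternating. *)

Definition form (R : realType) (K : Type) (k n : nat) := 'M[R]_(k, n) -> K.

Definition alternating_form (R : realType) (k n : nat) (w : form R R k n) :=
  (forall (V V1 V2 : 'M[R]_(k, n)) (r : 'I_k) (b c : R),
      row r V = b *: row r V1 + c *: row r V2 ->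
      row' r V1 = row' r V -> row' r V2 = row' r V ->
      w V = b * w V1 + c * w V2) /\
  (forall (V : 'M[R]_(k, n)) (r1 r2 : 'I_k),
      r1 != r2 -> row r1 V = row r2 V -> w V = 0).

(* Normalised so that e^1 /\ e^2 (e_1, e_2) = 1. *)
Definition wedge (R : realType) (K : fieldType) (p q n : nat)
    (a : form R K p n) (b : form R K q n) : form R K (p + q) n := fun V =>
  (p`! * q`!)%:R^-1 *
  \sum_(s : 'S_(p + q)) (-1) ^+ s * a (usubmx (row_perm s V))
                                  * b (dsubmx (row_perm s V)).

Definition interior (R : realType) (K : Type) (k n : nat) (v : 'rV[R]_n)
    (w : form R K (1 + k) n) : form R K k n := fun V => w (col_mx v V).

Definition covector (R : realType) (n : nat) (a : 'rV[R]_n) : form R R 1 n :=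
  fun V => \sum_j a 0 j * V 0 j.

Definition dx (R : realType) (n : nat) (i : 'I_n) : form R R 1 n :=
  fun V => V 0 i.

(* Inner product on [k]-forms induced by the inner product with Gram matrix
   [G]: one argument is evaluated on coordinate vectors, the other on the metric
   duals of the coordinate covectors, which are the rows of [invmx G]. *)
Definition form_inner (R : realType) (k n : nat) (G : 'M[R]_n)
    (a b : form R R k n) : R :=
  (k`!)%:R^-1 *
  \sum_(f : {ffun 'I_k -> 'I_n}) a (rowsub f (invmx G)) * b (rowsub f 1%:M).

(* Hodge star for the Gram matrix [G] and the standard orientation:
   ( *b)_{j..} = 1/k! b^{i..} sqrt(det G) eps_{i..j..}. *)
Definition hodge (R : realType) (k m : nat) (G : 'M[R]_(k + m))
    (b : form R R k (k + m)) : form R R m (k + m) := fun V =>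
  (k`!)%:R^-1 *
  \sum_(f : {ffun 'I_k -> 'I_(k + m)})
     b (rowsub f (invmx G)) *
     (Num.sqrt (\det G) * \det (col_mx (rowsub f 1%:M) V)).

Definition formC (R : realType) (k n : nat) (w : form R R k n)
  : form R R[i] k n := fun V => (w V)%:C.

Definition extC (R : realType) (k m n : nat)
    (T : form R R k n -> form R R m n) (w : form R R[i] k n)
  : form R R[i] m n :=
  fun V => T (fun U => complex.Re (w U)) V +i* T (fun U => complex.Im (w U)) V.

Definition e3 (R : realType) (i j k : nat) : form R R 3 7 :=
  wedge (wedge (dx (inord i.-1)) (dx (inord j.-1))) (dx (inord k.-1)).

Definition phi0 (R : realType) : form R R 3 7 := fun V =>
  e3 1 2 3 V + e3 1 4 5 V + e3 1 6 7 V + e3 2 4 6 V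
  - e3 2 5 7 V - e3 3 4 7 V - e3 3 5 6 V.

Definition form_pr2 (R : realType) (K : Type) (k m n : nat)
    (w : form R K k n) : form R K k (m + n) := fun V => w (rsubmx V).

Definition cylinder_form (R : realType) (phi : form R R 3 7)
    (psi : form R R 4 7) : form R R 4 (1 + 7) := fun V =>
  wedge (dx 0) (form_pr2 (m := 1) phi) V + form_pr2 (m := 1) psi V.

Definition star_phi (R : realType) (G : 'M[R]_7) (phi : form R R 3 7)
  : form R R 4 7 := hodge (k := 3) (m := 4) G phi.

Definition Phi0 (R : realType) : form R R 4 (1 + 7) :=
  cylinder_form (@phi0 R) (star_phi 1%:M (@phi0 R)).

(* e^0 /\ i(a^#) *_7 phi_0 - a /\ phi_0; in the orthonormal basis of the model,
   [a] and its metric dual have the same coefficients. *)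
Definition lambda47 (R : realType) (a : 'rV[R]_7) : form R R 4 (1 + 7) :=
  fun V =>
    wedge (dx 0)
      (form_pr2 (m := 1) (interior (k := 3) a (star_phi 1%:M (@phi0 R)))) V
    - form_pr2 (m := 1) (wedge (covector a) (@phi0 R)) V.

(* The rows of [E] form a positively oriented basis which is orthonormal for
   [G].  Coordinates in this basis are obtained by multiplying by [invmx E], so
   [w (V *m invmx E)] is the form with the expression of the model form [w] in
   the basis dual to [E]. *)
Definition oriented_orthonormal (R : realType) (n : nat) (G E : 'M[R]_n) :=
  0 < \det E /\ E *m G *m E^T = 1%:M.

Definition in_frame (R : realType) (K : Type) (k n : nat) (E : 'M[R]_n)
    (w : form R K k n) : form R K k n := fun V => w (V *m invmx E).

(* Two bases adapted to the same form differ by an element of G_2 in SO(7),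
   respectively Spin(7) in SO(8); the form thus determines [G]. *)
Definition g2_frame (R : realType) (phi : form R R 3 7) (G E : 'M[R]_7) :=
  oriented_orthonormal G E /\ forall V, phi V = in_frame E (@phi0 R) V.

Definition spin7_frame (R : realType) (Phi : form R R 4 (1 + 7))
    (G E : 'M[R]_(1 + 7)) :=
  oriented_orthonormal G E /\ forall V, Phi V = in_frame E (@Phi0 R) V.

Definition pi27 (R : realType) (Phi : form R R 4 (1 + 7)) (G : 'M[R]_(1 + 7))
    (a : form R R 2 (1 + 7)) : form R R 2 (1 + 7) := fun V =>
  4^-1 * (a V + hodge (k := 6) (m := 2) G (wedge Phi a) V).

(* Every adapted basis yields the same 7-dimensional space. *)
Definition Lambda47 (R : realType) (Phi : form R R 4 (1 + 7))
    (G : 'M[R]_(1 + 7)) : set (form R R 4 (1 + 7)) :=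
  [set w | exists (E : 'M[R]_(1 + 7)) (a : 'rV[R]_7),
     spin7_frame Phi G E /\ forall V, w V = in_frame E (lambda47 a) V].

Definition pi47 (R : realType) (Phi : form R R 4 (1 + 7)) (G : 'M[R]_(1 + 7))
    (b : form R R 4 (1 + 7)) : form R R 4 (1 + 7) :=
  xget (fun=> 0) [set c : form R R 4 (1 + 7) | Lambda47 Phi G c /\
    forall w, Lambda47 Phi G w -> form_inner G (fun V => b V - c V) w = 0].

(* A manifold is a set with a family of injective parametrisations of its
   subsets by open subsets of R^n; its topology is the induced one. *)

(* C^infinity: every iterated partial derivative is differentiable. *)
Fixpoint partials (R : realType) (n : nat) (W : normedModType R)
    (s : seq 'I_n) (f : 'rV[R]_n -> W) : 'rV[R]_n -> W :=
  if s is i :: s' then fun x => 'D_(delta_mx 0 i) (partials s' f) x else f.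

Definition smooth_on (R : realType) (n : nat) (W : normedModType R)
    (U : set 'rV[R]_n) (f : 'rV[R]_n -> W) :=
  forall (s : seq 'I_n) x, U x -> differentiable (partials s f) x.

Record atlas (R : realType) (n : nat) := Atlas {
  pt : Type;
  ix : Type;
  dom : ix -> set 'rV[R]_n;
  par : ix -> 'rV[R]_n -> pt }.

Definition chart_image (R : realType) (n : nat) (A : atlas R n) (i : ix A)
  : set (pt A) := par i @` dom i.

Definition open_in (R : realType) (n : nat) (A : atlas R n) (U : set (pt A)) :=
  forall i : ix A, open [set x | dom i x /\ U (par i x)].

Definition overlap (R : realType) (n : nat) (A : atlas R n) (i j : ix A)
  : set 'rV[R]_n := [set x | dom i x /\ chart_image j (par i x)].

(* Change of coordinates from [i] to [j], meaningful on [overlap i j]. *)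
Definition trans (R : realType) (n : nat) (A : atlas R n) (i j : ix A)
    (x : 'rV[R]_n) : 'rV[R]_n :=
  xget 0 [set y | dom j y /\ par j y = par i x].

(* Hausdorff, second countable (countably many charts suffice to cover) and
   oriented by its atlas.  ['J] acts on row vectors on the right. *)
Definition oriented_manifold (R : realType) (n : nat) (A : atlas R n) :=
  [/\ (forall i : ix A, open (dom i) /\ {in dom i &, injective (par i)}),
      (exists2 C : set (ix A), countable C &
         forall p, exists2 i, C i & chart_image i p),
      (forall p q : pt A, p <> q -> exists U V : set (pt A),
         [/\ open_in U, open_in V, U p, V q & U `&` V = set0]),
      (forall i j : ix A, open (overlap i j)) &
      (forall i j : ix A, smooth_on (overlap i j) (trans i j) /\
         forall x, overlap i j x -> 0 < \det ('J (trans i j) x))].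

Definition circle_pt (R : realType) :=
  {z : R * R | z.1 ^+ 2 + z.2 ^+ 2 == 1}.

Lemma circle_proof (R : realType) (t : R) :
  (cos t, sin t).1 ^+ 2 + (cos t, sin t).2 ^+ 2 == 1 :> R.
Proof. by rewrite /= cos2Dsin2. Qed.

(* The chart of index [t] is x |-> (cos x, sin x) for t < x < t + 2 pi, so that
   dx is the standard 1-form in every chart. *)
Definition circle (R : realType) : atlas R 1 := {|
  pt := circle_pt R;
  ix := R;
  dom := fun t => [set x : 'rV[R]_1 | t < x 0 0 < t + 2 * pi];
  par := fun _ x => exist _ (cos (x 0 0), sin (x 0 0)) (circle_proof (x 0 0)) |}.

Definition prod_atlas (R : realType) (m n : nat) (A : atlas R m)
    (B : atlas R n) : atlas R (m + n) := {|
  pt := pt A * pt B;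
  ix := ix A * ix B;
  dom := fun ij => [set x | dom ij.1 (lsubmx x) /\ dom ij.2 (rsubmx x)];
  par := fun ij x => (par ij.1 (lsubmx x), par ij.2 (rsubmx x)) |}.

Definition form_field (R : realType) (K : Type) (k n : nat) (A : atlas R n) :=
  ix A -> 'rV[R]_n -> form R K k n.

Definition smooth_form (R : realType) (k n : nat) (A : atlas R n)
    (w : form_field R k A) :=
  [/\ (forall i x, dom i x -> alternating_form (w i x)),
      (forall i V, smooth_on (dom i) (fun x => w i x V : R^o)) &
      (forall i j x V, overlap i j x ->
         w i x V = w j (trans i j x) (V *m 'J (trans i j) x))].

(* [g i x] is the Gram matrix of the coordinate vectors of the chart [i]. *)
Definition metric_field (R : realType) (n : nat) (A : atlas R n) :=
  ix A -> 'rV[R]_n -> 'M[R]_n.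

Definition riemannian_metric (R : realType) (n : nat) (A : atlas R n)
    (g : metric_field A) :=
  [/\ (forall i x, dom i x -> (g i x)^T = g i x),
      (forall i x (u : 'rV[R]_n), dom i x -> u != 0 ->
         0 < (u *m g i x *m u^T) 0 0),
      (forall i a b, smooth_on (dom i) (fun x => g i x a b : R^o)) &
      (forall i j x, overlap i j x ->
         g i x = 'J (trans i j) x *m g j (trans i j x)
                                  *m ('J (trans i j) x)^T)].

Definition partial (R : realType) (n : nat) (a : 'I_n) (f : 'rV[R]_n -> R)
  : 'rV[R]_n -> R := fun x => 'D_(delta_mx 0 a) (f : 'rV[R]_n -> R^o) x.

(* Gamma^c_{ab} = 1/2 g^{cd} (d_a g_{bd} + d_b g_{ad} - d_d g_{ab}) *)
Definition christoffel (R : realType) (n : nat) (G : 'rV[R]_n -> 'M[R]_n)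
    (x : 'rV[R]_n) (c a b : 'I_n) : R :=
  2^-1 * \sum_d invmx (G x) c d *
    (partial a (fun y => G y b d) x + partial b (fun y => G y a d) x
     - partial d (fun y => G y a b) x).

(* Components of the covariant derivative for the Levi-Civita connection:
   (nabla_a w)_{f} = d_a w_{f} - sum_r Gamma^c_{a f(r)} w_{f[r := c]}. *)
Definition levi_civita (R : realType) (k n : nat) (G : 'rV[R]_n -> 'M[R]_n)
    (w : 'rV[R]_n -> form R R k n) (x : 'rV[R]_n) (a : 'I_n)
    (f : 'I_k -> 'I_n) : R :=
  partial a (fun y => w y (rowsub f 1%:M)) x
  - \sum_(r < k) \sum_c christoffel G x c a (f r) *
      w x (rowsub (fun s => if s == r then c else f s) 1%:M).

Definition parallel (R : realType) (k n : nat) (A : atlas R n)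
    (g : metric_field A) (w : form_field R k A) :=
  forall i x, dom i x -> forall a f, levi_civita (g i) (w i) x a f = 0.

Definition g2_manifold (R : realType) (A : atlas R 7)
    (phi : form_field R 3 A) (g : metric_field A) :=
  [/\ oriented_manifold A, smooth_form phi, riemannian_metric g,
      (forall i x, dom i x -> exists E, g2_frame (phi i x) (g i x) E) &
      parallel g phi].

Definition spin7_manifold (R : realType) (A : atlas R (1 + 7))
    (Phi : form_field R 4 A) (g : metric_field A) :=
  [/\ oriented_manifold A, smooth_form Phi, riemannian_metric g,
      (forall i x, dom i x -> exists E, spin7_frame (Phi i x) (g i x) E) &
      parallel g Phi].

Definition cylinder (R : realType) (Y : atlas R 7) : atlas R (1 + 7) :=
  prod_atlas (circle R) Y.

Definition cylinder_Phi (R : realType) (Y : atlas R 7)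
    (phi : form_field R 3 Y) (g : metric_field Y)
  : form_field R 4 (cylinder Y) := fun ti x =>
  cylinder_form (phi ti.2 (rsubmx x))
                (star_phi (g ti.2 (rsubmx x)) (phi ti.2 (rsubmx x))).

Definition cylinder_metric (R : realType) (Y : atlas R 7) (g : metric_field Y)
  : metric_field (cylinder Y) := fun ti x =>
  block_mx (1%:M : 'M[R]_1) 0 0 (g ti.2 (rsubmx x)).

Definition smooth_fun (R : realType) (n : nat) (A : atlas R n)
    (U : set (pt A)) (f : pt A -> R[i]) :=
  forall i : ix A,
    smooth_on [set x | dom i x /\ U (par i x)]
              (fun x => complex.Re (f (par i x)) : R^o) /\
    smooth_on [set x | dom i x /\ U (par i x)]
              (fun x => complex.Im (f (par i x)) : R^o).

(* Derivative of [f], along the vector [u] in the chart [i], at the point with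
   coordinates [x]. *)
Definition dfun (R : realType) (n : nat) (A : atlas R n) (f : pt A -> R[i])
    (i : ix A) (x u : 'rV[R]_n) : R[i] :=
  'D_u (fun y => complex.Re (f (par i y)) : R^o) x +i*
  'D_u (fun y => complex.Im (f (par i y)) : R^o) x.

Record line_bundle (R : realType) (n : nat) (A : atlas R n) := LineBundle {
  fib : pt A -> lmodType R[i];
  lix : Type;
  lset : lix -> set (pt A);
  lframe : lix -> forall p, fib p }.

Definition section (R : realType) (n : nat) (A : atlas R n)
  (L : line_bundle A) := forall p, fib L p.

Definition coef (R : realType) (V : lmodType R[i]) (e v : V) : R[i] :=
  xget 0 [set c | v = c *: e].

Definition smooth_line_bundle (R : realType) (n : nat) (A : atlas R n)
    (L : line_bundle A) :=
  [/\ (forall p, exists a : lix L, lset a p),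
      (forall a : lix L, open_in (lset a)),
      (forall (a : lix L) p, lset a p ->
         forall v : fib L p, exists! c, v = c *: lframe a p) &
      (forall a b : lix L, smooth_fun (lset a `&` lset b)
         (fun p => coef (lframe a p) (lframe b p)))].

Definition smooth_section (R : realType) (n : nat) (A : atlas R n)
    (L : line_bundle A) (U : set (pt A)) (s : section L) :=
  forall a : lix L,
    smooth_fun (U `&` lset a) (fun p => coef (lframe a p) (s p)).

Definition smooth_at (R : realType) (n : nat) (A : atlas R n)
    (L : line_bundle A) (p : pt A) (s : section L) :=
  exists U : set (pt A), [/\ open_in U, U p & smooth_section U s].

Definition hermitian_metric (R : realType) (n : nat) (A : atlas R n)
    (L : line_bundle A) (h : forall p, fib L p -> fib L p -> R[i]) :=
  [/\ (forall p c u v w, h p (c *: u + v) w = c * h p u w + h p v w),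
      (forall p v w, h p v w = (h p w v)^*),
      (forall p v, v != 0 -> 0 < h p v v) &
      (forall (U : set (pt A)) (s t : section L), open_in U ->
         smooth_section U s -> smooth_section U t ->
         smooth_fun U (fun p => h p (s p) (t p)))].

(* [D i u s] is the covariant derivative of [s] along the vector field which is
   constantly [u] in the chart [i]; its values matter on [chart_image i] only,
   and where [s] is smooth. *)
Definition cov_derivative (R : realType) (n : nat) (A : atlas R n)
  (L : line_bundle A) := ix A -> 'rV[R]_n -> section L -> section L.

Record is_connection (R : realType) (n : nat) (A : atlas R n)
    (L : line_bundle A) (D : cov_derivative L) : Prop := IsConnection {
  conn_linear : forall i x (c : R) (u v : 'rV[R]_n) (s : section L),
    dom i x -> smooth_at (par i x) s ->
    D i (c *: u + v) s (par i x) =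
      c%:C *: D i u s (par i x) + D i v s (par i x);
  conn_add : forall i x u (s t : section L),
    dom i x -> smooth_at (par i x) s -> smooth_at (par i x) t ->
    D i u (fun p => s p + t p) (par i x) =
      D i u s (par i x) + D i u t (par i x);
  conn_leibniz : forall i x u (f : pt A -> R[i]) (s : section L)
      (U : set (pt A)),
    dom i x -> open_in U -> U (par i x) -> smooth_fun U f ->
    smooth_section U s ->
    D i u (fun p => f p *: s p) (par i x) =
      dfun f i x u *: s (par i x) + f (par i x) *: D i u s (par i x);
  conn_chart : forall i j x u (s : section L),
    overlap i j x -> smooth_at (par i x) s ->
    D i u s (par i x) = D j (u *m 'J (trans i j) x) s (par i x);
  conn_smooth : forall i u (s : section L) (U : set (pt A)),
    open_in U -> smooth_section U s ->
    smooth_section (U `&` chart_image i) (D i u s) }.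

Definition hermitian_connection (R : realType) (n : nat) (A : atlas R n)
    (L : line_bundle A) (h : forall p, fib L p -> fib L p -> R[i])
    (D : cov_derivative L) :=
  is_connection D /\
  forall i x u (s t : section L),
    dom i x -> smooth_at (par i x) s -> smooth_at (par i x) t ->
    dfun (fun p => h p (s p) (t p)) i x u =
      h (par i x) (D i u s (par i x)) (t (par i x)) +
      h (par i x) (s (par i x)) (D i u t (par i x)).

(* F(u, v) s = nabla_u nabla_v s - nabla_v nabla_u s; there is no bracket term
   because [u] and [v] are constant in the chart. *)
Definition curvature (R : realType) (n : nat) (A : atlas R n)
    (L : line_bundle A) (D : cov_derivative L)
  : ix A -> 'rV[R]_n -> form R R[i] 2 n := fun i x V =>
  xget 0 [set c : R[i] | forall s : section L, smooth_at (par i x) s ->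
    D i (row 0 V) (D i (row 1 V) s) (par i x)
    - D i (row 1 V) (D i (row 0 V) s) (par i x) = c *: s (par i x)].

Definition pullback_bundle (R : realType) (Y : atlas R 7) (L : line_bundle Y)
  : line_bundle (cylinder Y) :=
  @LineBundle R (1 + 7) (cylinder Y)
    (fun q => fib L q.2) (lix L) (fun a => [set q | lset a q.2])
    (fun a q => lframe a q.2).

(* The pullback connection is the connection on the pullback bundle with
   nabla_u (s o pr) = (nabla_{pr_* u} s) o pr; the Leibniz rule determines it on
   all sections. *)
Definition is_pullback_connection (R : realType) (Y : atlas R 7)
    (L : line_bundle Y) (D : cov_derivative L)
    (D' : cov_derivative (pullback_bundle L)) :=
  is_connection D' /\
  forall (ti : ix (cylinder Y)) (x u : 'rV[R]_(1 + 7)) (s : section L),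
    dom ti x -> smooth_at (par ti x).2 s ->
    D' ti u (fun q => s q.2) (par ti x) = D ti.2 (rsubmx u) s (par ti x).2.

Definition g2_dDT_form (R : realType) (Y : atlas R 7)
    (phi : form_field R 3 Y) (g : metric_field Y) (L : line_bundle Y)
    (D : cov_derivative L) (i : ix Y) (x : 'rV[R]_7) : form R R[i] 6 7 :=
  let F := curvature D i x in fun V =>
  wedge (formC (star_phi (g i x) (phi i x))) F V
  + 6^-1 * wedge (wedge F F) F V.

Definition g2_dDT (R : realType) (Y : atlas R 7)
    (phi : form_field R 3 Y) (g : metric_field Y) (L : line_bundle Y)
    (D : cov_derivative L) :=
  forall i x, dom i x -> forall V, g2_dDT_form phi g D i x V = 0.

Definition spin7_F1 (R : realType) (X : atlas R (1 + 7))
    (Phi : form_field R 4 X) (g : metric_field X) (L : line_bundle X)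
    (D : cov_derivative L) (i : ix X) (x : 'rV[R]_(1 + 7))
  : form R R[i] 2 (1 + 7) :=
  let F := curvature D i x in
  extC (pi27 (Phi i x) (g i x)) (fun V =>
    F V + 6^-1 * extC (hodge (k := 6) (m := 2) (g i x))
                      (wedge (wedge F F) F) V).

Definition spin7_F2 (R : realType) (X : atlas R (1 + 7))
    (Phi : form_field R 4 X) (g : metric_field X) (L : line_bundle X)
    (D : cov_derivative L) (i : ix X) (x : 'rV[R]_(1 + 7))
  : form R R[i] 4 (1 + 7) :=
  let F := curvature D i x in
  extC (pi47 (Phi i x) (g i x)) (wedge F F).

Definition form_field_vanishes (R : realType) (k n : nat) (A : atlas R n)
    (w : ix A -> 'rV[R]_n -> form R R[i] k n) :=
  forall i x, dom i x -> forall V, w i x V = 0.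

(* Main.v *)
(** At a point, write F for the curvature on Y and beta = *_7 F^3 / 6.  The
    components of 4 F1 in an adapted frame are
      (4 F1)_{0d}  = beta_d + 1/2 F_ab phi_abd,
      (4 F1)_{cd}  = F_cd + 1/2 F_ab psi_abcd + beta_b phi_bcd,
    where psi = *_7 phi.  The first line is the Hodge dual of the G_2 equation,
    and by phi_abe phi_cde = d_ac d_bd - d_ad d_bc + psi_abcd the second line is
    the contraction of the first one with phi.  For F2, the space Lambda^4_7 is
    obtained from Phi by the derivations of antisymmetric matrices, and pairing
    F^2 with it produces F_ab beta_b once F_ab phi_abd = - 2 beta_d.  This
    vanishes because the antisymmetric 7 x 7 matrix (F_ab) has a kernel.

    On the cylinder, the Christoffel symbols are those of Y, and a form w is
    parallel along a direction a when w and w_x o (1 + t Gamma_a) have the same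
    one-jet; this property passes from phi to *_7 phi because the Hodge star is
    natural under linear maps.  The curvature is computed in a local frame of the
    line bundle, where it is d theta for the connection form theta. *)

Require Import Defs.
From mathcomp Require Import all_boot all_order all_fingroup all_algebra.
From mathcomp Require Import complex.
From mathcomp Require Import all_classical all_reals all_analysis.
From mathcomp Require Import ring lra zify.
Import Order.TTheory GRing.Theory Num.Theory.
Import numFieldNormedType.Exports.
Import Defs.

Set Implicit Arguments.
Unset Strict Implicit.
Unset Printing Implicit Defensive.

Local Open Scope classical_set_scope.
Local Open Scope ring_scope.
Local Open Scope complex_scope.

(** * Multilinear and alternating forms *)

(** Pointwise identities are moved to the model frame, where each form is an integer combination of
    monomials and identities between coefficients are decided by evaluation on finitely many
    multi-indices. What makes the move possible is that a contraction over all index functions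
    depends on its two families of vectors only through [A^T *m B]; the naturality of the Hodge star
    and of the inner product are instances of this. The obstacle for F2 is that [Lambda47] gathers
    the forms [lambda47 a] of every adapted frame, whereas the curvature is simple only in the frame
    of the product. Two adapted frames differ by an orthogonal matrix fixing the model 4-form. The
    formula for [lambda47] does not show how such a matrix acts on it, but a derivation by an
    antisymmetric matrix is merely conjugated; hence the detour through derivations. The Hodge star
    is a rational expression, with one square root, in the metric and the form. Its smoothness and
    its compatibility with parallel transport are therefore consequences of the same closure
    properties, applied once to [C^k] functions and once to one-jets of curves. *)

Section Multilinear.
Variables (R K : comNzRingType) (iota : {rmorphism R -> K}).

(** Arguments are real while values may be real or complex; the ring morphism [iota] lets one notion
    serve both cases. *)
Definition mlin k n (w : 'M[R]_(k, n) -> K) :=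
  forall (V V1 V2 : 'M[R]_(k, n)) (r : 'I_k) (b c : R),
    row r V = b *: row r V1 + c *: row r V2 ->
    row' r V1 = row' r V -> row' r V2 = row' r V ->
    w V = iota b * w V1 + iota c * w V2.

Definition altn k n (w : 'M[R]_(k, n) -> K) :=
  forall (s : 'S_k) V, w (row_perm s V) = (-1) ^+ s * w V.

Lemma row'P k n (r : 'I_k) (A B : 'M[R]_(k, n)) :
  row' r A = row' r B <-> forall i, i != r -> row i A = row i B.
Proof.
split=> [/matrixP H i|H].
  case: (unliftP r i) => [j ->|->]; last by rewrite eqxx.
  by move=> _; apply/rowP => c; have := H j c; rewrite !mxE.
apply/matrixP=> i j; rewrite !mxE.
by have /rowP/(_ j) := H (lift r i) (negbT (lift_eqF r i)); rewrite !mxE.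
Qed.

Lemma mlin_pull k n m (w : 'M[R]_(k, m) -> K) (B : 'M[R]_(n, m)) :
  mlin w -> mlin (fun V => w (V *m B)).
Proof.
move=> wl V V1 V2 r b c H1 H2 H3; apply: (wl _ _ _ r).
- by rewrite !row_mul H1 mulmxDl !scalemxAl.
- by apply/row'P => i ir; rewrite !row_mul; move/row'P: H2 => ->.
- by apply/row'P => i ir; rewrite !row_mul; move/row'P: H3 => ->.
Qed.

Lemma mlin_row0 k n (w : 'M[R]_(k, n) -> K) (V : 'M[R]_(k, n)) (r : 'I_k) :
  mlin w -> row r V = 0 -> w V = 0.
Proof.
move=> wl Vr; rewrite (wl V V V r 0 0) ?rmorph0 ?mul0r ?addr0 //.
by rewrite !scale0r addr0.
Qed.

Lemma mlinD k n (w1 w2 : 'M[R]_(k, n) -> K) :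
  mlin w1 -> mlin w2 -> mlin (fun V => w1 V + w2 V).
Proof.
move=> l1 l2 V V1 V2 r b c H1 H2 H3.
rewrite (l1 V V1 V2 r b c) // (l2 V V1 V2 r b c) //; ring.
Qed.

Lemma mlinZ k n a (w : 'M[R]_(k, n) -> K) : mlin w -> mlin (fun V => a * w V).
Proof. by move=> l V V1 V2 r b c H1 H2 H3; rewrite (l V V1 V2 r b c) //; ring. Qed.

Lemma mlin_sum k n (I : Type) (s : seq I) (P : pred I)
    (w : I -> 'M[R]_(k, n) -> K) :
  (forall i, P i -> mlin (w i)) -> mlin (fun V => \sum_(i <- s | P i) w i V).
Proof.
move=> l V V1 V2 r b c H1 H2 H3; rewrite !mulr_sumr -big_split /=.
by apply: eq_bigr => i Pi; apply: (l i Pi V V1 V2 r).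
Qed.

Lemma mlin_row_perm k n (s : 'S_k) (w : 'M[R]_(k, n) -> K) :
  mlin w -> mlin (fun V => w (row_perm s V)).
Proof.
have rowp (V : 'M[R]_(k, n)) i : row i (row_perm s V) = row (s i) V.
  by apply/rowP => c; rewrite !mxE.
move=> l V V1 V2 r b c H1 /row'P H2 /row'P H3.
apply: (l _ _ _ ((s^-1)%g r)).
- by rewrite !rowp permKV.
- apply/row'P => i ir; rewrite !rowp; apply: H2; apply: contra_neq ir => <-.
  by rewrite permK.
- apply/row'P => i ir; rewrite !rowp; apply: H3; apply: contra_neq ir => <-.
  by rewrite permK.
Qed.

Lemma mlin_colr p q n (w : 'M[R]_(p + q, n) -> K) (A : 'M[R]_(p, n)) :
  mlin w -> mlin (fun U : 'M[R]_(q, n) => w (col_mx A U)).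
Proof.
move=> l V V1 V2 r b c H1 /row'P H2 /row'P H3.
apply: (l _ _ _ (rshift p r)); first by rewrite !rowKd.
- apply/row'P => i; case: (split_ordP i) => j ->; rewrite ?rowKu ?rowKd //.
  by move=> jr; apply: H2; apply: contra_neq jr => ->.
- apply/row'P => i; case: (split_ordP i) => j ->; rewrite ?rowKu ?rowKd //.
  by move=> jr; apply: H3; apply: contra_neq jr => ->.
Qed.

Lemma mlin_coll p q n (w : 'M[R]_(p + q, n) -> K) (A : 'M[R]_(q, n)) :
  mlin w -> mlin (fun U : 'M[R]_(p, n) => w (col_mx U A)).
Proof.
move=> l V V1 V2 r b c H1 /row'P H2 /row'P H3.
apply: (l _ _ _ (lshift q r)); first by rewrite !rowKu.
- apply/row'P => i; case: (split_ordP i) => j ->; rewrite ?rowKu ?rowKd //.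
  by move=> jr; apply: H2; apply: contra_neq jr => ->.
- apply/row'P => i; case: (split_ordP i) => j ->; rewrite ?rowKu ?rowKd //.
  by move=> jr; apply: H3; apply: contra_neq jr => ->.
Qed.

Lemma mlin_tensor p q n (a : 'M[R]_(p, n) -> K) (b : 'M[R]_(q, n) -> K) :
  mlin a -> mlin b -> mlin (fun V => a (usubmx V) * b (dsubmx V)).
Proof.
move=> la lb V V1 V2 r x y H1 /row'P H2 /row'P H3.
have rowu i (U : 'M[R]_(p + q, n)) : row i (usubmx U) = row (lshift q i) U.
  by apply/rowP => c; rewrite !mxE.
have rowd i (U : 'M[R]_(p + q, n)) : row i (dsubmx U) = row (rshift p i) U.
  by apply/rowP => c; rewrite !mxE.
case: (split_ordP r) H1 H2 H3 => j -> H1 H2 H3.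
- have E W : (forall i, i != lshift q j -> row i W = row i V) ->
     dsubmx W = dsubmx V.
    by move=> H; apply/row_matrixP => i; rewrite !rowd H // eq_rlshift.
  rewrite (E _ H2) (E _ H3).
  rewrite (la (usubmx V) (usubmx V1) (usubmx V2) j x y) ?rowu //; first ring.
  + by apply/row'P => i ij; rewrite !rowu H2 // eq_lshift.
  + by apply/row'P => i ij; rewrite !rowu H3 // eq_lshift.
- have E W : (forall i, i != rshift p j -> row i W = row i V) ->
     usubmx W = usubmx V.
    by move=> H; apply/row_matrixP => i; rewrite !rowu H // eq_lrshift.
  rewrite (E _ H2) (E _ H3).
  rewrite (lb (dsubmx V) (dsubmx V1) (dsubmx V2) j x y) ?rowd //; first ring.
  + by apply/row'P => i ij; rewrite !rowd H2 // eq_rshift.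
  + by apply/row'P => i ij; rewrite !rowd H3 // eq_rshift.
Qed.

Lemma mlin_row n (w : 'M[R]_(1, n) -> K) (I : Type) (s : seq I) (a : I -> R) x :
  mlin w ->
  w (\sum_(i <- s) a i *: x i) = \sum_(i <- s) iota (a i) * w (x i).
Proof.
move=> l; elim: s => [|i s IH].
  by rewrite !big_nil; apply: (mlin_row0 (r := 0) l); rewrite linear0.
rewrite !big_cons -IH.
rewrite (l _ (x i) (\sum_(j <- s) a j *: x j) 0 (a i) 1) ?rmorph1 ?mul1r //.
- by rewrite linearD linearZ /= scale1r.
- by apply/row'P => j; rewrite ord1.
- by apply/row'P => j; rewrite ord1.
Qed.

(** Vanishing on a repeated row is stable under fixing some of the arguments and is the form used in
    [alternating_form]; the sign rule [altn] is the one needed to reindex sums over permutations.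
    Both are kept and converted when required. *)
Definition alt0 k n (w : 'M[R]_(k, n) -> K) :=
  forall (V : 'M[R]_(k, n)) (r1 r2 : 'I_k),
    r1 != r2 -> row r1 V = row r2 V -> w V = 0.

Lemma alt0_pull k n m (w : 'M[R]_(k, m) -> K) (B : 'M[R]_(n, m)) :
  alt0 w -> alt0 (fun V => w (V *m B)).
Proof. by move=> wa V r1 r2 r12 H; apply: (wa _ _ _ r12); rewrite !row_mul H. Qed.

Lemma alt0_colr p q n (w : 'M[R]_(p + q, n) -> K) (A : 'M[R]_(p, n)) :
  alt0 w -> alt0 (fun U : 'M[R]_(q, n) => w (col_mx A U)).
Proof.
move=> wa V r1 r2 r12 H; apply: (wa _ (rshift p r1) (rshift p r2)).
  by rewrite eq_rshift.
by rewrite !rowKd.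
Qed.

Lemma alt0_coll p q n (w : 'M[R]_(p + q, n) -> K) (A : 'M[R]_(q, n)) :
  alt0 w -> alt0 (fun U : 'M[R]_(p, n) => w (col_mx U A)).
Proof.
move=> wa V r1 r2 r12 H; apply: (wa _ (lshift q r1) (lshift q r2)).
  by rewrite eq_lshift.
by rewrite !rowKu.
Qed.

(** Polarisation: expanding the value on a matrix with [x + y] in both rows [i] and [j] gives the
    sign of a transposition, and every permutation is a product of transpositions. *)
Lemma alt0_altn k n (w : 'M[R]_(k, n) -> K) : mlin w -> alt0 w -> altn w.
Proof.
move=> wl wa.
have swap i j V : i != j -> w (row_perm (tperm i j) V) = - w V.
  move=> ij.
  pose S x y := \matrix_k (if k == i then x else if k == j then y else row k V).
  have Si x y : row i (S x y) = x by rewrite rowK eqxx.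
  have Sj x y : row j (S x y) = y by rewrite rowK eq_sym (negPf ij) eqxx.
  have Sk x y l : l != i -> l != j -> row l (S x y) = row l V.
    by move=> li lj; rewrite rowK (negPf li) (negPf lj).
  have Di x1 x2 y : w (S (x1 + x2) y) = w (S x1 y) + w (S x2 y).
    rewrite (wl _ (S x1 y) (S x2 y) i 1 1) ?rmorph1 ?mul1r //.
    + by rewrite !Si !scale1r.
    + by apply/row'P => l li; rewrite !rowK (negPf li).
    + by apply/row'P => l li; rewrite !rowK (negPf li).
  have Dj x y1 y2 : w (S x (y1 + y2)) = w (S x y1) + w (S x y2).
    rewrite (wl _ (S x y1) (S x y2) j 1 1) ?rmorph1 ?mul1r //.
    + by rewrite !Sj !scale1r.
    + by apply/row'P => l li; rewrite !rowK (negPf li).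
    + by apply/row'P => l li; rewrite !rowK (negPf li).
  have S0 x : w (S x x) = 0 by apply: (wa _ _ _ ij); rewrite Si Sj.
  have := S0 (row i V + row j V); rewrite Di !Dj !S0 add0r addr0.
  have -> : S (row i V) (row j V) = V.
    by apply/row_matrixP => l; rewrite rowK; case: (eqVneq l i) => [->|_] //; case: (eqVneq l j) => [->|].
  have -> : S (row j V) (row i V) = row_perm (tperm i j) V.
    apply/row_matrixP => l; rewrite rowK.
    have -> : row l (row_perm (tperm i j) V) = row (tperm i j l) V.
      by apply/rowP => c; rewrite !mxE.
    case: tpermP => [->|->|/eqP li /eqP lj]; rewrite ?eqxx //.
      by rewrite eq_sym (negPf ij).
    by rewrite (negPf li) (negPf lj).
  by move/eqP; rewrite addrC addr_eq0 => /eqP.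
move=> s; case/prod_tpermP: (s) => ts -> /=; elim: ts => [|t ts IH] /= H V.
  by rewrite big_nil odd_perm1 expr0 mul1r; congr w; apply/matrixP => i j; rewrite !mxE perm1.
case/andP: H => Ht Hts.
rewrite big_cons row_permM swap // IH // odd_mul_tperm Ht signr_addb expr1.
  by rewrite mulN1r mulNr.
Qed.

Lemma det_mlin k : @mlin k k (fun V => iota (\det V)).
Proof.
move=> V V1 V2 r b c H1 H2 H3.
by rewrite (determinant_multilinear H1 H2 H3) rmorphD !rmorphM.
Qed.

Lemma det_alt0 k : @alt0 k k (fun V => iota (\det V)).
Proof.
move=> V r1 r2 r12 H; rewrite (determinant_alternate r12) ?rmorph0 // => j.
by move/rowP/(_ j): H; rewrite !mxE.
Qed.

Definition joinf (T : Type) p q (f : 'I_p -> T) (g : 'I_q -> T) (i : 'I_(p + q)) :=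
  match fintype.split i with inl a => f a | inr b => g b end.

Lemma rowsub_join p q m n (f : 'I_p -> 'I_m) (g : 'I_q -> 'I_m) (A : 'M[R]_(m, n)) :
  rowsub (joinf f g) A = col_mx (rowsub f A) (rowsub g A).
Proof.
by apply/matrixP => i j; rewrite !mxE /joinf; case: splitP => l _; rewrite !mxE.
Qed.

Lemma big_ffun_split (T : finType) p q (G : {ffun 'I_(p + q) -> T} -> K) :
  \sum_f G f = \sum_(f : {ffun 'I_p -> T}) \sum_(g : {ffun 'I_q -> T})
                 G (finfun (joinf f g)).
Proof.
rewrite pair_big /= (reindex (fun fg : {ffun 'I_p -> T} * {ffun 'I_q -> T} =>
  finfun (joinf fg.1 fg.2))) //=.
exists (fun f => ([ffun i => f (lshift q i)], [ffun i => f (rshift p i)])).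
  move=> [f g] _ /=; congr pair; apply/ffunP => i; rewrite !ffunE /joinf.
    by rewrite (unsplitK (inl _ i)).
  by rewrite (unsplitK (inr _ i)).
move=> f _; apply/ffunP => i; rewrite ffunE /joinf /=.
by case: splitP => j ij; rewrite ffunE; congr (f _); apply: val_inj.
Qed.

Lemma big_ffun1 (T : finType) (G : {ffun 'I_1 -> T} -> K) :
  \sum_f G f = \sum_c G [ffun=> c].
Proof.
rewrite (reindex (fun c : T => [ffun _ : 'I_1 => c])) //=.
exists (fun f => f 0) => [c _|f _]; first by rewrite ffunE.
by apply/ffunP => i; rewrite ffunE (ord1 i).
Qed.

Lemma eq_rowsub k m n (f g : 'I_k -> 'I_m) (A : 'M[R]_(m, n)) :
  f =1 g -> rowsub f A = rowsub g A.
Proof. by move=> fg; apply/matrixP => i j; rewrite !mxE fg. Qed.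

(** Induction on the number of arguments: the first row is expanded in the standard basis, and the
    remaining rows form an argument of a multilinear map of one degree less. *)
Lemma mlin_expand k n (w : 'M[R]_(k, n) -> K) (V : 'M[R]_(k, n)) : mlin w ->
  w V = \sum_(h : {ffun 'I_k -> 'I_n})
          iota (\prod_r V r (h r)) * w (rowsub h 1%:M).
Proof.
elim: k => [|k IH] in w V * => l.
  rewrite (bigD1 [ffun i : 'I_0 => match i with Ordinal _ H => False_rect _ (notF (H : false)) end]) //= big_ord0.
  rewrite rmorph1 mul1r big1 ?addr0; first by congr w; apply/matrixP => -[].
  by move=> h /eqP[]; apply/ffunP => -[].
rewrite (@big_ffun_split 'I_n 1 k) big_ffun1.
rewrite -[V in LHS](vsubmxK (V : 'M[R]_(1 + k, n))).
have {1}-> : @usubmx R 1 k n V = \sum_c V 0 c *: delta_mx 0 c.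
  rewrite {1}[usubmx _]row_sum_delta; apply: eq_bigr => c _; congr (_ *: _).
  by rewrite mxE; congr (V _ c); apply: val_inj.
rewrite (mlin_row _ _ _ (@mlin_coll 1 k n w (@dsubmx R 1 k n V) l)).
apply: eq_bigr => c _.
rewrite (IH _ _ (@mlin_colr 1 k n w _ l)) mulr_sumr; apply: eq_bigr => h _.
rewrite mulrA -rmorphM; congr (iota _ * w _).
  rewrite big_ord_recl; congr (_ * _).
    by rewrite ffunE /joinf; case: splitP => // j _; rewrite ffunE.
  apply: eq_bigr => r _; rewrite ffunE /joinf mxE; congr (V _ _).
    exact: val_inj.
  case: splitP => [j|j]; first by rewrite ord1.
  by move/eqP; rewrite eqSS => /eqP/val_inj ->.
transitivity (rowsub (@joinf _ 1 k (fun=> c) h) (1%:M : 'M[R]_n)).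
  rewrite rowsub_join.
  suff -> : rowsub (fun=> c) (1%:M : 'M[R]_n) = delta_mx 0 c :> 'M[R]_(1, n) by [].
  by apply/matrixP => i j; rewrite !mxE (ord1 i) eqxx eq_sym.
apply/matrixP => i j; rewrite !mxE ffunE /joinf.
by case: fintype.split => // l'; rewrite ffunE.
Qed.

End Multilinear.

(** After expansion of both factors in the standard basis, the sum over [f] only involves the
    products of [A c i * B c j] over the slots. Distributivity turns it into a product of entries of
    [A^T *m B]. *)
Lemma sum_transfer (R K : comNzRingType) (iota : {rmorphism R -> K}) k n m N
    (a : 'M[R]_(k, n) -> K) (b : 'M[R]_(k, m) -> K)
    (A : 'M[R]_(N, n)) (B : 'M[R]_(N, m)) :
  mlin iota a -> mlin iota b ->
  \sum_(f : {ffun 'I_k -> 'I_N}) a (rowsub f A) * b (rowsub f B) =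
  \sum_(h : {ffun 'I_k -> 'I_n}) \sum_(h' : {ffun 'I_k -> 'I_m})
    a (rowsub h 1%:M) * b (rowsub h' 1%:M) *
    iota (\prod_r (A^T *m B) (h r) (h' r)).
Proof.
move=> la lb.
under eq_bigr => f _.
  rewrite (mlin_expand (rowsub f A) la) (mlin_expand (rowsub f B) lb).
  rewrite mulr_suml; under eq_bigr => h _ do rewrite mulr_sumr.
  over.
rewrite exchange_big; apply: eq_bigr => h _ /=.
rewrite exchange_big; apply: eq_bigr => h' _ /=.
have -> : \prod_r (A^T *m B) (h r) (h' r) =
  \sum_(f : {ffun 'I_k -> 'I_N}) \prod_r (A (f r) (h r) * B (f r) (h' r)).
  rewrite -(bigA_distr_bigA (fun r c => A c (h r) * B c (h' r))).
  by apply: eq_bigr => r _; rewrite mxE; apply: eq_bigr => c _; rewrite mxE.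
rewrite rmorph_sum mulr_sumr; apply: eq_bigr => f _.
rewrite big_split rmorphM /=.
have -> : \prod_r rowsub f A r (h r) = \prod_r A (f r) (h r).
  by apply: eq_bigr => r _; rewrite mxE.
have -> : \prod_r rowsub f B r (h' r) = \prod_r B (f r) (h' r).
  by apply: eq_bigr => r _; rewrite mxE.
ring.
Qed.

(** The two sides may run over index sets of different sizes. A linear map can thus be moved from
    one factor of a contraction to the other, and a contraction in R^8 of a form pulled back from
    R^7 can be computed in R^7. *)
Lemma sum_transfer_eq (R K : comNzRingType) (iota : {rmorphism R -> K})
    k n m N N' (a : 'M[R]_(k, n) -> K) (b : 'M[R]_(k, m) -> K)
    (A : 'M[R]_(N, n)) (B : 'M[R]_(N, m)) (A' : 'M[R]_(N', n))
    (B' : 'M[R]_(N', m)) :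
  mlin iota a -> mlin iota b -> A^T *m B = A'^T *m B' ->
  \sum_(f : {ffun 'I_k -> 'I_N}) a (rowsub f A) * b (rowsub f B) =
  \sum_(f : {ffun 'I_k -> 'I_N'}) a (rowsub f A') * b (rowsub f B').
Proof. by move=> la lb E; rewrite !(sum_transfer _ _ la lb) E. Qed.

(** * Wedge products, contractions and the Hodge star *)

Section WedgeHodge.
Variable (R : realType).

Section OverField.
Variables (K : numFieldType) (iota : {rmorphism R -> K}).

Lemma mlin_wedge p q n (a : form R K p n) (b : form R K q n) :
  mlin iota a -> mlin iota b -> mlin iota (wedge a b).
Proof.
move=> la lb; rewrite /wedge; apply: mlinZ; apply: mlin_sum => s _.
have := mlinZ ((-1) ^+ s) (mlin_row_perm s (mlin_tensor la lb)).
by under eq_fun do rewrite mulrA.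
Qed.

Lemma wedge_altn p q n (a : form R K p n) (b : form R K q n) : altn (wedge a b).
Proof.
move=> t V; rewrite /wedge mulrCA; congr (_ * _); rewrite mulr_sumr.
rewrite (reindex_inj (mulIg (t^-1)%g)) /=; apply: eq_bigr => s _.
by rewrite -row_permM mulgKV odd_permM odd_permV signr_addb [X in X * _ * _]mulrC -!mulrA.
Qed.

(** Swapping two equal rows gives [w V = - w V], and 2 is invertible in [K]. *)
Lemma altn_alt0 k n (w : 'M[R]_(k, n) -> K) : altn w -> alt0 w.
Proof.
move=> wa V r1 r2 r12 H; have := wa (tperm r1 r2) V.
have -> : row_perm (tperm r1 r2) V = V.
  apply/matrixP => i j; rewrite !mxE; move/rowP/(_ j): H; rewrite !mxE.
  by case: tpermP => [->|->|].
rewrite odd_tperm r12 expr1 mulN1r => /eqP; rewrite -addr_eq0 -mulr2n.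
by rewrite mulrn_eq0 => /eqP.
Qed.

Lemma alt0_wedge p q n (a : form R K p n) (b : form R K q n) : alt0 (wedge a b).
Proof. exact/altn_alt0/wedge_altn. Qed.

Lemma wedge_pull p q n m (a : form R K p m) (b : form R K q m) (B : 'M[R]_(n, m)) V :
  wedge a b (V *m B) = wedge (fun U => a (U *m B)) (fun U => b (U *m B)) V.
Proof.
rewrite /wedge; congr (_ * _); apply: eq_bigr => s _.
by rewrite row_permE mulmxA -row_permE -mul_usub_mx -mul_dsub_mx.
Qed.

Lemma rowsub_perm k n m (s : 'S_k) (f : 'I_k -> 'I_m) (A : 'M[R]_(m, n)) :
  row_perm s (rowsub f A) = rowsub (f \o s) A.
Proof. by apply/matrixP => i j; rewrite !mxE. Qed.

Lemma reindex_ffun_perm k (T : finType) (s : 'S_k) (G : {ffun 'I_k -> T} -> K) :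
  \sum_f G f = \sum_(f : {ffun 'I_k -> T}) G [ffun i => f (s i)].
Proof.
rewrite (reindex (fun f : {ffun 'I_k -> T} => [ffun i => f (s i)])) //=.
exists (fun f : {ffun 'I_k -> T} => [ffun i => f ((s^-1)%g i)]) => f _;
  by apply/ffunP => i; rewrite !ffunE ?permK ?permKV.
Qed.

(** Since [T] absorbs the sign of a permutation, the [(p + q)!] terms of the wedge product
    contribute equally to the contraction. *)
Lemma wedge_sum p q n (a : form R K p n) (b : form R K q n)
    (T : form R K (p + q) n) : altn T ->
  \sum_(f : {ffun 'I_(p + q) -> 'I_n}) wedge a b (rowsub f 1%:M) * T (rowsub f 1%:M) =
  ((p + q)`!)%:R / (p`! * q`!)%:R *
  \sum_(f : {ffun 'I_p -> 'I_n}) \sum_(g : {ffun 'I_q -> 'I_n})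
    a (rowsub f 1%:M) * b (rowsub g 1%:M) *
    T (col_mx (rowsub f 1%:M) (rowsub g 1%:M)).
Proof.
move=> Ta.
pose G (f : 'I_(p + q) -> 'I_n) := a (usubmx (rowsub f 1%:M)) *
  b (dsubmx (rowsub f 1%:M)) * T (rowsub f 1%:M).
have E f g : f =1 g -> G f = G g.
  by move=> fg; rewrite /G (@eq_rowsub R _ _ _ f g).
transitivity ((p`! * q`!)%:R^-1 * \sum_(s : 'S_(p + q))
   \sum_(f : {ffun 'I_(p + q) -> 'I_n}) G (f \o s)).
  rewrite exchange_big mulr_sumr /=; apply: eq_bigr => f _.
  rewrite /wedge -mulrA mulr_suml; congr (_ * _); apply: eq_bigr => s _.
  rewrite /G -rowsub_perm Ta.
  move: (a _) (b _) (T _) ((-1) ^+ s) => x y z u; ring.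
rewrite (eq_bigr (fun=> \sum_(f : {ffun 'I_(p + q) -> 'I_n}) G f)).
  rewrite sumr_const card_Sn -[X in _ * X]mulr_natl mulrA [_^-1 * _]mulrC.
  congr (_ * _); rewrite big_ffun_split; apply: eq_bigr => f _.
  apply: eq_bigr => g _; rewrite (E _ (joinf f g)); last by move=> i; rewrite ffunE.
  by rewrite /G rowsub_join col_mxKu col_mxKd.
move=> s _; rewrite [RHS](reindex_ffun_perm s); apply: eq_bigr => f _.
by apply: E => i; rewrite ffunE.
Qed.

(** The minor of [V] on the columns [m], which is the value of the monomial e^{m_1} /\ ... /\
    e^{m_k}. *)
Definition emon k n (m : 'I_k -> 'I_n) : form R R k n := fun V => \det (colsub m V).

Lemma emonE k n (m : 'I_k -> 'I_n) V : emon m V = \det (V *m (rowsub m 1%:M)^T).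
Proof.
congr (\det _); apply/matrixP => i j; rewrite !mxE (bigD1 (m j)) //= !mxE eqxx mulr1.
by rewrite big1 ?addr0 // => l lm; rewrite !mxE eq_sym (negPf lm) mulr0.
Qed.

Lemma mlin_emon k n (m : 'I_k -> 'I_n) : mlin iota (fun V => iota (emon m V)).
Proof.
under eq_fun do rewrite emonE.
exact: (mlin_pull _ (@det_mlin R K iota k)).
Qed.

Lemma alt0_emon k n (m : 'I_k -> 'I_n) : alt0 (fun V => iota (emon m V)).
Proof.
under eq_fun do rewrite emonE.
exact: (alt0_pull _ (@det_alt0 R K iota k)).
Qed.

(** In the Leibniz expansion of the minor, the term of a permutation [s] is nonzero only for
    [f = m \o s]; the alternation of [T] makes the [k!] surviving terms equal. *)
Lemma emon_sum k n (m : 'I_k -> 'I_n) (T : form R K k n) : altn T ->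
  \sum_(f : {ffun 'I_k -> 'I_n}) iota (emon m (rowsub f 1%:M)) * T (rowsub f 1%:M)
  = (k`!)%:R * T (rowsub m 1%:M).
Proof.
move=> Ta; rewrite -card_Sn mulr_natl -sumr_const.
under eq_bigr => f _ do rewrite /emon /determinant rmorph_sum mulr_suml.
rewrite exchange_big /=; apply: eq_bigr => s _.
rewrite (bigD1 [ffun i => m (s i)]) //= [X in _ + X]big1 ?addr0.
  rewrite [X in iota (_ * X)]big1 => [|i _]; last by rewrite !mxE ffunE eqxx.
  rewrite mulr1 rmorph_sign (@eq_rowsub R _ _ _ _ (m \o s)); last by move=> i; rewrite ffunE.
  by rewrite -rowsub_perm Ta mulrA -signr_addb addbb mul1r.
move=> f fm; have [i fi] : exists i, f i != m (s i).
  apply/existsP; rewrite -negb_forall; apply: contra fm => /forallP H.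
  by apply/eqP/ffunP => i; rewrite ffunE; apply/eqP.
by rewrite (bigD1 i) //= !mxE (negPf fi) mul0r mulr0 rmorph0 mul0r.
Qed.

(** Averaging [mlin_expand] over all permutations of the rows turns each product of entries into a
    determinant. *)
Lemma altn_expand k n (w : form R K k n) (V : 'M[R]_(k, n)) :
  mlin iota w -> altn w ->
  w V = (k`!)%:R^-1 * \sum_(f : {ffun 'I_k -> 'I_n}) w (rowsub f 1%:M) * iota (emon f V).
Proof.
move=> wl wa; have k0 : (k`!)%:R != 0 :> K by rewrite pnatr_eq0 -lt0n fact_gt0.
apply: (mulfI k0); rewrite mulVKf // -card_Sn mulr_natl -sumr_const.
transitivity (\sum_(s : 'S_k) (-1) ^+ s * w (row_perm s V)).
  by apply: eq_bigr => s _; rewrite wa mulrA -signr_addb addbb mul1r.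
under eq_bigr => s _ do rewrite (mlin_expand _ wl) mulr_sumr.
rewrite exchange_big /=; apply: eq_bigr => f _.
rewrite /emon -det_tr /determinant rmorph_sum mulr_sumr; apply: eq_bigr => s _.
rewrite [in RHS]rmorphM rmorph_sign /= [RHS]mulrC -mulrA; congr (_ * (_ * _)).
by apply: (f_equal iota); apply: eq_bigr => i _; rewrite !mxE.
Qed.

End OverField.

Section RealForms.

Let idR : {rmorphism R -> R} := idfun.

(** For fixed [V], the minor [emon f V] is an alternating function [T] of the basis vectors e_f, by
    transposition of the determinant. Contracting with [T] evaluates the wedge product, and
    [emon_sum], applied to each factor, leaves the single index function [joinf m1 m2]. *)
Lemma wedge_emon p q n (m1 : 'I_p -> 'I_n) (m2 : 'I_q -> 'I_n) V :
  wedge (emon m1) (emon m2) V = emon (joinf m1 m2) V.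
Proof.
have l1 : mlin idR (wedge (emon m1) (emon m2)).
  by apply: mlin_wedge; apply: mlin_emon.
rewrite (altn_expand V l1 (wedge_altn _ _)).
pose T (X : 'M[R]_(p + q, n)) := \det (X *m V^T).
have TE (f : 'I_(p + q) -> 'I_n) : emon f V = T (rowsub f 1%:M).
  by rewrite /T emonE -[LHS]det_tr trmx_mul trmxK.
have Tl : mlin idR T := mlin_pull _ (@det_mlin R R idR _).
have T0 : alt0 T := alt0_pull _ (@det_alt0 R R idR _).
have Ta := alt0_altn Tl T0.
under eq_bigr => f _ do rewrite TE.
rewrite wedge_sum // TE rowsub_join mulrA.
under eq_bigr => f _.
  under eq_bigr => g _ do rewrite -mulrA.
  rewrite -mulr_sumr (@emon_sum R idR _ _ _ (fun U => T (col_mx _ U))).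
  rewrite mulrCA; over.
  apply: (alt0_altn (iota := idR)); last exact: alt0_colr.
  exact: mlin_colr.
rewrite -mulr_sumr (@emon_sum R idR _ _ _ (fun U => T (col_mx U _))); last first.
  apply: (alt0_altn (iota := idR)); last exact: alt0_coll.
  exact: mlin_coll.
rewrite !mulrA -[RHS]mul1r; congr (_ * _); rewrite natrM.
field; rewrite !pnatr_eq0 -!lt0n !fact_gt0 //.
Qed.

Lemma wedge_pull_eq p q n (K : fieldType) (a a' : form R K p n) (b b' : form R K q n) V :
  a =1 a' -> b =1 b' -> wedge a b V = wedge a' b' V.
Proof. by move=> /funext -> /funext ->. Qed.

Lemma dx_emon n (i : 'I_n) V : dx i V = emon (fun _ : 'I_1 => i) V :> R.
Proof. by rewrite /emon det_mx11 !mxE. Qed.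

Lemma mlin_idC k n (iota : {rmorphism R -> R[i]%C}) (w : form R R k n) :
  mlin idR w -> mlin iota (fun V => iota (w V)).
Proof.
by move=> l V V1 V2 r b c H1 H2 H3; rewrite (l V V1 V2 r b c) // rmorphD !rmorphM.
Qed.

Lemma rowsub_mul k m n (f : 'I_k -> 'I_m) p (A : 'M[R]_(m, n)) (B : 'M[R]_(n, p)) :
  rowsub f (A *m B) = rowsub f A *m B.
Proof. by apply/matrixP => i j; rewrite !mxE; apply: eq_bigr => l _; rewrite !mxE. Qed.

Lemma hodge1E k m (b : form R R k (k + m)) V :
  hodge 1%:M b V = (k`!)%:R^-1 * \sum_(f : {ffun 'I_k -> 'I_(k + m)})
     b (rowsub f 1%:M) * \det (col_mx (rowsub f 1%:M) V).
Proof.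
rewrite /hodge invmx1 det1 sqrtr1; congr (_ * _).
by apply: eq_bigr => f _; rewrite mul1r.
Qed.

Lemma mlin_hodge k m (G : 'M[R]_(k + m)) (b : form R R k (k + m)) :
  mlin idR (hodge G b).
Proof.
apply/mlinZ/mlin_sum => f _; apply/mlinZ/mlinZ.
exact: (mlin_colr _ (@det_mlin R R idR _)).
Qed.

Lemma alt0_hodge k m (G : 'M[R]_(k + m)) (b : form R R k (k + m)) :
  alt0 (hodge G b).
Proof.
move=> V r1 r2 r12 H; rewrite /hodge big1 ?mulr0 // => f _.
have := alt0_colr (rowsub f 1%:M) (@det_alt0 R R idR (k + m)) r12 H.
by rewrite /= => ->; rewrite !mulr0.
Qed.

(** The frame is not assumed orthonormal: [M] is the Gram matrix of its rows. This generality is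
    needed for changes of charts and for the linear maps [1 + t A], which are not isometries. *)
Lemma hodge_frame k m (G E M : 'M[R]_(k + m)) (b : form R R k (k + m)) V :
  mlin idR b -> E *m G *m E^T = M -> 0 < \det E -> 0 < \det M ->
  hodge G (in_frame E b) V = in_frame E (hodge M b) V.
Proof.
move=> bl EGE dE dM; have uE : E \in unitmx by rewrite unitmxE unitfE gt_eqF.
have uM : M \in unitmx by rewrite unitmxE unitfE gt_eqF.
have GE : G = invmx E *m M *m (invmx E)^T.
  by rewrite -EGE !mulmxA mulVmx // mul1mx -mulmxA -trmx_mul mulVmx // trmx1 mulmx1.
have uG : G \in unitmx.
  by rewrite GE !unitmx_mul unitmx_tr unitmx_inv uE uM.
have iG : invmx G = E^T *m invmx M *m E.
  apply: (can_inj (mulKmx uG)); rewrite mulmxV // GE.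
  rewrite -!mulmxA [(invmx E)^T *m _]mulmxA -trmx_mul mulmxV // trmx1 mul1mx.
  by rewrite [M *m _]mulmxA mulmxV // mul1mx mulVmx.
have dG : Num.sqrt (\det G) = (\det E)^-1 * Num.sqrt (\det M).
  rewrite GE !det_mulmx det_tr det_inv mulrAC sqrtrM ?sqrtr_sqr.
  - by rewrite ger0_norm // invr_ge0 ltW.
  - by rewrite -expr2 sqr_ge0.
rewrite /in_frame /hodge; congr (_ * _).
pose T (U : 'M[R]_(k, k + m)) := Num.sqrt (\det M) * \det (col_mx U (V *m invmx E)).
have Tl : mlin idR T.
  apply: mlinZ; exact: (mlin_coll _ (@det_mlin R R idR _)).
rewrite [RHS](eq_bigr (fun f : {ffun 'I_k -> 'I_(k + m)} => b (rowsub f (invmx M)) * T (rowsub f 1%:M))); last by [].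
(* Both pairs of families have the same product [A^T *m B], namely [invmx M]; the frame passes from
   the raised indices of [b] to the determinant. *)
rewrite (@sum_transfer_eq R R idR k _ _ _ _ b T (invmx M) 1%:M (E^T *m invmx M) (invmx E)) //; last first.
  rewrite mulmx1 trmx_mul trmxK -mulmxA mulmxV // mulmx1 //.
apply: eq_bigr => f _; rewrite /T; congr (b _ * _).
  by rewrite -rowsub_mul iG mulmxK.
have -> : col_mx (rowsub f (invmx E)) (V *m invmx E) = col_mx (rowsub f 1%:M) V *m invmx E.
  by rewrite mul_col_mx -rowsub_mul mul1mx.
by rewrite dG det_mulmx det_inv; ring.
Qed.

Lemma form_inner_frame k n (G E : 'M[R]_n) (a b : form R R k n) :
  mlin idR a -> mlin idR b -> oriented_orthonormal G E ->
  form_inner G (in_frame E a) (in_frame E b) = form_inner 1%:M a b.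
Proof.
move=> al bl [dE EGE]; have uE : E \in unitmx by rewrite unitmxE unitfE gt_eqF.
have GE : G = invmx E *m (invmx E)^T.
  have := congr1 (fun X => invmx E *m X *m (invmx E)^T) EGE.
  by rewrite mulmx1 !mulmxA mulVmx // mul1mx -mulmxA -trmx_mul mulVmx // trmx1 mulmx1.
have uG : G \in unitmx by rewrite GE !unitmx_mul unitmx_tr unitmx_inv uE.
have iG : invmx G = E^T *m E.
  apply: (can_inj (mulKmx uG)); rewrite mulmxV // GE.
  rewrite -!mulmxA [(invmx E)^T *m _]mulmxA -trmx_mul mulmxV // trmx1 mul1mx mulVmx //.
rewrite /form_inner /in_frame invmx1; congr (_ * _).
under eq_bigr => f _ do rewrite -!rowsub_mul iG mulmxK // mul1mx.
apply: (@sum_transfer_eq R R idR) => //.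
by rewrite trmxK mulmxV // trmx1 mulmx1.
Qed.

End RealForms.
End WedgeHodge.

(** * Components of the model forms *)

(* [dt m s] is the determinant of the matrix [(s_i == m_j)], i.e. the value of
   the monomial [e^m] on the basis vectors [e_s].  It is an integer, so identities
   between components of the model forms can be checked by computation. *)
Fixpoint dt (m s : seq nat) : int :=
  if s is a :: s' then
    if a \in m then
      if odd (index a m) then - dt (rem a m) s' else dt (rem a m) s'
    else 0
  else if m is [::] then 1 else 0.

(** Indices are natural numbers and not ordinals, so that the tables below can be evaluated; the
    bounds reappear as [all] hypotheses. *)
Definition bas (R : realType) k n (s : seq nat) : 'M[R]_(k, n.+1) :=
  rowsub (fun i : 'I_k => inord (nth 0%N s i)) 1%:M.

Definition emonl (R : realType) k n (m : seq nat) : form R R k n.+1 :=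
  emon (fun i : 'I_k => inord (nth 0%N m i)).

Section Tables.
Variable (R : realType).

Lemma nth_rem (m : seq nat) a j : a \in m -> (j < (size m).-1)%N ->
  nth 0%N (rem a m) j = nth 0%N m (bump (index a m) j).
Proof.
move=> am jm; rewrite remE nth_cat size_take index_mem am nth_drop.
rewrite /bump; case: ltnP => ij; first by rewrite nth_take // leqNgt ij.
by rewrite addSn subnKC.
Qed.

(** Laplace expansion along the first row, which has at most one nonzero entry because [m] has no
    repetition; the position of that entry gives the sign. *)
Lemma det_dt k (m s : seq nat) : size m = k -> size s = k -> uniq m ->
  \det (\matrix_(i < k, j < k) (nth 0%N s i == nth 0%N m j)%:R) = (dt m s)%:~R :> R.
Proof.
elim: s m k => [|a s IH] m k /=.
  by case: m => [|? ?]; case: k => [|k] // _ _ _; rewrite det_mx00.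
case: k => // k sm [sk] um; subst k.
rewrite (expand_det_row _ ord0); case: ifP => am; last first.
  rewrite big1 // => j _; rewrite mxE /=; case: eqP => [e|]; last by rewrite mul0r.
  by rewrite e mem_nth ?sm ?ltn_ord // in am.
have im : (index a m < (size s).+1)%N by rewrite -sm index_mem.
rewrite (bigD1 (Ordinal im)) //= big1 ?addr0; last first.
  move=> j /eqP ji; rewrite mxE /=; case: eqP => [e|]; last by rewrite mul0r.
  by case: ji; apply: val_inj; rewrite /= e index_uniq // sm.
rewrite mxE /= nth_index // eqxx mul1r /cofactor /= add0n.
have E : row' ord0 (col' (Ordinal im)
   (\matrix_(i < (size s).+1, j < (size s).+1) (nth 0%N (a :: s) i == nth 0%N m j)%:R))
   = \matrix_(i < size s, j < size s) (nth 0%N s i == nth 0%N (rem a m) j)%:R :> 'M[R]__.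
  apply/matrixP => i j; rewrite !mxE /= nth_rem // ?sm //.
rewrite E (IH (rem a m)) ?rem_uniq ?size_rem ?sm // -signr_odd.
by case: odd; rewrite ?expr1 ?expr0 ?mul1r // mulN1r rmorphN.
Qed.

Lemma emonl_bas k n (m s : seq nat) : size m = k -> size s = k -> uniq m ->
  all (fun a => a < n.+1)%N m -> all (fun a => a < n.+1)%N s ->
  emonl (R := R) m (bas R k n s) = (dt m s)%:~R.
Proof.
move=> sm ss um am as_; rewrite -(det_dt sm ss um); congr (\det _).
apply/matrixP => i j; rewrite !mxE -val_eqE /= !inordK //.
  by apply: (allP am); rewrite mem_nth ?sm.
by apply: (allP as_); rewrite mem_nth ?ss.
Qed.

Lemma det_bas n (s : seq nat) : size s = n.+1 -> all (fun a => a < n.+1)%N s ->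
  \det (bas R n.+1 n s) = (dt (iota 0 n.+1) s)%:~R.
Proof.
move=> ss sa; rewrite -(@emonl_bas n.+1 n) ?size_iota ?iota_uniq //; last first.
  by apply/allP => i; rewrite mem_iota add0n.
congr (\det _); apply/matrixP => i j; rewrite !mxE; congr (_ == _)%:R.
by rewrite nth_iota // add0n inord_val.
Qed.

Lemma col_bas p q n (s t : seq nat) : size s = p ->
  col_mx (bas R p n s) (bas R q n t) = bas R (p + q) n (s ++ t).
Proof.
move=> ss; apply/matrixP => i j; rewrite !mxE nth_cat ss.
case: splitP => l il; rewrite !mxE il ?ltn_ord //.
by rewrite addKn.
Qed.

Lemma ffun_bas k n (f : {ffun 'I_k -> 'I_n.+1}) :
  rowsub f 1%:M = bas R k n [seq val (f i) | i <- enum 'I_k].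
Proof.
apply/matrixP => i j; rewrite !mxE (nth_map i) ?size_enum_ord // nth_ord_enum.
by rewrite inord_val.
Qed.

Lemma sum_bas1 (K : comNzRingType) n (G : 'M[R]_(1, n.+1) -> K) :
  \sum_(f : {ffun 'I_1 -> 'I_n.+1}) G (rowsub f 1%:M) =
  \sum_(a < n.+1) G (bas R 1 n [:: val a]).
Proof.
rewrite big_ffun1; apply: eq_bigr => a _; congr G.
by apply/matrixP => i j; rewrite !mxE ffunE (ord1 i) /= inord_val.
Qed.

Lemma sum_basS (K : comNzRingType) k n (G : 'M[R]_(1 + k, n.+1) -> K) :
  \sum_(f : {ffun 'I_(1 + k) -> 'I_n.+1}) G (rowsub f 1%:M) =
  \sum_(a < n.+1) \sum_(f : {ffun 'I_k -> 'I_n.+1})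
    G (col_mx (bas R 1 n [:: val a]) (rowsub f 1%:M)).
Proof.
rewrite big_ffun_split.
rewrite -(@sum_bas1 K n (fun U => \sum_(f : {ffun 'I_k -> 'I_n.+1}) G (col_mx U (rowsub f 1%:M)))).
apply: eq_bigr => f _; apply: eq_bigr => g _; rewrite -rowsub_join; congr G.
by apply: eq_rowsub => i; rewrite ffunE.
Qed.

Lemma sum_bas2 (K : comNzRingType) n (G : 'M[R]_(2, n.+1) -> K) :
  \sum_(f : {ffun 'I_2 -> 'I_n.+1}) G (rowsub f 1%:M) =
  \sum_(a < n.+1) \sum_(b < n.+1) G (bas R 2 n [:: val a; val b]).
Proof.
rewrite (@sum_basS K 1); apply: eq_bigr => a _.
rewrite (@sum_bas1 K n (fun U => G (col_mx (bas R 1 n [:: val a]) U))).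
by apply: eq_bigr => b _; rewrite col_bas.
Qed.

(* A list of pairs [(c, m)] encodes the sum of the forms [c e^m]. *)
Definition combo k n (l : seq (int * seq nat)) : form R R k n.+1 :=
  fun V => \sum_(x <- l) x.1%:~R * emonl x.2 V.

Definition comboi (l : seq (int * seq nat)) (s : seq nat) : int :=
  foldr (fun x r => x.1 * dt x.2 s + r) 0 l.

Definition okl k n (l : seq (int * seq nat)) :=
  all (fun x => [&& size x.2 == k, uniq x.2 & all (fun a => a < n.+1)%N x.2]) l.

Lemma combo_bas k n l s : okl k n l -> size s = k -> all (fun a => a < n.+1)%N s ->
  combo l (bas R k n s) = (comboi l s)%:~R.
Proof.
move=> lo ss sa; rewrite /combo; elim: l lo => [|x l IH] /=.
  by rewrite big_nil.
move=> /andP[/and3P[/eqP x1 x2 x3] lo]; rewrite big_cons IH //.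
by rewrite emonl_bas // rmorphD rmorphM.
Qed.

Lemma combo_mlin k n l : mlin (idfun : {rmorphism R -> R}) (combo (k := k) (n := n) l).
Proof. by apply: mlin_sum => x _; apply: mlinZ; apply: (mlin_emon (idfun : {rmorphism R -> R})). Qed.

Lemma combo_alt0 k n l : alt0 (combo (k := k) (n := n) l).
Proof.
move=> V r1 r2 r12 H; rewrite /combo big1 // => x _.
have /= := @alt0_emon R R (idfun : {rmorphism R -> R}) k n.+1 _ V r1 r2 r12 H.
by rewrite /emonl => ->; rewrite mulr0.
Qed.

Lemma combo_altn k n l : altn (combo (k := k) (n := n) l).
Proof. by apply: (alt0_altn (iota := (idfun : {rmorphism R -> R}))); [exact: combo_mlin|exact: combo_alt0]. Qed.

Lemma combo_sum (K : numFieldType) (iota : {rmorphism R -> K}) k n l (T : form R K k n.+1) :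
  altn T ->
  \sum_(f : {ffun 'I_k -> 'I_n.+1}) iota (combo l (rowsub f 1%:M)) * T (rowsub f 1%:M) =
  (k`!)%:R * \sum_(x <- l) x.1%:~R * T (bas R k n x.2).
Proof.
move=> Ta; under eq_bigr => f _ do rewrite /combo rmorph_sum mulr_suml.
rewrite exchange_big mulr_sumr; apply: eq_bigr => x _ /=.
under eq_bigr => f _ do rewrite rmorphM rmorph_int -mulrA.
by rewrite -mulr_sumr (emon_sum iota _ Ta) mulrCA.
Qed.

(** The indices 1 to 7 of the literature are shifted to 0 to 6. On the cylinder they are shifted
    back by [S], and 0 becomes the circle direction. *)
Definition phiL : seq (int * seq nat) :=
  [:: (1, [:: 0; 1; 2]%N); (1, [:: 0; 3; 4]%N); (1, [:: 0; 5; 6]%N); (1, [:: 1; 3; 5]%N);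
      (-1, [:: 1; 4; 6]%N); (-1, [:: 2; 3; 6]%N); (-1, [:: 2; 4; 5]%N)].

Lemma e3E i j k V :
  e3 i j k V = emonl [:: i.-1; j.-1; k.-1] V :> R.
Proof.
rewrite /e3.
have E1 : wedge (dx (inord i.-1)) (dx (inord j.-1)) =1
   emon (joinf (fun _ : 'I_1 => inord i.-1) (fun _ : 'I_1 => inord j.-1)) :> form R R 2 7.
  move=> U; rewrite -wedge_emon; apply: wedge_pull_eq => W; exact: dx_emon.
rewrite (wedge_pull_eq _ E1 (@dx_emon R _ _)) wedge_emon.
congr (\det _); apply/matrixP => a b; rewrite !mxE; congr (V _ _).
by rewrite /joinf; case: splitP => [c ->|c ->];
   [case: splitP => d ->; rewrite (ord1 d)|rewrite (ord1 c)].
Qed.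

Lemma phi0E V : @phi0 R V = combo phiL V.
Proof.
rewrite /combo /phi0 !e3E unlock /= !mul1r !mulN1r; ring.
Qed.

Definition psiL : seq (int * seq nat) :=
  [:: (1, [:: 3; 4; 5; 6]%N); (1, [:: 1; 2; 5; 6]%N); (1, [:: 1; 2; 3; 4]%N); (1, [:: 0; 2; 4; 6]%N);
      (-1, [:: 0; 2; 3; 5]%N); (-1, [:: 0; 1; 4; 5]%N); (-1, [:: 0; 1; 3; 6]%N)].

(* The value at [e_s] of the Hodge star on R^n of the form encoded by [l]. *)
Definition kt n (l : seq (int * seq nat)) s : int :=
  foldr (fun x r => x.1 * dt (iota 0 n) (x.2 ++ s) + r) 0 l.

Definition all3 n (P : nat -> nat -> nat -> bool) :=
  all (fun a => all (fun b => all (P a b) (iota 0 n)) (iota 0 n)) (iota 0 n).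
Definition all4 n (P : nat -> nat -> nat -> nat -> bool) :=
  all (fun a => all3 n (P a)) (iota 0 n).

(** Applied to [iota 0 n], this lists the increasing multi-indices, on which an alternating form is
    determined. *)
Fixpoint subs (k : nat) (l : seq nat) : seq (seq nat) :=
  match k, l with
  | 0, _ => [:: [::]]
  | _.+1, [::] => [::]
  | k'.+1, x :: l' => map (cons x) (subs k' l') ++ subs k l'
  end%N.

Lemma subsP k l s : (s \in subs k l) = subseq s l && (size s == k).
Proof.
elim: l k s => [|x l IH] [|k] [|a s] //=; rewrite ?mem_cat ?inE ?andbF //.
  by rewrite IH /= andbF orbF; apply/mapP => -[].
rewrite IH eqSS; case: (eqVneq a x) => [->|ax].
  have -> : (x :: s \in [seq x :: i | i <- subs k l]) = (s \in subs k l).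
    by apply: mem_map => u v [].
  rewrite IH; case: eqP => // _; rewrite ?andbT ?andbF //.
  case: (boolP (subseq s l)) => // ns; apply: contraNF ns => xs.
  exact: subseq_trans (subseq_cons s x) xs.
case: mapP => [[y _ [e]]|//]; by rewrite e eqxx in ax.
Qed.

(* [phit] and [Phit] are the components of [phi0] and of [*Phi0 = Phi0]; [ipsiL j]
   and [lamL j] encode [i(e_j) psi0] and [lambda47 e_j]; [dertab p q s] is the
   component at [e_s] of the image of [Phi0] under the derivation of the elementary
   antisymmetric matrix at [p, q], and [ctab p q] are its coefficients on the
   [lambda47 e_j]. *)
Definition phit (b c d : nat) := comboi phiL [:: b; c; d].
Definition PhiL : seq (int * seq nat) :=
  [seq (x.1, 0%N :: map S x.2) | x <- phiL] ++ [seq (x.1, map S x.2) | x <- psiL].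
Definition Phit s := kt 8 PhiL s.
(** The interior product inserts [e_j] in the first slot; the sign is that of moving e^j to the
    front of the monomial. *)
Definition rmsg j (x : int * seq nat) : int * seq nat :=
  (if odd (index j x.2) then - x.1 else x.1, rem j x.2).
Definition ipsiL j := [seq rmsg j x | x <- psiL & j \in x.2].
Definition lamL j : seq (int * seq nat) :=
  [seq (x.1, 0%N :: map S x.2) | x <- ipsiL j] ++
  [seq (- x.1, map S (j :: x.2)) | x <- phiL & j \notin x.2].

Definition delta (a b : nat) : int := if a == b then 1 else 0.

Definition dertab p q s : int :=
  foldr (fun r z => (if nth 0%N s r == p then comboi PhiL (set_nth 0%N s r q) else 0)
                  - (if nth 0%N s r == q then comboi PhiL (set_nth 0%N s r p) else 0) + z)
     0 (iota 0 4).

Definition ctab (p q j : nat) : int := match p, q with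
  | 0, 0 => 0
  | 0, q'.+1 => delta q' j
  | p'.+1, 0 => - delta p' j
  | p'.+1, q'.+1 => phit p' q' j end%N.

(** * Identities between structure constants, by evaluation *)

Lemma psi_tab : all (fun s => kt 7 phiL s == comboi psiL s) (subs 4 (iota 0 7)).
Proof. by vm_compute. Qed.
Lemma starpsi_tab : all3 7 (fun a b d => kt 7 psiL [:: a; b; d] == phit a b d).
Proof. by vm_compute. Qed.
Lemma Phi0bcd_tab : all3 7 (fun b c d => Phit [:: 0; b.+1; c.+1; d.+1]%N == phit b c d).
Proof. by vm_compute. Qed.
Lemma Phiab0d_tab : all3 7 (fun a b d => Phit [:: a.+1; b.+1; 0; d.+1]%N == phit a b d).
Proof. by vm_compute. Qed.
Lemma Phi0b0d_tab : all (fun a => all (fun b => Phit [:: 0; a; 0; b]%N == 0) (iota 0 8)) (iota 0 8).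
Proof. by vm_compute. Qed.
Lemma Phi_swap_tab : all3 8 (fun b c d => Phit [:: b; 0; c; d]%N == - Phit [:: 0; b; c; d]%N).
Proof. by vm_compute. Qed.
Lemma phi_phi_tab : all4 7 (fun a b c d =>
  delta a c * delta b d - delta a d * delta b c + Phit [:: a.+1; b.+1; c.+1; d.+1]%N ==
  foldr (fun e z => phit a b e * phit e c d + z) 0 (iota 0 7)).
Proof. by vm_compute. Qed.
Lemma ipsi_tab : all (fun j => all (fun s => comboi psiL (j :: s) == comboi (ipsiL j) s)
  (subs 3 (iota 0 7))) (iota 0 7).
Proof. by vm_compute. Qed.
(** On arguments tangent to [Y] the summand containing e^0 vanishes, so only [- e^j /\ phi] remains,
    written out by the slot that receives e^j. *)
Lemma lam_tab : all (fun j => all4 7 (fun a b c d => comboi (lamL j) [:: a.+1; b.+1; c.+1; d.+1]%N ==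
   - (delta j a * phit b c d - delta j b * phit a c d + delta j c * phit a b d - delta j d * phit a b c))) (iota 0 7).
Proof. by vm_compute. Qed.
Lemma phi_cycle_tab : all3 7 (fun a b c => phit a b c == phit c a b).
Proof. by vm_compute. Qed.
(** The antisymmetric matrices that annihilate the model 4-form are those of spin(7), of codimension
    7 in so(8). The coefficients [ctab] describe the quotient map from so(8) to R^7: the identity on
    e_0 /\ e_q, and the cross product defined by phi on e_p /\ e_q. *)
Lemma der_tab : all (fun p => all (fun q => all (fun s => dertab p q s ==
  foldr (fun j z => ctab p q j * comboi (lamL j) s + z) 0 (iota 0 7))
  (subs 4 (iota 0 8))) (iota 0 8)) (iota 0 8).
Proof. by vm_compute. Qed.
Lemma okl_lam : all (fun j => okl 4 7 (lamL j) && okl 3 6 (ipsiL j)) (iota 0 7).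
Proof. by vm_compute. Qed.
(** Moving [e_d] from the last of seven places to place [d] costs [6 - d] transpositions, whose
    parity is that of [d]. *)
Lemma cofactor_tab : all (fun d => all (fun s => dt (iota 0 7) (s ++ [:: d]) ==
  (if odd d then -1 else 1) * dt (rem d (iota 0 7)) s) (subs 6 (iota 0 7))) (iota 0 7).
Proof. by vm_compute. Qed.

Lemma all_ltn n (P : nat -> bool) a : all P (iota 0 n) -> (a < n)%N -> P a.
Proof. by move=> /allP H an; apply: H; rewrite mem_iota. Qed.

Lemma all3E n P a b c : all3 n P -> (a < n)%N -> (b < n)%N -> (c < n)%N -> P a b c.
Proof.
by move=> H an bn cn; move: H => /all_ltn/(_ an)/all_ltn/(_ bn)/all_ltn/(_ cn).
Qed.

Lemma all4E n P a b c d : all4 n P ->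
  (a < n)%N -> (b < n)%N -> (c < n)%N -> (d < n)%N -> P a b c d.
Proof. by move=> /all_ltn H an; move: (H _ an); apply: all3E. Qed.

Let idR : {rmorphism R -> R} := idfun.

Lemma mem_subs k n s : s \in subs k (iota 0 n) -> size s = k /\ all (fun a => a < n)%N s.
Proof.
rewrite subsP => /andP[/mem_subseq H /eqP]; split=> //.
by apply/allP => i /H; rewrite mem_iota.
Qed.

Section Ext.
Variables (K : numFieldType) (iota : {rmorphism R -> K}).

Lemma mlin_ext k n (w1 w2 : form R K k n.+1) : mlin iota w1 -> mlin iota w2 ->
  (forall s, size s = k -> all (fun a => a < n.+1)%N s ->
     w1 (bas R k n s) = w2 (bas R k n s)) -> w1 =1 w2.
Proof.
move=> l1 l2 H V; rewrite (mlin_expand V l1) (mlin_expand V l2).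
apply: eq_bigr => h _; congr (_ * _); rewrite ffun_bas H //.
  by rewrite size_map size_enum_ord.
by apply/allP => _ /mapP[i _ ->] /=; exact: ltn_ord.
Qed.

(** A multi-index with a repetition gives 0 on both sides; any other is a permutation of its sorted
    version, which changes both sides by the same sign. *)
Lemma alt_ext k n (w1 w2 : form R K k n.+1) :
  mlin iota w1 -> mlin iota w2 -> alt0 w1 -> alt0 w2 ->
  (forall s, s \in subs k (seq.iota 0 n.+1) ->
     w1 (bas R k n s) = w2 (bas R k n s)) -> w1 =1 w2.
Proof.
move=> l1 l2 a1 a2 H; apply: mlin_ext => // s ss sa.
case: (boolP (uniq s)) => us; last first.
  move: us; case/(uniqPn 0%N) => i [j [ij js e]].
  have jk : (j < k)%N by rewrite -ss.
  have ik : (i < k)%N := ltn_trans ij jk.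
  have nij : Ordinal ik != Ordinal jk by rewrite -val_eqE /= neq_ltn ij.
  have E : row (Ordinal ik) (bas R k n s) = row (Ordinal jk) (bas R k n s).
    by apply/rowP => c; rewrite !mxE /= e.
  by rewrite (a1 _ _ _ nij E) (a2 _ _ _ nij E).
have st : size s == k by apply/eqP.
have st' : size (sort leq s) == k by rewrite size_sort.
have := perm_sort leq s => /permEl.
move=> pe; have /tuple_permP[p sp] : perm_eq (Tuple st') (Tuple st) by [].
(* The permutation [p] is the one that sorts [s]. *)
have E : row_perm p (bas R k n s) = bas R k n (sort leq s).
  apply/matrixP => i j; rewrite !mxE; congr (inord _ == _)%:R.
  have -> : sort leq s = [tuple tnth (Tuple st) (p i0) | i0 < k] by [].
  by rewrite -tnth_nth tnth_mktuple (tnth_nth 0%N).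
have : w1 (row_perm p (bas R k n s)) = w2 (row_perm p (bas R k n s)).
  rewrite E; apply: H; rewrite subsP size_sort ss eqxx andbT.
  have so : sorted ltn (sort leq s).
    by rewrite ltn_sorted_uniq_leq sort_uniq us sort_sorted //; exact: leq_total.
  have -> : sort leq s = [seq i <- seq.iota 0 n.+1 | i \in s].
    apply: (irr_sorted_eq ltn_trans ltnn so).
      by apply: (sorted_filter ltn_trans); exact: iota_ltn_sorted.
    move=> i; rewrite mem_sort mem_filter mem_iota /= add0n.
    by case: (boolP (i \in s)) => // /(allP sa) ->.
  exact: filter_subseq.
rewrite (alt0_altn l1 a1) (alt0_altn l2 a2) => /(mulfI _); apply.
by rewrite signr_eq0.
Qed.

End Ext.

Lemma size4P (s : seq nat) : size s = 4 -> exists a b c d, s = [:: a; b; c; d].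
Proof. by case: s => [|a [|b [|c [|d []]]]] // _; exists a, b, c, d. Qed.

Lemma combo_det k m n (l : seq (int * seq nat)) (s : seq nat) :
  (k + m)%N = n.+1 -> okl k n l -> size s = m -> all (fun a => a < n.+1)%N s ->
  \sum_(x <- l) x.1%:~R * \det (bas R n.+1 n (x.2 ++ s)) = (kt n.+1 l s)%:~R :> R.
Proof.
move=> kmn lo ss sa; elim: l lo => [|x l IH] /=; first by rewrite big_nil.
move=> /andP[/and3P[/eqP x1 x2 x3] lo]; rewrite big_cons IH // rmorphD rmorphM.
by rewrite det_bas ?all_cat ?x3 // size_cat x1 ss.
Qed.

Definition psi0 : form R R 4 7 := combo psiL.

(** Contraction with [phi0] leaves one determinant for each of its seven monomials; these are the
    integers compared in [psi_tab]. *)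
Lemma star_phi0 : star_phi 1%:M (@phi0 R) =1 psi0.
Proof.
apply: (@alt_ext R idR 4 6); [exact: (@mlin_hodge R 3 4)|exact: combo_mlin|exact: (@alt0_hodge R 3 4)|exact: combo_alt0|].
move=> s sS; have [ss sa] := mem_subs sS; rewrite /star_phi hodge1E.
under eq_bigr => f _ do rewrite phi0E.
rewrite (@combo_sum R idR 3 6 phiL (fun U => \det (col_mx U (bas R 4 6 s)))); last first.
  apply: (@alt0_altn R R idR).
    exact: (mlin_coll _ (@det_mlin R R idR _)).
  exact: (alt0_coll _ (@det_alt0 R R idR _)).
rewrite mulKf ?pnatr_eq0 //.
rewrite (eq_big_seq (fun x : int * seq nat => x.1%:~R * \det (bas R 7 6 (x.2 ++ s)))); last first.
  move=> x xl; rewrite col_bas //; apply/eqP.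
  by move: x xl; apply/allP.
rewrite (@combo_det 3 4 6) // /psi0 combo_bas //; congr (_%:~R); apply/eqP.
by move: s sS {ss sa}; apply/allP; exact: psi_tab.
Qed.

Lemma combo_pr2 k n l (V : 'M[R]_(k, 1 + n.+1)) :
  okl k n l ->
  form_pr2 (m := 1) (combo l) V = combo (n := n.+1) [seq (x.1, map S x.2) | x <- l] V.
Proof.
move=> lo; rewrite /form_pr2 /combo big_map; apply: eq_big_seq => x xl.
have /and3P[/eqP x1 x2 x3] := allP lo x xl.
congr (_ * \det _); apply/matrixP => i j; rewrite !mxE /=; congr (V _ _).
apply: val_inj; rewrite /= (nth_map 0%N) ?x1 // !inordK ?add1n //.
  by apply: (allP x3); rewrite mem_nth ?x1.
by rewrite ltnS; apply: (allP x3); rewrite mem_nth ?x1.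
Qed.

Lemma wedge_combor p q n (a : form R R p n.+1) (l : seq (int * seq nat)) V :
  wedge a (combo (k := q) l) V = \sum_(x <- l) x.1%:~R * wedge a (emonl x.2) V.
Proof.
rewrite /wedge /combo; under [RHS]eq_bigr => x _ do rewrite mulrCA mulr_sumr.
rewrite -mulr_sumr exchange_big; congr (_ * _); apply: eq_bigr => s _ /=.
by rewrite mulr_sumr; apply: eq_bigr => x _; rewrite mulrCA.
Qed.

Lemma wedge_dx_combo q n (i : 'I_n.+1) (l : seq (int * seq nat)) V :
  wedge (dx i) (combo (k := q) l) V = combo [seq (x.1, val i :: x.2) | x <- l] V :> R.
Proof.
rewrite wedge_combor /combo big_map; apply: eq_bigr => x _ /=; congr (_ * _).
rewrite (wedge_pull_eq _ (@dx_emon R n.+1 i) (fun=> erefl)) wedge_emon.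
congr (\det _); apply/matrixP => a b; rewrite !mxE /joinf; congr (V _ _).
by case: splitP => c ->; rewrite ?(ord1 c) /= ?inord_val.
Qed.

Lemma cylinder_combo phl psl V : okl 3 6 phl -> okl 4 6 psl ->
  cylinder_form (@combo 3 6 phl) (@combo 4 6 psl) V =
  combo ([seq (x.1, 0%N :: map S x.2) | x <- phl] ++
         [seq (x.1, map S x.2) | x <- psl]) V :> R.
Proof.
move=> h1 h2; rewrite /cylinder_form combo_pr2 //.
rewrite (@wedge_pull_eq R 1 3 8 R _ _ _ _ V (fun=> erefl) (fun U => combo_pr2 U h1)).
rewrite (@wedge_dx_combo 3 7) /combo big_cat -map_comp; congr (_ + _).
Qed.

Lemma Phi0E : @Phi0 R =1 combo PhiL.
Proof.
move=> V; rewrite /PhiL -cylinder_combo // /Phi0.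
have E1 : @phi0 R = combo phiL by apply/funext => U; rewrite phi0E.
have E2 : star_phi 1%:M (@phi0 R) = combo psiL by apply/funext => U; rewrite star_phi0.
by rewrite E2 E1.
Qed.

(** * Matrices acting on forms by derivations *)

Definition setr k n (r : 'I_k) (x : 'rV[R]_n) (V : 'M[R]_(k, n)) : 'M[R]_(k, n) :=
  \matrix_i (if i == r then x else row i V).

Lemma row_setr k n (r i : 'I_k) (x : 'rV[R]_n) V :
  row i (setr r x V) = if i == r then x else row i V.
Proof. by rewrite rowK. Qed.

Lemma mlin_setr (K : numFieldType) (iota : {rmorphism R -> K}) k n (w : form R K k n) r V :
  mlin iota w -> mlin iota (fun x : 'M[R]_(1, n) => w (setr r x V)).
Proof.
move=> wl X X1 X2 i b c; rewrite (ord1 i) !row_id => -> _ _.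
apply: (wl _ _ _ r).
- by rewrite !row_setr eqxx.
- by apply/row'P => j jr; rewrite !row_setr (negPf jr).
- by apply/row'P => j jr; rewrite !row_setr (negPf jr).
Qed.

(* The derivative at [t = 0] of [w (V *m (1 + t A))]. *)
Definition der k n (A : 'M[R]_n) (w : form R R k n) : form R R k n :=
  fun V => \sum_r w (setr r (row r V *m A) V).

Lemma mlin_der k n (A : 'M[R]_n) (w : form R R k n) : mlin idR w -> mlin idR (der A w).
Proof.
move=> wl; apply: mlin_sum => r _ V V1 V2 i b c H1 /row'P H2 /row'P H3.
apply: (wl _ _ _ i).
- rewrite !row_setr; case: (eqVneq i r) => [<-|//].
  by rewrite H1 mulmxDl !scalemxAl.
- apply/row'P => j ji; rewrite !row_setr; case: (eqVneq j r) => [<-|_]; by rewrite H2.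
- apply/row'P => j ji; rewrite !row_setr; case: (eqVneq j r) => [<-|_]; by rewrite H3.
Qed.

Lemma altn_der k n (A : 'M[R]_n) (w : form R R k n) : altn w -> altn (der A w).
Proof.
have rowp s (V : 'M[R]_(k, n)) i : row i (row_perm s V) = row (s i) V.
  by apply/rowP => c; rewrite !mxE.
move=> wa s V; rewrite /der mulr_sumr [RHS](reindex_inj (@perm_inj _ s)) /=.
apply: eq_bigr => r _; rewrite -wa; congr w; apply/row_matrixP => i.
by rewrite !rowp !row_setr !rowp (inj_eq perm_inj).
Qed.

(** Equivariance of the derivation action: a linear change of argument conjugates the matrix. *)
Lemma der_conj k n (A Q : 'M[R]_n) (w : form R R k n) V : Q \in unitmx ->
  der A w (V *m Q) = der (Q *m A *m invmx Q) (fun U => w (U *m Q)) V.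
Proof.
move=> uQ; rewrite /der; apply: eq_bigr => r _; congr w; apply/row_matrixP => i.
rewrite [RHS]row_mul !row_setr; case: (i == r); last by rewrite row_mul.
by rewrite row_mul !mulmxA mulmxKV.
Qed.

Lemma setr_bas k n (r : 'I_k) (s : seq nat) (q : 'I_n.+1) : size s = k ->
  setr r (delta_mx 0 q) (bas R k n s) = bas R k n (set_nth 0%N s r q).
Proof.
move=> ss; apply/matrixP => i j; rewrite !mxE nth_set_nth /=.
case: eqVneq => [->|ir]; rewrite !mxE ?eqxx ?inord_val; first by rewrite eq_sym.
by rewrite -val_eqE in ir; rewrite (negPf ir).
Qed.

Lemma der_bas k n (A : 'M[R]_n.+1) (w : form R R k n.+1) s : mlin idR w -> size s = k ->
  der A w (bas R k n s) =
  \sum_p \sum_q A p q *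
    \sum_(r < k) (inord (nth 0%N s r) == p)%:R * w (bas R k n (set_nth 0%N s r (val q))).
Proof.
move=> wl ss; rewrite /der.
transitivity (\sum_(r < k) \sum_q A (inord (nth 0%N s r)) q * w (bas R k n (set_nth 0%N s r (val q)))).
  apply: eq_bigr => r _.
  have -> : row r (bas R k n s) *m A = \sum_q A (inord (nth 0%N s r)) q *: delta_mx 0 q.
    rewrite [LHS]row_sum_delta; apply: eq_bigr => q _; congr (_ *: _).
    rewrite !mxE (bigD1 (inord (nth 0%N s r))) //= big1 ?addr0 ?mxE ?eqxx ?mul1r //.
    by move=> i ir; rewrite !mxE eq_sym (negPf ir) mul0r.
  rewrite (mlin_row _ _ _ (mlin_setr r _ wl)); apply: eq_bigr => q _.
  by rewrite setr_bas.
rewrite exchange_big [RHS]exchange_big; apply: eq_bigr => q _ /=.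
under [RHS]eq_bigr => p _ do rewrite mulr_sumr.
rewrite exchange_big; apply: eq_bigr => r _ /=.
rewrite (bigD1 (inord (nth 0%N s r))) //= eqxx mul1r big1 ?addr0 // => p pr.
by rewrite eq_sym (negPf pr) mul0r mulr0.
Qed.

(** Adding the sum with [p] and [q] exchanged doubles the left side and replaces each elementary
    matrix by its antisymmetrisation, the quantity tabulated in [dertab]. *)
Lemma der_antisym k n (A : 'M[R]_n.+1) (w : form R R k n.+1) s : A^T = - A ->
  mlin idR w -> size s = k ->
  2 * der A w (bas R k n s) =
  \sum_p \sum_q A p q *
    \sum_(r < k) ((inord (nth 0%N s r) == p)%:R * w (bas R k n (set_nth 0%N s r (val q))) -
                  (inord (nth 0%N s r) == q)%:R * w (bas R k n (set_nth 0%N s r (val p)))).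
Proof.
move=> As wl ss; rewrite mulr_natl mulr2n {1}(der_bas _ wl ss) (der_bas _ wl ss).
rewrite [X in _ + X]exchange_big -big_split; apply: eq_bigr => p _ /=.
rewrite -big_split; apply: eq_bigr => q _ /=.
have -> : A q p = - A p q by have := congr1 (fun X : 'M[R]_n.+1 => X p q) As; rewrite !mxE.
by rewrite mulNr -mulrBr sumrB.
Qed.

Lemma emonl_dup k n j (m : seq nat) (V : 'M[R]_(k.+1, n.+1)) : size m = k -> j \in m ->
  emonl (j :: m) V = 0.
Proof.
move=> sm jm; rewrite /emonl /emon -det_tr.
have jk : (index j m < k)%N by rewrite -sm index_mem.
rewrite (@determinant_alternate _ _ _ ord0 (lift ord0 (Ordinal jk))) //.
by move=> c; rewrite !mxE /= /bump /= nth_index.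
Qed.

Lemma wedge_sumr (K : fieldType) p q n (I : finType) (c : I -> K) (a : form R K p n) (w : I -> form R K q n) V :
  wedge a (fun U => \sum_j c j * w j U) V = \sum_j c j * wedge a (w j) V.
Proof.
rewrite /wedge; under [RHS]eq_bigr => x _ do rewrite mulrCA mulr_sumr.
rewrite -mulr_sumr exchange_big; congr (_ * _); apply: eq_bigr => s _ /=.
by rewrite mulr_sumr; apply: eq_bigr => x _; rewrite mulrCA.
Qed.

Lemma wedge_suml (K : fieldType) p q n (I : finType) (c : I -> K) (a : form R K p n) (w : I -> form R K q n) V :
  wedge (fun U => \sum_j c j * w j U) a V = \sum_j c j * wedge (w j) a V.
Proof.
rewrite /wedge; under [RHS]eq_bigr => x _ do rewrite mulrCA mulr_sumr.
rewrite -mulr_sumr exchange_big; congr (_ * _); apply: eq_bigr => s _ /=.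
by rewrite mulr_sumr mulr_suml; apply: eq_bigr => x _; rewrite !mulrA [c x * _]mulrC.
Qed.

Lemma lambda47E a V : lambda47 a V = \sum_j a 0 j * combo (lamL j) V :> R.
Proof.
have E1 (j : 'I_7) U : psi0 (col_mx (bas R 1 6 [:: val j]) U) = combo (ipsiL j) U.
  move: U; apply: (@alt_ext R idR 3 6); [|exact: combo_mlin| |exact: combo_alt0|].
  - exact: (@mlin_colr R R idR 1 3 7 psi0 _ (@combo_mlin 4 6 psiL)).
  - exact: (@alt0_colr R R 1 3 7 psi0 _ (@combo_alt0 4 6 psiL)).
  move=> s sS; have [ss sa] := mem_subs sS.
  have /andP[_ oi] := all_ltn okl_lam (ltn_ord j).
  rewrite col_bas // /psi0 !combo_bas //= ?ss ?sa ?andbT ?ltn_ord //.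
  by congr (_%:~R); apply/eqP; apply: (allP (all_ltn ipsi_tab (ltn_ord j))).
have E2 : interior (k := 3) a (star_phi 1%:M (@phi0 R)) =
    fun U => \sum_j a 0 j * combo (ipsiL j) U.
  apply/funext => U; rewrite /interior star_phi0 {1}[a]row_sum_delta.
  rewrite (@mlin_row R R idR 7 (fun x => psi0 (col_mx x U)) 'I_7); last first.
    exact: (@mlin_coll R R idR 1 3 7 psi0 U (@combo_mlin 4 6 psiL)).
  apply: eq_bigr => j _; rewrite -E1.
  suff -> : delta_mx 0 j = bas R 1 6 [:: val j] by [].
  by apply/matrixP => i k; rewrite !mxE (ord1 i) eqxx inord_val eq_sym.
have E3 : form_pr2 (m := 1) (fun U => \sum_j a 0 j * combo (ipsiL j) U) =
    fun U : 'M[R]_(3, 8) => \sum_j a 0 j * combo (n := 7) [seq (x.1, map S x.2) | x <- ipsiL j] U.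
  apply/funext => U; apply: eq_bigr => j _; congr (_ * _).
  have /andP[_ oi] := all_ltn okl_lam (ltn_ord j).
  by rewrite -(combo_pr2 U oi).
(* Monomials of [phi0] that contain e^j are killed by the wedge product with e^j, which explains the
   filter in [lamL]. *)
have E4 (j : 'I_7) (U : 'M[R]_(4, 7)) : wedge (dx j) (@phi0 R) U =
    combo [seq (x.1, val j :: x.2) | x <- phiL & val j \notin x.2] U.
  rewrite (@wedge_pull_eq R 1 3 7 R _ _ _ _ U (fun=> erefl) phi0E).
  rewrite (@wedge_dx_combo 3 6) /combo !big_map.
  rewrite big_filter [RHS]big_mkcond /=; apply: eq_big_seq => x xl.
  case: ifP => //= /negbFE jx; rewrite emonl_dup ?mulr0 //; apply/eqP.
  by move: x xl {jx}; apply/allP.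
have E5 (U : 'M[R]_(4, 7)) : wedge (covector a) (@phi0 R) U =
    \sum_j a 0 j * combo [seq (x.1, val j :: x.2) | x <- phiL & val j \notin x.2] U.
  rewrite (@wedge_suml R 3 1 7 'I_7 (fun j => a 0 j) (@phi0 R) (fun j => dx j) U).
  by apply: eq_bigr => j _; rewrite E4.
rewrite /lambda47 E2 E3 /form_pr2 E5.
rewrite (@wedge_sumr R 1 3 8 'I_7) -sumrB; apply: eq_bigr => j _.
rewrite -mulrBr; congr (_ * _).
rewrite (@wedge_dx_combo 3 7) /lamL {3}/combo big_cat -map_comp; congr (_ + _).
have ok : okl 4 6 [seq (x.1, val j :: x.2) | x <- phiL & val j \notin x.2].
  apply/allP => y /mapP[x xf ->]; move: xf; rewrite mem_filter => /andP[jx xl] /=.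
  rewrite jx ltn_ord /=; move: x xl {jx}; exact/allP.
rewrite (_ : combo _ (rsubmx V) = form_pr2 (m := 1) (combo [seq (x.1, val j :: x.2) | x <- phiL & val j \notin x.2]) V) //.
rewrite combo_pr2 // /combo !big_map -sumrN; apply: eq_bigr => x _ /=.
by rewrite rmorphN mulNr.
Qed.

End Tables.

(** * The pointwise equivalence *)

Local Opaque Phit phit comboi kt.

Section Complexified.
Variable (R : realType).
Local Notation C := R[i].
Let idR : {rmorphism R -> R} := idfun.
Let iC : {rmorphism R -> C} := real_complex R.

Lemma ReD (x y : C) : complex.Re (x + y) = complex.Re x + complex.Re y.
Proof. by case: x; case: y. Qed.
Lemma ImD (x y : C) : complex.Im (x + y) = complex.Im x + complex.Im y.
Proof. by case: x; case: y. Qed.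
Lemma Re_sum I (s : seq I) (P : pred I) (F : I -> C) :
  complex.Re (\sum_(i <- s | P i) F i) = \sum_(i <- s | P i) complex.Re (F i).
Proof. exact: (big_morph (@complex.Re R) ReD erefl). Qed.
Lemma Im_sum I (s : seq I) (P : pred I) (F : I -> C) :
  complex.Im (\sum_(i <- s | P i) F i) = \sum_(i <- s | P i) complex.Im (F i).
Proof. exact: (big_morph (@complex.Im R) ImD erefl). Qed.
Lemma ReZ (a : R) (x : C) : complex.Re (a%:C * x) = a * complex.Re x.
Proof. by case: x => b c; rewrite /= mul0r subr0. Qed.
Lemma ImZ (a : R) (x : C) : complex.Im (a%:C * x) = a * complex.Im x.
Proof. by case: x => b c; rewrite /= mul0r addr0. Qed.
Lemma complexP (x y : C) : complex.Re x = complex.Re y -> complex.Im x = complex.Im y -> x = y.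
Proof. by case: x => a b; case: y => c d /= -> ->. Qed.

Lemma natrC n : (n%:R : C) = (n%:R : R)%:C.
Proof. by rewrite rmorph_nat. Qed.
Lemma natVC n : ((n%:R : C)^-1) = ((n%:R : R)^-1)%:C.
Proof. by rewrite natrC fmorphV. Qed.
Lemma signC (b : bool) : ((-1 : C) ^+ b) = ((-1 : R) ^+ b)%:C.
Proof. by rewrite rmorph_sign. Qed.

Lemma extC_hodge k m (G : 'M[R]_(k + m)) (w : form R C k (k + m)) V :
  extC (hodge G) w V = (k`!)%:R^-1 * \sum_(f : {ffun 'I_k -> 'I_(k + m)})
     w (rowsub f (invmx G)) *
     (Num.sqrt (\det G) * \det (col_mx (rowsub f 1%:M) V))%:C.
Proof.
apply: complexP; rewrite /extC /=.
  rewrite natVC ReZ Re_sum; congr (_ * _); apply: eq_bigr => f _.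
  by rewrite [in RHS]mulrC ReZ mulrC.
rewrite natVC ImZ Im_sum; congr (_ * _); apply: eq_bigr => f _.
by rewrite [in RHS]mulrC ImZ mulrC.
Qed.

Lemma extC_hodge1 k m (w : form R C k (k + m)) V :
  extC (hodge 1%:M) w V = (k`!)%:R^-1 * \sum_(f : {ffun 'I_k -> 'I_(k + m)})
     w (rowsub f 1%:M) * (\det (col_mx (rowsub f 1%:M) V))%:C.
Proof.
rewrite extC_hodge invmx1 det1 sqrtr1; congr (_ * _).
by apply: eq_bigr => f _; rewrite mul1r.
Qed.

Lemma Re_wedge p q n (a : form R R p n) (w : form R C q n) V :
  complex.Re (wedge (formC a) w V) = wedge a (fun U => complex.Re (w U)) V.
Proof.
rewrite /wedge natVC ReZ Re_sum; congr (_ * _); apply: eq_bigr => s _.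
by rewrite signC -rmorphM ReZ.
Qed.

Lemma Im_wedge p q n (a : form R R p n) (w : form R C q n) V :
  complex.Im (wedge (formC a) w V) = wedge a (fun U => complex.Im (w U)) V.
Proof.
rewrite /wedge natVC ImZ Im_sum; congr (_ * _); apply: eq_bigr => s _.
by rewrite signC -rmorphM ImZ.
Qed.

Lemma extC_pi27 (Phi : form R R 4 (1 + 7)) (G : 'M[R]_(1 + 7)) (w : form R C 2 (1 + 7)) V :
  extC (pi27 Phi G) w V =
  4^-1 * (w V + extC (hodge (k := 6) (m := 2) G) (wedge (formC Phi) w) V).
Proof.
apply: complexP; rewrite /extC /pi27 /=.
  rewrite natVC ReZ ReD /=; congr (_ * (_ + hodge _ _ _)).
  by apply/funext => U; rewrite -Re_wedge.
rewrite natVC ImZ ImD /=; congr (_ * (_ + hodge _ _ _)).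
by apply/funext => U; rewrite -Im_wedge.
Qed.

Lemma mlin_extC_hodge k m (G : 'M[R]_(k + m)) (w : form R C k (k + m)) :
  mlin iC (extC (hodge G) w).
Proof.
rewrite (_ : extC (hodge G) w = fun V => (k`!)%:R^-1 * \sum_(f : {ffun 'I_k -> 'I_(k + m)})
     w (rowsub f (invmx G)) *
     (Num.sqrt (\det G) * \det (col_mx (rowsub f 1%:M) V))%:C); last first.
  by apply/funext => V; rewrite extC_hodge.
apply/mlinZ/mlin_sum => f _; apply/mlinZ; apply: mlin_idC; apply: mlinZ.
exact: (mlin_colr _ (@det_mlin R R idR _)).
Qed.

Lemma alt0_extC_hodge k m (G : 'M[R]_(k + m)) (w : form R C k (k + m)) :
  alt0 (extC (hodge G) w).
Proof. by move=> V r1 r2 r12 H; rewrite /extC !(alt0_hodge _ _ r12 H). Qed.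

Lemma mlin_pr2 k m n (w : form R C k n) : mlin iC w -> mlin iC (form_pr2 (m := m) w).
Proof.
rewrite (_ : form_pr2 (m := m) w = fun V => w (V *m col_mx 0 1%:M)); first exact: mlin_pull.
by apply/funext => V; rewrite /form_pr2 -{2}[V]hsubmxK mul_row_col mulmx0 mulmx1 add0r.
Qed.

Lemma alt0_pr2 k m n (w : form R C k n) : alt0 w -> alt0 (form_pr2 (m := m) w).
Proof.
rewrite (_ : form_pr2 (m := m) w = fun V => w (V *m col_mx 0 1%:M)); first exact: alt0_pull.
by apply/funext => V; rewrite /form_pr2 -{2}[V]hsubmxK mul_row_col mulmx0 mulmx1 add0r.
Qed.

Lemma wedge_pr2 (K : fieldType) p q n m (a : form R K p n) (b : form R K q n) V :
  wedge (form_pr2 (m := m) a) (form_pr2 (m := m) b) V = form_pr2 (m := m) (wedge a b) V.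
Proof.
rewrite /wedge /form_pr2; congr (_ * _); apply: eq_bigr => s _.
congr (_ * a _ * b _); by apply/matrixP => i j; rewrite !mxE.
Qed.

Lemma wedge_combo_sum p q n (l : seq (int * seq nat)) (w : form R C q n.+1)
    (T : form R C (p + q) n.+1) : mlin iC T -> alt0 T ->
  \sum_(f : {ffun 'I_(p + q) -> 'I_n.+1})
     wedge (formC (combo l)) w (rowsub f 1%:M) * T (rowsub f 1%:M) =
  ((p + q)`!)%:R / (q`!)%:R * \sum_(g : {ffun 'I_q -> 'I_n.+1}) w (rowsub g 1%:M) *
    \sum_(x <- l) x.1%:~R * T (col_mx (bas R p n x.2) (rowsub g 1%:M)).
Proof.
move=> Tl T0; rewrite (wedge_sum _ _ (alt0_altn Tl T0)).
have p0 : (p`!)%:R != 0 :> C by rewrite pnatr_eq0 -lt0n fact_gt0.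
transitivity ((p + q)`!%:R / (p`! * q`!)%:R * \sum_(g : {ffun 'I_q -> 'I_n.+1})
   w (rowsub g 1%:M) * ((p`!)%:R * \sum_(x <- l) x.1%:~R * T (col_mx (bas R p n x.2) (rowsub g 1%:M)))).
  congr (_ * _); rewrite exchange_big; apply: eq_bigr => g _ /=.
  rewrite -(@combo_sum R C iC p n l (fun U => T (col_mx U (rowsub g 1%:M)))).
    by rewrite mulr_sumr; apply: eq_bigr => f _; rewrite mulrA [w _ * _]mulrC.
  by apply: (alt0_altn (iota := iC)); [exact: mlin_coll|exact: alt0_coll].
under eq_bigr => g _ do rewrite mulrCA.
rewrite -mulr_sumr mulrA natrM invfM; congr (_ * _).
by rewrite -!mulrA; congr (_ * _); rewrite mulrC -mulrA mulfV ?mulr1.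
Qed.

(** * The Hodge star of six-forms pulled back from R^7 *)

Lemma det_col0 n (M : 'M[R]_n.+1) : (forall i, M i 0 = 0) -> \det M = 0.
Proof. by move=> H; rewrite (expand_det_col _ 0) big1 // => i _; rewrite H mul0r. Qed.

Lemma det_col0_delta n (M : 'M[R]_n.+2) (N : 'M[R]_n.+1) (k : 'I_n.+2) : ~~ odd k ->
  (forall i, M i 0 = (i == k)%:R) ->
  (forall i j, M (lift k i) (lift 0 j) = N i j) -> \det M = \det N.
Proof.
move=> ok M0 MN; rewrite (expand_det_col _ 0) (bigD1 k) //= big1 ?addr0.
  rewrite M0 eqxx mul1r /cofactor addn0 -signr_odd (negPf ok) expr0 mul1r.
  by congr (\det _); apply/matrixP => i j; rewrite !mxE MN.
by move=> i ik; rewrite M0 (negPf ik) mul0r.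
Qed.

(** The rows are e_1, ..., e_7 in R^8: the inclusion of the tangent space of [Y]. *)
Let B' : 'M[R]_(7, 8) := (row_mx 0 1%:M : 'M[R]_(7, 1 + 7)).

Lemma B'E (f : 'I_6 -> 'I_7) i j : rowsub f B' i j = (j == (f i).+1 :> nat)%:R.
Proof.
rewrite !mxE; case: splitP => k; rewrite ?(ord1 k) mxE => ->; first by [].
by rewrite add1n eqSS eq_sym.
Qed.

(** A pulled-back form sees only the last seven coordinates, so the contraction over eight indices
    transfers to seven, with the inclusion [B'] moved into the determinant. *)
Lemma star_pr2 (w : form R C 6 7) (V : 'M[R]_(2, 8)) : mlin iC w ->
  extC (hodge (k := 6) (m := 2) 1%:M) (form_pr2 (m := 1) w) V =
  (6`!)%:R^-1 * \sum_(f : {ffun 'I_6 -> 'I_7}) w (rowsub f 1%:M) *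
     (\det (col_mx (rowsub f B') V : 'M[R]_8))%:C.
Proof.
move=> wl; rewrite (@extC_hodge1 6 2); congr (_ * _).
pose B : 'M[R]_(8, 7) := (col_mx 0 1%:M : 'M[R]_(1 + 7, 7)).
pose T (U : 'M[R]_(6, 8)) := iC (\det (col_mx U V : 'M[R]_8)).
have Tl : mlin iC T := @mlin_coll R C iC 6 2 8 _ _ (@det_mlin R C iC 8).
transitivity (\sum_(f : {ffun 'I_6 -> 'I_8}) w (rowsub f B) * T (rowsub f 1%:M)).
  apply: eq_bigr => f _; rewrite /form_pr2; congr (w _ * _).
  apply/matrixP => i j; rewrite !mxE; case: splitP => k; rewrite ?(ord1 k) mxE -val_eqE /= => ->; first by [].
  by rewrite eqn_add2l.
rewrite (@sum_transfer_eq R C iC 6 7 8 8 7 w T B 1%:M 1%:M B') //.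
by rewrite mulmx1 trmx1 mul1mx /B /B' (@tr_col_mx _ 1 7) trmx0 trmx1.
Qed.

(** All eight rows of the determinant are tangent to [Y], so its first column is zero. *)
Lemma star_pr2_cd (w : form R C 6 7) (c d : nat) : mlin iC w -> (c < 7)%N -> (d < 7)%N ->
  extC (hodge (k := 6) (m := 2) 1%:M) (form_pr2 (m := 1) w) (bas R 2 7 [:: c.+1; d.+1]) = 0.
Proof.
move=> wl c7 d7; rewrite star_pr2 // big1 ?mulr0 // => f _.
rewrite (@det_col0 7) ?rmorph0 ?mulr0 // => i; rewrite !mxE.
case: splitP => k _; rewrite ?B'E //= !mxE -val_eqE /= inordK //.
by case: k => -[|[|]] //=.
by case: k => -[|[|]] //=.
Qed.

(** The first column has a single 1, in the row of [e_0]. That row has index 6, after the six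
    contracted vectors, so the cofactor sign is positive and the remaining minor is the one of
    R^7. *)
Lemma star_pr2_0d (w : form R C 6 7) (d : nat) : mlin iC w -> (d < 7)%N ->
  extC (hodge (k := 6) (m := 2) 1%:M) (form_pr2 (m := 1) w) (bas R 2 7 [:: 0%N; d.+1]) =
  extC (hodge (k := 6) (m := 1) 1%:M) w (bas R 1 6 [:: d]).
Proof.
move=> wl d7; rewrite star_pr2 // (@extC_hodge1 6 1); congr (_ * _).
apply: eq_bigr => f _; congr (_ * _); apply: (f_equal iC).
apply: (@det_col0_delta 6 _ _ (inord 6)) => [|i|i j]; first by rewrite inordK.
  rewrite !mxE -[i == _]val_eqE /= inordK //; case: splitP => k e; rewrite ?B'E /=.
    by rewrite e; case: eqP => // e'; have := ltn_ord k; rewrite e'.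
  rewrite !mxE -val_eqE /= e inordK; last by case: k {e} => -[|[|]].
  by case: k {e} => -[|[|]].
rewrite !mxE; case: splitP => k; rewrite /= /bump inordK //; case: (ltnP 5 i) => h ek; case: splitP => l el.
all: rewrite ?add1n ?add0n /= in ek.
all: try by exfalso; move: (ltn_ord k) (ltn_ord l) h ek el; move: (nat_of_ord i) (nat_of_ord k) (nat_of_ord l) => x y z; lia.
  have -> : l = k by apply: val_inj; rewrite /= -el.
  by rewrite B'E /= !mxE -val_eqE /= /bump /= eqSS eq_sym.
rewrite !mxE -!val_eqE /= (_ : nth _ _ k = d.+1); last first.
  have -> : nat_of_ord k = 1%N.
    by move: (ltn_ord k) (ltn_ord l) h ek el; move: (nat_of_ord i) (nat_of_ord k) (nat_of_ord l) => x y z; lia.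
  by [].
by rewrite (ord1 l) /= !inordK.
Qed.

(** Up to sign, the component [d] of the Hodge star is the component of [w] on the six indices other
    than [d], and these are all the increasing multi-indices of length 6. *)
Lemma star_inj6 (w : form R C 6 7) : mlin iC w -> alt0 w ->
  (forall d, (d < 7)%N -> extC (hodge (k := 6) (m := 1) 1%:M) w (bas R 1 6 [:: d]) = 0) ->
  forall V, w V = 0.
Proof.
move=> wl w0 H; pose sg (d : nat) : R := if odd d then -1 else 1.
have T d (U : 'M[R]_(6, 7)) : (d < 7)%N -> \det (col_mx U (bas R 1 6 [:: d])) =
    sg d * emonl (k := 6) (n := 6) (rem d (iota 0 7)) U.
  move=> d7; move: U; apply: (@alt_ext R R idR 6 6).
  - exact: (@mlin_coll R R idR 6 1 7 _ _ (@det_mlin R R idR 7)).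
  - by apply: mlinZ; exact: (mlin_emon idR).
  - exact: (@alt0_coll R R 6 1 7 _ _ (@det_alt0 R R idR 7)).
  - by move=> V r1 r2 r12 e; rewrite /emonl; have /= -> := @alt0_emon R R idR 6 7 _ _ _ _ r12 e; rewrite mulr0.
  move=> s sS; have [ss sa] := mem_subs sS.
  have dm : d \in iota 0 7 by rewrite mem_iota.
  rewrite col_bas // (@det_bas R 6); [|by rewrite size_cat ss|by rewrite all_cat sa /= d7].
  rewrite emonl_bas; [|by rewrite size_rem|by []|by rewrite rem_uniq ?iota_uniq| |by []]; last first.
    by apply/allP => i /mem_rem; rewrite mem_iota.
  rewrite (eqP (allP (all_ltn cofactor_tab d7) s sS)) rmorphM /sg.
  by case: odd; rewrite ?rmorphN rmorph1.
have K d : (d < 7)%N -> w (bas R 6 6 (rem d (iota 0 7))) = 0.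
  move=> d7; have := H d d7; rewrite (@extC_hodge1 6 1).
  under eq_bigr => f _ do rewrite (T _ _ d7) rmorphM mulrCA [w _ * _]mulrC.
  rewrite -mulr_sumr (@emon_sum R C iC 6 7 _ w); last exact: (alt0_altn wl w0).
  rewrite mulrCA [X in _ * X]mulKf ?pnatr_eq0 // /sg => /eqP; rewrite mulf_eq0.
  case/orP => /eqP //; case: odd => /eqP; rewrite fmorph_eq0 ?oppr_eq0 oner_eq0 //.
apply: (@alt_ext R C iC 6 6 w (fun=> 0)) => //.
  by move=> *; rewrite !mulr0 addr0.
move=> s; have : all (fun s => has (fun d => s == rem d (iota 0 7)) (iota 0 7)) (subs 6 (iota 0 7)).
  by vm_compute.
move=> /allP h /h /hasP[d]; rewrite mem_iota => d7 /eqP ->; exact: K.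
Qed.

Lemma bas2C n (w : form R C 2 n.+1) a b : mlin iC w -> alt0 w ->
  w (bas R 2 n [:: a; b]) = - w (bas R 2 n [:: b; a]).
Proof.
move=> wl w0.
have := alt0_altn wl w0 (tperm ord0 (lift ord0 ord0)) (bas R 2 n [:: b; a]).
rewrite odd_tperm /= expr1 mulN1r => <-; congr w.
apply/matrixP => i j; rewrite !mxE; congr (inord _ == _)%:R.
by case: tpermP => [->|->|] //; case: i => -[|[|]] //= ? h1 h2; [case: h1|case: h2]; apply: val_inj.
Qed.

(** * The equations in the model frame *)

Section Pointwise.
Variable F : form R C 2 7.
Hypotheses (Fl : mlin iC F) (F0 : alt0 F).

Let G : form R C 6 7 := wedge (wedge F F) F.
Let Fab (a b : nat) : C := F (bas R 2 6 [:: a; b]).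
Let beta (d : nat) : C := 6^-1 * extC (hodge (k := 6) (m := 1) 1%:M) G (bas R 1 6 [:: d]).
Let S (d : nat) : C := \sum_(a < 7) \sum_(b < 7) Fab a b * (phit a b d)%:~R.

Let Gl : mlin iC G.
Proof. exact: (@mlin_wedge R C iC 4 2 7 _ _ (@mlin_wedge R C iC 2 2 7 _ _ Fl Fl) Fl). Qed.

Lemma FabC a b : Fab a b = - Fab b a.
Proof. by apply: bas2C. Qed.

Definition g2_dDT_std : form R C 6 7 := fun V =>
  wedge (formC (@psi0 R)) F V + 6^-1 * G V.

(** Expanding [psi0] into monomials turns the star of [psi0 /\ F] into the contraction of [F] with
    the star of [psi0], which is [phi0]; the factor 1/2 is the [2!] of the two contracted
    indices. *)
Lemma g2_dDT_std_star d : (d < 7)%N ->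
  extC (hodge (k := 6) (m := 1) 1%:M) g2_dDT_std (bas R 1 6 [:: d]) =
  2^-1 * S d + beta d.
Proof.
move=> d7; rewrite (@extC_hodge1 6 1) /beta (@extC_hodge1 6 1) [6^-1 * _]mulrCA.
pose T (U : 'M[R]_(6, 7)) := iC (\det (col_mx U (bas R 1 6 [:: d]) : 'M[R]_7)).
have Tl : mlin iC T := @mlin_coll R C iC 6 1 7 _ _ (@det_mlin R C iC 7).
have T0 : alt0 T := @alt0_coll R C 6 1 7 _ _ (@det_alt0 R C iC 7).
under eq_bigr => f _ do rewrite /g2_dDT_std mulrDl.
rewrite big_split mulrDr; congr (_ + _); last first.
  rewrite [6^-1 * _]mulr_sumr; apply: (f_equal (fun z => _ * z)); apply: eq_bigr => f _.
  by rewrite -mulrA.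
rewrite /psi0 (@wedge_combo_sum 4 2 6 psiL F T Tl T0).
rewrite (@sum_bas2 R C 6 (fun X => F X * \sum_(x <- psiL) x.1%:~R * T (col_mx (bas R 4 6 x.2) X))) mulrA.
rewrite mulrA mulVf ?pnatr_eq0 // mul1r; congr (_ * _).
apply: eq_bigr => a _; apply: eq_bigr => b _; congr (_ * _).
have <- := eqP (all3E starpsi_tab (ltn_ord a) (ltn_ord b) d7).
rewrite -(rmorph_int iC) -(@combo_det R 4 3 6) ?rmorph_sum //=; last first.
  by rewrite !ltn_ord d7.
apply: eq_big_seq => x xl; rewrite rmorphM rmorph_int; congr (_ * iC (\det _)).
have /and3P[/eqP x2 _ _] : [&& size x.2 == 4, uniq x.2 & all (fun a => a < 7)%N x.2].
  by move: x xl; apply/allP.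
by rewrite col_bas // (@col_bas R 6 1) ?size_cat ?x2 // -catA.
Qed.

Let F' : form R C 2 (1 + 7) := form_pr2 (m := 1) F.

(** The 2-form to which the projection is applied. Its two summands occupy complementary components:
    [F] those tangent to [Y], and the star of F^3 those containing the circle direction. *)
Definition spin7_alpha : form R C 2 (1 + 7) := fun V =>
  F' V + 6^-1 * extC (hodge (k := 6) (m := 2) 1%:M) (wedge (wedge F' F') F') V.

Definition spin7_F1_std : form R C 2 (1 + 7) :=
  extC (pi27 (@Phi0 R) 1%:M) spin7_alpha.

Let alpha_ab (a b : nat) : C := spin7_alpha (bas R 2 7 [:: a; b]).

Lemma GprE : wedge (wedge F' F') F' = form_pr2 (m := 1) G.
Proof.
apply/funext => V; rewrite -(@wedge_pr2 C 4 2 7 1); congr (@wedge R C 4 2 8 _ _ V).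
by apply/funext => U; rewrite (@wedge_pr2 C 2 2 7 1).
Qed.

Lemma mlin_alpha : mlin iC spin7_alpha.
Proof.
apply: mlinD; first exact: mlin_pr2.
by apply: mlinZ; exact: (@mlin_extC_hodge 6 2).
Qed.

Lemma alt0_alpha : alt0 spin7_alpha.
Proof.
move=> V r1 r2 r12 H; rewrite /spin7_alpha /F' (alt0_pr2 F0 r12 H).
by rewrite (@alt0_extC_hodge 6 2 _ _ _ _ _ r12 H) mulr0 addr0.
Qed.

Lemma F'_bas a b : (a < 7)%N -> (b < 7)%N -> F' (bas R 2 7 [:: a.+1; b.+1]) = Fab a b.
Proof.
move=> a7 b7; rewrite /F' /form_pr2 /Fab; congr F; apply/matrixP => i j.
rewrite !mxE -!val_eqE /=; case: i => -[|[|]] //= _; rewrite !inordK //.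
Qed.

Lemma F'_bas0 b : F' (bas R 2 7 [:: 0; b]%N) = 0.
Proof.
apply: (@mlin_row0 R C iC 2 7 F _ ord0 Fl); apply/rowP => j.
by rewrite !mxE -val_eqE /= inordK.
Qed.

Lemma alpha_cd c d : (c < 7)%N -> (d < 7)%N -> alpha_ab c.+1 d.+1 = Fab c d.
Proof.
move=> c7 d7; rewrite /alpha_ab /spin7_alpha GprE (@star_pr2_cd G) // mulr0 addr0.
exact: F'_bas.
Qed.

Lemma alpha_0d d : (d < 7)%N -> alpha_ab 0 d.+1 = beta d.
Proof.
by move=> d7; rewrite /alpha_ab /spin7_alpha GprE (@star_pr2_0d G) // F'_bas0 add0r.
Qed.

Lemma alphaC a b : alpha_ab a b = - alpha_ab b a.
Proof. by apply: (@bas2C 7); [exact: mlin_alpha|exact: alt0_alpha]. Qed.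

Lemma mlin_F1_std : mlin iC spin7_F1_std.
Proof.
rewrite (_ : spin7_F1_std = fun V => 4^-1 * (spin7_alpha V + extC (hodge (k := 6) (m := 2) 1%:M) (wedge (formC (@Phi0 R)) spin7_alpha) V)).
  apply: mlinZ; apply: mlinD; [exact: mlin_alpha|exact: (@mlin_extC_hodge 6 2)].
by apply/funext => V; rewrite /spin7_F1_std extC_pi27.
Qed.

Lemma F1_bas c d : (c < 8)%N -> (d < 8)%N ->
  4 * spin7_F1_std (bas R 2 7 [:: c; d]) =
  alpha_ab c d + 2^-1 * \sum_(a < 8) \sum_(b < 8) alpha_ab a b * (Phit [:: val a; val b; c; d])%:~R.
Proof.
move=> c8 d8; rewrite /spin7_F1_std extC_pi27 mulVKf ?pnatr_eq0 //; congr (_ + _).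
pose T (U : 'M[R]_(6, 8)) := iC (\det (col_mx U (bas R 2 7 [:: c; d]) : 'M[R]_8)).
have Tl : mlin iC T := @mlin_coll R C iC 6 2 8 _ _ (@det_mlin R C iC 8).
have T0 : alt0 T := @alt0_coll R C 6 2 8 _ _ (@det_alt0 R C iC 8).
have -> : @Phi0 R = combo PhiL by apply/funext => V; rewrite Phi0E.
rewrite (@extC_hodge1 6 2) (@wedge_combo_sum 4 2 7 PhiL spin7_alpha T Tl T0).
rewrite (@sum_bas2 R C 7 (fun X => spin7_alpha X * \sum_(x <- PhiL) x.1%:~R * T (col_mx (bas R 4 7 x.2) X))).
rewrite !mulrA mulVf ?pnatr_eq0 // mul1r; congr (_ * _).
apply: eq_bigr => a _; apply: eq_bigr => b _; congr (_ * _).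
rewrite -(rmorph_int iC) -(@combo_det R 4 4 7) ?rmorph_sum //=; last first.
  by rewrite !ltn_ord c8 d8.
apply: eq_big_seq => x xl; rewrite rmorphM rmorph_int; congr (_ * iC (\det _)).
have /and3P[/eqP x2 _ _] : [&& size x.2 == 4, uniq x.2 & all (fun a => a < 8)%N x.2].
  by move: x xl; apply/allP.
by rewrite col_bas // (@col_bas R 6 2) ?size_cat ?x2 // -catA.
Qed.

Lemma split8 (X : nat -> nat -> C) :
  \sum_(a < 8) \sum_(b < 8) X a b =
  X 0 0 + \sum_(b < 7) (X 0 b.+1 + X b.+1 0) + \sum_(a < 7) \sum_(b < 7) X a.+1 b.+1.
Proof.
rewrite big_ord_recl [X in X + _]big_ord_recl.
under [X in _ + X = _]eq_bigr => a _ do rewrite big_ord_recl.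
rewrite [X in _ + X = _]big_split /= [X in _ = _ + X + _]big_split /= -!addrA.
by [].
Qed.

Lemma alpha_swap (b : 'I_7) c d : (c < 8)%N -> (d < 8)%N ->
  alpha_ab b.+1 0 * (Phit [:: b.+1; 0; c; d]%N)%:~R = beta b * (Phit [:: 0; b.+1; c; d]%N)%:~R.
Proof.
move=> c8 d8; rewrite alphaC (alpha_0d (ltn_ord b)).
have := all3E Phi_swap_tab (ltn_ord (lift ord0 b)) c8 d8.
by rewrite lift0 => /eqP ->; rewrite rmorphN mulrNN.
Qed.

Lemma alpha00 : alpha_ab 0 0 = 0.
Proof.
have /eqP := alphaC 0 0; rewrite -addr_eq0 -mulr2n mulrn_eq0 /= => /eqP ->.
by [].
Qed.

(** The components of [spin7_alpha] along the circle meet only coefficients of the 4-form with a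
    repeated 0, which vanish; what is left of the 4-form is [phi]. *)
Lemma F1_0d d : (d < 7)%N ->
  4 * spin7_F1_std (bas R 2 7 [:: 0; d.+1]%N) = 2^-1 * S d + beta d.
Proof.
move=> d7; rewrite F1_bas // alpha_0d // addrC; congr (2^-1 * _ + _).
rewrite (split8 (fun a b => alpha_ab a b * (Phit [:: a; b; 0; d.+1]%N)%:~R)).
rewrite alpha00 mul0r add0r big1 ?add0r.
  apply: eq_bigr => a _; apply: eq_bigr => b _; rewrite alpha_cd //.
  by rewrite (eqP (all3E Phiab0d_tab (ltn_ord a) (ltn_ord b) d7)).
move=> b _; rewrite alpha_swap // (alpha_0d (ltn_ord b)).
rewrite (eqP (all_ltn (all_ltn Phi0b0d_tab (ltn_ord (lift ord0 b))) (d7 : (d.+1 < 8)%N))).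
by rewrite !mulr0 addr0.
Qed.

(** The orders (0, b) and (b, 0) give equal contributions, which cancels the factor 1/2 in front of
    the double sum for the terms in [beta]. *)
Lemma F1_cd c d : (c < 7)%N -> (d < 7)%N ->
  4 * spin7_F1_std (bas R 2 7 [:: c.+1; d.+1]%N) =
  Fab c d + \sum_(b < 7) beta b * (phit b c d)%:~R +
  2^-1 * \sum_(a < 7) \sum_(b < 7) Fab a b * (Phit [:: a.+1; b.+1; c.+1; d.+1]%N)%:~R.
Proof.
move=> c7 d7; rewrite F1_bas // alpha_cd // -addrA; congr (_ + _).
rewrite (split8 (fun a b => alpha_ab a b * (Phit [:: a; b; c.+1; d.+1]%N)%:~R)).
rewrite alpha00 mul0r add0r mulrDr; congr (_ + _ * _); last first.
  by apply: eq_bigr => a _; apply: eq_bigr => b _; rewrite alpha_cd.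
rewrite mulr_sumr; apply: eq_bigr => b _; rewrite alpha_swap // (alpha_0d (ltn_ord b)).
rewrite (eqP (all3E Phi0bcd_tab (ltn_ord b) c7 d7)); field.
by [].
Qed.

Lemma foldr_sumE (T : nmodType) (f : nat -> T) s :
  foldr (fun e z => f e + z) 0 s = \sum_(e <- s) f e.
Proof. by elim: s => [|e s IH] /=; rewrite ?big_nil // big_cons IH. Qed.

Lemma sum_delta (c : nat) (f : nat -> C) : (c < 7)%N ->
  \sum_(a < 7) (delta a c)%:~R * f a = f c.
Proof.
move=> c7; rewrite (bigD1 (Ordinal c7)) //= /delta eqxx mul1r big1 ?addr0 // => a.
by rewrite -val_eqE /= => /negPf ->; rewrite mul0r.
Qed.

(** The two Kronecker terms of the contraction identity give [Fab c d - Fab d c], that is twice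
    [Fab c d]. *)
Lemma F_phi_phi c d : (c < 7)%N -> (d < 7)%N ->
  \sum_(e < 7) S e * (phit e c d)%:~R =
  Fab c d *+ 2 +
  \sum_(a < 7) \sum_(b < 7) Fab a b * (Phit [:: a.+1; b.+1; c.+1; d.+1]%N)%:~R.
Proof.
move=> c7 d7.
transitivity (\sum_(a < 7) \sum_(b < 7) Fab a b * \sum_(e < 7) (phit a b e * phit e c d)%:~R).
  rewrite /S; under eq_bigr => e _ do rewrite mulr_suml.
  rewrite exchange_big; apply: eq_bigr => a _ /=.
  under eq_bigr => e _ do rewrite mulr_suml.
  rewrite exchange_big; apply: eq_bigr => b _ /=.
  by rewrite mulr_sumr; apply: eq_bigr => e _; rewrite rmorphM mulrA.
transitivity (\sum_(a < 7) \sum_(b < 7) (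
   ((delta a c)%:~R * ((delta b d)%:~R * Fab a b) - (delta b c)%:~R * ((delta a d)%:~R * Fab a b))
   + Fab a b * (Phit [:: a.+1; b.+1; c.+1; d.+1]%N)%:~R)).
  apply: eq_bigr => a _; apply: eq_bigr => b _.
  have := eqP (all4E phi_phi_tab (ltn_ord a) (ltn_ord b) c7 d7).
  rewrite (foldr_sumE (fun e => phit a b e * phit e c d)).
  move=> /(congr1 (fun z : int => z%:~R : C)).
  rewrite [X in _ = X](_ : _ = \sum_(e < 7) (phit a b e * phit e c d)%:~R); last first.
    by rewrite rmorph_sum -(big_mkord xpredT (fun e => (phit a b e * phit e c d)%:~R)).
  move=> <-; move: (delta a c) (delta b d) (delta a d) (delta b c) (Phit _) (Fab a b).
  move=> x1 x2 x3 x4 x5 x6; rewrite intrD intrB !intrM.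
  move: (x1%:~R : C) (x2%:~R : C) (x3%:~R : C) (x4%:~R : C) (x5%:~R : C).
  move=> y1 y2 y3 y4 y5; ring.
under eq_bigr => a _ do rewrite big_split sumrB.
rewrite big_split sumrB /=; congr (_ + _).
under eq_bigr => a _ do rewrite -mulr_sumr (sum_delta (Fab a)) //.
rewrite (sum_delta (Fab ^~ d)) // exchange_big /=.
under eq_bigr => b _ do rewrite -mulr_sumr (sum_delta (Fab ^~ b)) //.
by rewrite (sum_delta (Fab d)) // -FabC -mulr2n.
Qed.

Lemma g2_dDT_std_F1 : (forall V, g2_dDT_std V = 0) -> forall V, spin7_F1_std V = 0.
Proof.
move=> H.
have H' d : (d < 7)%N -> 2^-1 * S d + beta d = 0.
  move=> d7; rewrite -g2_dDT_std_star // (@extC_hodge1 6 1) big1 ?mulr0 // => f _.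
  by rewrite H mul0r.
have n4 : 4 != 0 :> C by rewrite pnatr_eq0.
apply: (@alt_ext R C iC 2 7 spin7_F1_std (fun=> 0)); [exact: mlin_F1_std| | |by []|].
- by move=> *; rewrite !mulr0 addr0.
- move=> V r1 r2 r12 e; rewrite /spin7_F1_std extC_pi27 (alt0_alpha r12 e).
  by rewrite (@alt0_extC_hodge 6 2 _ _ _ _ _ r12 e) addr0 mulr0.
move=> s sS; have [ss sa] := mem_subs sS; apply: (mulfI n4); rewrite mulr0.
have : sorted ltn s.
  move: sS; rewrite subsP => /andP[/(subseq_sorted ltn_trans) so _].
  by apply: so; exact: iota_ltn_sorted.
case: s ss sa {sS} => [|c [|d [|]]] //= _ /and3P[c8 d8 _]; rewrite andbT => cd.
case: d d8 cd => // d d8 cd; case: c c8 cd => [|c] c8 cd.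
  by rewrite F1_0d // H'.
rewrite !ltnS in c8 d8; rewrite (F1_cd (c8 : (c < 7)%N) (d8 : (d < 7)%N)).
(* Substituting [beta b = - S b / 2] makes the contraction identity cancel the other two terms
   exactly. *)
have -> : \sum_(b < 7) beta b * (phit b c d)%:~R = - (2^-1 * \sum_(e < 7) S e * (phit e c d)%:~R).
  rewrite mulr_sumr -sumrN; apply: eq_bigr => b _.
  have /eqP := H' b (ltn_ord b); rewrite addrC addr_eq0 => /eqP ->.
  by rewrite mulNr mulrA.
rewrite F_phi_phi //; set X := \sum_(a < 7) _; field.
by [].
Qed.

(** Only the components containing the circle direction are used: they already are the Hodge dual of
    the six-form. *)
Lemma F1_std_g2_dDT : (forall V, spin7_F1_std V = 0) -> forall V, g2_dDT_std V = 0.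
Proof.
move=> H; apply: star_inj6.
- apply: mlinD; last exact: mlinZ.
  apply: (@mlin_wedge R C iC 4 2 7) => //.
  exact: (@mlin_idC R 4 7 iC (@psi0 R) (@combo_mlin R 4 6 psiL)).
- move=> V r1 r2 r12 e; rewrite /g2_dDT_std /G.
  by rewrite !(@alt0_wedge R C 4 2 7 _ _ _ _ _ r12 e) mulr0 addr0.
move=> d d7; rewrite g2_dDT_std_star // -F1_0d // H mulr0 //.
Qed.

(** The constant is 90 = 6! / (2!)^3, the product of the factors 15 and 6 of the two successive
    wedge products. *)
Lemma wedge3_sum (T : form R C 6 7) : mlin iC T -> alt0 T ->
  \sum_(f : {ffun 'I_6 -> 'I_7}) G (rowsub f 1%:M) * T (rowsub f 1%:M) =
  90 * \sum_(f : {ffun 'I_6 -> 'I_7})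
    F (usubmx (usubmx (rowsub f 1%:M : 'M[R]_(2 + 2 + 2, 7)))) *
    F (dsubmx (usubmx (rowsub f 1%:M : 'M[R]_(2 + 2 + 2, 7)))) *
    F (dsubmx (rowsub f 1%:M : 'M[R]_(2 + 2 + 2, 7))) * T (rowsub f 1%:M).
Proof.
move=> Tl T0.
rewrite (@wedge_sum R C 4 2 7 (wedge F F) F T (alt0_altn Tl T0)).
rewrite exchange_big /=.
transitivity ((6`!)%:R / (4`! * 2`!)%:R * \sum_(h : {ffun 'I_2 -> 'I_7}) 6 *
   (F (rowsub h 1%:M) * \sum_(f : {ffun 'I_2 -> 'I_7}) \sum_(g : {ffun 'I_2 -> 'I_7})
      F (rowsub f 1%:M) * F (rowsub g 1%:M) *
      T (col_mx (col_mx (rowsub f 1%:M) (rowsub g 1%:M)) (rowsub h 1%:M)))).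
  apply: (f_equal (fun z => _ * z)); apply: eq_bigr => h _.
  have Th : altn (fun U : 'M[R]_(4, 7) => T (col_mx U (rowsub h 1%:M))).
    apply: (@alt0_altn R C iC); first exact: (@mlin_coll R C iC 4 2 7).
    exact: (@alt0_coll R C 4 2 7).
  have := @wedge_sum R C 2 2 7 F F _ Th.
  have -> : ((2 + 2)`!)%:R / (2`! * 2`!)%:R = 6 :> C.
    by rewrite (_ : (2 + 2)`! = (6 * (2`! * 2`!))%N) // natrM mulfK // pnatr_eq0.
  move=> E; rewrite mulrCA -E mulr_sumr; apply: eq_bigr => f _.
  by rewrite mulrA [F _ * _]mulrC.
rewrite -mulr_sumr mulrA; congr (_ * _).
  rewrite (_ : 6`! = (15 * (4`! * 2`!))%N) // natrM mulfK ?pnatr_eq0 //.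
  by rewrite -natrM.
rewrite (@big_ffun_split C _ 4 2) exchange_big; apply: eq_bigr => h _ /=.
rewrite (@big_ffun_split C _ 2 2) mulr_sumr; apply: eq_bigr => f _.
rewrite mulr_sumr; apply: eq_bigr => g _.
have -> : rowsub (finfun (@joinf _ 4 2 (finfun (@joinf _ 2 2 f g)) h)) 1%:M =
    col_mx (col_mx (rowsub f 1%:M) (rowsub g 1%:M)) (rowsub h 1%:M) :> 'M[R]_(2 + 2 + 2, 7).
  rewrite -!rowsub_join; apply: eq_rowsub => i; rewrite ffunE /joinf.
  by case: fintype.split => // k; rewrite ffunE.
rewrite col_mxKu col_mxKd !col_mxKu col_mxKd !mulrA; congr (_ * _).
by rewrite -mulrA mulrC.
Qed.

(* An antisymmetric matrix of odd size has a kernel vector u; the projection P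
   along u leaves the form A invariant, so the top-degree pairing below picks up
   the factor det P = 0. *)
Lemma antisym_cubic0 (A : 'M[C]_7) (c : 'I_7) : A^T = - A ->
  let z0 : 'I_2 := ord0 in let z1 : 'I_2 := lift ord0 ord0 in
  \sum_(f : {ffun 'I_6 -> 'I_7})
    A (f (@lshift 4 2 (@lshift 2 2 z0))) (f (@lshift 4 2 (@lshift 2 2 z1))) *
    A (f (@lshift 4 2 (@rshift 2 2 z0))) (f (@lshift 4 2 (@rshift 2 2 z1))) *
    A (f (@rshift 4 2 z0)) (f (@rshift 4 2 z1)) *
    \det (col_mx (rowsub f 1%:M) (row c A) : 'M[C]_7) = 0.
Proof.
move=> As z0 z1.
have dA : \det A = 0.
  have : \det A = - \det A.
    by rewrite -{1}det_tr As -scaleN1r detZ -signr_odd expr1 mulN1r.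
  by move/eqP; rewrite -addr_eq0 -mulr2n mulrn_eq0 => /eqP.
have /det0P[u u0 uA] : \det A == 0 by rewrite dA.
have [l ul] : exists l, u 0 l != 0.
  apply/existsP; rewrite -negb_forall; apply: contra u0 => /forallP H.
  by apply/eqP/rowP => l; rewrite mxE; apply/eqP.
pose P : 'M[C]_7 := 1%:M - (u 0 l)^-1 *: (delta_mx l 0 *m u).
have uP : u *m P = 0.
  rewrite /P mulmxBr mulmx1 -scalemxAr mulmxA.
  have -> : u *m delta_mx l 0 = (u 0 l)%:M.
    by apply/matrixP => i j; rewrite !mxE (ord1 i) (ord1 j) eqxx mulr1n (bigD1 l) //= big1 ?addr0 ?mxE ?eqxx ?mulr1 // => k kl; rewrite !mxE (negPf kl) mulr0.
  by rewrite mul_scalar_mx scalerA mulVf // scale1r subrr.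
have dP : \det P = 0.
  by apply/eqP/det0P; exists u.
have PA : P *m A = A.
  by rewrite /P mulmxBl mul1mx -scalemxAl -mulmxA uA mulmx0 scaler0 subr0.
have AP : A *m P^T = A.
  apply: trmx_inj; rewrite trmx_mul trmxK As mulmxN PA //.
pose idC : {rmorphism C -> C} := idfun.
pose q (X : 'M[C]_(2, 7)) := (X *m A *m X^T) ord0 (lift ord0 ord0).
have qE X : q X = \sum_i \sum_j (X ord0 i * A i j) * X (lift ord0 ord0) j.
  rewrite /q mxE; under eq_bigr => j _ do rewrite !mxE mulr_suml.
  by rewrite exchange_big.
have ql : mlin idC q.
  move=> V V1 V2 r x y H1 /row'P H2 /row'P H3; rewrite !qE !mulr_sumr -big_split.
  apply: eq_bigr => i _ /=; rewrite !mulr_sumr -big_split; apply: eq_bigr => j _ /=.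
  have rE (U : 'M[C]_(2, 7)) k m : U k m = row k U 0 m by rewrite mxE.
  rewrite !(rE _ (lift _ _)) !(rE _ ord0).
  case: (unliftP ord0 r) H1 H2 H3 => [k ->|->] H1 H2 H3.
    rewrite (ord1 k) in H1 H2 H3; rewrite H1 (H2 ord0) // (H3 ord0) // !mxE; ring.
  rewrite H1 (H2 (lift ord0 ord0)) // (H3 (lift ord0 ord0)) // !mxE; ring.
have qP X : q (X *m P) = q X.
  by rewrite /q trmx_mul !mulmxA -(mulmxA X P A) PA -(mulmxA X A) AP.
pose w (X : 'M[C]_(6, 7)) := q (usubmx (usubmx (X : 'M[C]_(2 + 2 + 2, 7)))) *
   q (dsubmx (usubmx (X : 'M[C]_(2 + 2 + 2, 7)))) * q (dsubmx (X : 'M[C]_(2 + 2 + 2, 7))).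
have wl : mlin idC w.
  have := @mlin_tensor C C idC 4 2 7 _ _ (@mlin_tensor C C idC 2 2 7 _ _ ql ql) ql.
  by [].
pose T (X : 'M[C]_(6, 7)) := \det (col_mx X (row c A) : 'M[C]_7).
have Tl : mlin idC T := @mlin_coll C C idC 6 1 7 _ _ (@det_mlin C C idC 7).
(* Since [q] is invariant under [P], each of the three factors may be evaluated on rows of [P]
   instead of basis vectors. *)
transitivity (\sum_(f : {ffun 'I_6 -> 'I_7}) w (rowsub f P) * T (rowsub f 1%:M)).
  apply: eq_bigr => f _; congr (_ * _).
  have qd (X : 'M[C]_(2, 7)) (g : 'I_2 -> 'I_7) : X = rowsub g P -> q X = A (g z0) (g z1).
    move=> ->; rewrite -[P]mul1mx -mul_rowsub_mx qP /q mul_rowsub_mx mul1mx.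
    rewrite -[_ *m _]trmxK trmx_mul trmxK mul_rowsub_mx mul1mx.
    by rewrite !mxE.
  rewrite /w; congr (_ * _ * _); symmetry.
  - by apply: (qd _ (fun i => f (@lshift 4 2 (@lshift 2 2 i)))); apply/matrixP => i j; rewrite !mxE.
  - by apply: (qd _ (fun i => f (@lshift 4 2 (@rshift 2 2 i)))); apply/matrixP => i j; rewrite !mxE.
  - by apply: (qd _ (fun i => f (@rshift 4 2 i))); apply/matrixP => i j; rewrite !mxE.
(* The projection now moves to the determinant. The last row, a row of [A], is also fixed by [P^T],
   so [P^T] factors out of the whole matrix. *)
rewrite (@sum_transfer_eq C C idC 6 7 7 7 7 w T P 1%:M 1%:M P^T) //; last first.
  by rewrite mulmx1 trmx1 mul1mx.
rewrite big1 // => f _; rewrite /T.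
have -> : (col_mx (rowsub f P^T) (row c A) : 'M[C]_7) = (col_mx (rowsub f 1%:M) (row c A) : 'M[C]_7) *m P^T.
  by rewrite (@mul_col_mx _ 6 1) mul_rowsub_mx mul1mx -row_mul AP.
by rewrite det_mulmx det_tr dP !mulr0.
Qed.

(** In [beta d] the index [d] occurs only as the last row e_d of a determinant. By linearity in that
    row, the sum over [d] replaces it by the row [c] of [F], which is the situation of
    [antisym_cubic0]. *)
Lemma F_beta0 c : (c < 7)%N -> \sum_(d < 7) Fab c d * beta d = 0.
Proof.
move=> c7.
pose A : 'M[C]_7 := \matrix_(i, j) Fab i j.
have As : A^T = - A by apply/matrixP => i j; rewrite !mxE FabC.
have /= := antisym_cubic0 (Ordinal c7) As.
set z0 : 'I_2 := ord0; set z1 : 'I_2 := lift ord0 ord0.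
set Q := (X in X = 0) => H.
pose T v (U : 'M[R]_(6, 7)) := iC (\det (col_mx U v : 'M[R]_7)).
have Tl v : mlin iC (T v) := @mlin_coll R C iC 6 1 7 _ _ (@det_mlin R C iC 7).
have T0 v : alt0 (T v) := @alt0_coll R C 6 1 7 _ _ (@det_alt0 R C iC 7).
have FA (X : 'M[R]_(2, 7)) (g : 'I_2 -> 'I_7) : X = rowsub g 1%:M -> F X = A (g z0) (g z1).
  move=> ->; rewrite mxE /Fab; congr F; apply/matrixP => i j; rewrite !mxE.
  congr (_ == _)%:R; case: i => -[|[|]] //= h; rewrite inord_val; congr g; exact: val_inj.
have bE d : beta d = 6^-1 * ((6`!)%:R^-1 * (90 * \sum_(f : {ffun 'I_6 -> 'I_7})
    A (f (@lshift 4 2 (@lshift 2 2 z0))) (f (@lshift 4 2 (@lshift 2 2 z1))) *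
    A (f (@lshift 4 2 (@rshift 2 2 z0))) (f (@lshift 4 2 (@rshift 2 2 z1))) *
    A (f (@rshift 4 2 z0)) (f (@rshift 4 2 z1)) *
    T (bas R 1 6 [:: d]) (rowsub f 1%:M))).
  rewrite /beta (@extC_hodge1 6 1) (wedge3_sum (Tl _) (T0 _)).
  apply: (f_equal (fun z => _ * (_ * (_ * z)))); apply: eq_bigr => f _; congr (_ * _ * _ * _).
  - by apply: (FA _ (fun i => f (@lshift 4 2 (@lshift 2 2 i)))); apply/matrixP => i j; rewrite !mxE.
  - by apply: (FA _ (fun i => f (@lshift 4 2 (@rshift 2 2 i)))); apply/matrixP => i j; rewrite !mxE.
  - by apply: (FA _ (fun i => f (@rshift 4 2 i))); apply/matrixP => i j; rewrite !mxE.
under eq_bigr => d _ do rewrite bE !mulrA mulr_sumr.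
rewrite exchange_big /=.
transitivity (6^-1 * (6`!)%:R^-1 * 90 * Q); last by rewrite H mulr0.
rewrite /Q [RHS]mulr_sumr; apply: eq_bigr => f _.
have -> : \det (col_mx (rowsub f 1%:M) (row (Ordinal c7) A) : 'M[C]_7) =
    \sum_(d < 7) Fab c d * T (bas R 1 6 [:: val d]) (rowsub f 1%:M).
  pose idC : {rmorphism C -> C} := idfun.
  have ml : mlin idC (fun v : 'M[C]_(1, 7) => \det (col_mx (rowsub f 1%:M) v : 'M[C]_7)).
    exact: (@mlin_colr C C idC 6 1 7 _ _ (@det_mlin C C idC 7)).
  rewrite [row _ A]row_sum_delta (@mlin_row C C idC 7 _ _ _ _ _ ml).
  apply: eq_bigr => d _; congr (_ * _); first by rewrite !mxE.
  rewrite /T -det_map_mx; congr (\det _).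
  rewrite (@map_col_mx _ _ _ 6 1).
  have -> : map_mx iC (rowsub f 1%:M) = rowsub f 1%:M.
    by apply/matrixP => i j; rewrite !mxE; case: eqP => _; rewrite ?rmorph1 ?rmorph0.
  suff -> : map_mx iC (bas R 1 6 [:: val d]) = delta_mx 0 d by [].
  apply/matrixP => i j; rewrite !mxE (ord1 i) eqxx /= inord_val eq_sym.
  by case: eqP => _; rewrite ?rmorph1 ?rmorph0.
rewrite !mulr_sumr; apply: eq_bigr => d _.
set x1 := A _ _; set x2 := A _ _; set x3 := A _ _; set t := T _ _.
set k1 : C := 6^-1; set k2 : C := _^-1.
move: (90 : C) => k3; ring.
Qed.

(** By [lam_tab] the contraction is a sum of four terms, according to the slot occupied by e^j. In
    each, one copy of [F] is contracted with [phi] into [S], and the other pairs [S] with the index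
    [j]; as [S = -2 beta], [F_beta0] applies. *)
Lemma lam_sum0 j : (forall d, (d < 7)%N -> 2^-1 * S d + beta d = 0) -> (j < 7)%N ->
  \sum_(f : {ffun 'I_4 -> 'I_8}) wedge F' F' (rowsub f 1%:M) *
    iC (combo (lamL j) (rowsub f 1%:M)) = 0.
Proof.
move=> H j7.
have Sb d : (d < 7)%N -> S d = - 2 * beta d.
  move=> d7; have /eqP := H d d7; rewrite addrC addr_eq0 => /eqP ->.
  by rewrite mulrNN mulrA mulfV ?mul1r // pnatr_eq0.
have Sc b : (b < 7)%N -> \sum_(c < 7) \sum_(d < 7) Fab c d * (phit b c d)%:~R = S b.
  move=> b7; apply: eq_bigr => c _; apply: eq_bigr => d _.
  by rewrite (eqP (all3E phi_cycle_tab (ltn_ord c) (ltn_ord d) b7)).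
pose T (U : 'M[R]_(4, 8)) := iC (combo (lamL j) U).
have Tl : mlin iC T := mlin_idC iC (@combo_mlin R 4 7 (lamL j)).
have T0 : alt0 T.
  move=> V r1 r2 r12 e; by rewrite /T (@combo_alt0 R 4 7 (lamL j) _ _ _ r12 e) rmorph0.
rewrite (@wedge_sum R C 2 2 8 F' F' T (alt0_altn Tl T0)).
set k := (_ / _); suff -> : \sum_(f : {ffun 'I_2 -> 'I_8}) \sum_(g : {ffun 'I_2 -> 'I_8})
  F' (rowsub f 1%:M) * F' (rowsub g 1%:M) * T (col_mx (rowsub f 1%:M) (rowsub g 1%:M)) = 0 by rewrite mulr0.
pose t a b c d : C := (comboi (lamL j) [:: a; b; c; d])%:~R.
pose f2 a b := F' (bas R 2 7 [:: a; b]).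
have f2C a b : f2 a b = - f2 b a.
  by apply: (@bas2C 7); [exact: (@mlin_pr2 2 1 7)|exact: (@alt0_pr2 2 1 7)].
transitivity (\sum_(a < 8) \sum_(b < 8) f2 a b * \sum_(c < 8) \sum_(d < 8) f2 c d * t a b c d).
  rewrite (@sum_bas2 R C 7 (fun X => \sum_(g : {ffun 'I_2 -> 'I_8}) F' X * F' (rowsub g 1%:M) * T (col_mx X (rowsub g 1%:M)))).
  apply: eq_bigr => a _; apply: eq_bigr => b _.
  rewrite (@sum_bas2 R C 7 (fun Y => F' (bas R 2 7 [:: val a; val b]) * F' Y * T (col_mx (bas R 2 7 [:: val a; val b]) Y))).
  rewrite mulr_sumr; apply: eq_bigr => c _; rewrite mulr_sumr; apply: eq_bigr => d _.
  rewrite -mulrA (@col_bas R 2 2) // /T /t.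
  have /andP[ol _] := all_ltn okl_lam j7.
  by rewrite (@combo_bas R 4 7 (lamL j) _ ol) ?rmorph_int //= !ltn_ord.
have f20 b : f2 0%N b = 0 by exact: F'_bas0.
(* The pulled-back curvature vanishes on [e_0], so every sum over eight indices reduces to one over
   seven. *)
have red (h : nat -> nat -> C) : \sum_(a < 8) \sum_(b < 8) f2 a b * h a b = \sum_(a < 7) \sum_(b < 7) Fab a b * h a.+1 b.+1.
  rewrite (split8 (fun a b => f2 a b * h a b)) f20 mul0r add0r big1 ?add0r.
    by apply: eq_bigr => a _; apply: eq_bigr => b _; rewrite /f2 F'_bas.
  by move=> b _; rewrite f20 f2C f20 oppr0 !mul0r addr0.
rewrite (red (fun a b => \sum_(c < 8) \sum_(d < 8) f2 c d * t a b c d)).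
under eq_bigr => a _ do under eq_bigr => b _ do rewrite (red (t a.+1 b.+1)).
pose de a : C := (delta j a)%:~R.
pose ph a b c : C := (phit a b c)%:~R.
have Z : \sum_(b < 7) Fab j b * S b = 0.
  under eq_bigr => b _ do rewrite Sb // mulrCA.
  by rewrite -mulr_sumr F_beta0 // mulr0.
have Z' : \sum_(b < 7) Fab b j * S b = 0.
  under eq_bigr => b _ do rewrite FabC mulNr.
  by rewrite sumrN Z oppr0.
pose S4 (h : nat -> nat -> nat -> nat -> C) :=
  \sum_(a < 7) \sum_(b < 7) \sum_(c < 7) \sum_(d < 7) h a b c d.
have S4D h1 h2 : S4 (fun a b c d => h1 a b c d + h2 a b c d) = S4 h1 + S4 h2.
  rewrite /S4 -big_split; apply: eq_bigr => a _; rewrite -big_split; apply: eq_bigr => b _.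
  by rewrite -big_split; apply: eq_bigr => c _; rewrite -big_split.
transitivity (S4 (fun a b c d => de a * (- Fab a b * (Fab c d * ph b c d)) +
    (de b * (Fab a b * (Fab c d * ph a c d)) +
    (de c * (- Fab c d * (Fab a b * ph a b d)) + de d * (Fab c d * (Fab a b * ph a b c)))))).
  apply: eq_bigr => a _; apply: eq_bigr => b _.
  rewrite mulr_sumr; apply: eq_bigr => c _; rewrite mulr_sumr; apply: eq_bigr => d _.
  rewrite /t (eqP (all4E (all_ltn lam_tab j7) (ltn_ord a) (ltn_ord b) (ltn_ord c) (ltn_ord d))).
  rewrite /de /ph mulrNz intrB intrD intrB !intrM.
  move: (delta j a) (delta j b) (delta j c) (delta j d) => d1 d2 d3 d4.
  move: (phit b c d) (phit a c d) (phit a b d) (phit a b c) => p1 p2 p3 p4.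
  move: (d1%:~R : C) (d2%:~R : C) (d3%:~R : C) (d4%:~R : C) => e1 e2 e3 e4.
  move: (p1%:~R : C) (p2%:~R : C) (p3%:~R : C) (p4%:~R : C) => q1 q2 q3 q4.
  move: (Fab a b) (Fab c d) => x y; ring.
have deE a : de a = (delta a j)%:~R by rewrite /de /delta eq_sym.
rewrite 3!S4D.
have -> : S4 (fun a b c d => de a * (- Fab a b * (Fab c d * ph b c d))) = 0.
  rewrite /S4; transitivity (\sum_(a < 7) (delta a j)%:~R * \sum_(b < 7) - (Fab a b * S b)).
    apply: eq_bigr => a _; rewrite mulr_sumr; apply: eq_bigr => b _.
    rewrite -(Sc b) // -mulNr !mulr_sumr; apply: eq_bigr => c _; rewrite !mulr_sumr; apply: eq_bigr => d _.
    by rewrite deE.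
  by rewrite (sum_delta (fun a => \sum_(b < 7) - (Fab a b * S b))) // sumrN Z oppr0.
have -> : S4 (fun a b c d => de b * (Fab a b * (Fab c d * ph a c d))) = 0.
  rewrite /S4; transitivity (\sum_(b < 7) (delta b j)%:~R * \sum_(a < 7) (Fab a b * S a)).
    rewrite exchange_big; apply: eq_bigr => b _; rewrite mulr_sumr; apply: eq_bigr => a _.
    rewrite -(Sc a) // !mulr_sumr; apply: eq_bigr => c _; rewrite !mulr_sumr; apply: eq_bigr => d _.
    by rewrite deE.
  by rewrite (sum_delta (fun b => \sum_(a < 7) (Fab a b * S a))) // Z'.
have sw h : S4 h = \sum_(c < 7) \sum_(d < 7) \sum_(a < 7) \sum_(b < 7) h a b c d.
  rewrite /S4; under eq_bigr => a _ do rewrite exchange_big.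
  rewrite exchange_big; apply: eq_bigr => c _ /=.
  under eq_bigr => a _ do rewrite exchange_big.
  by rewrite exchange_big.
have -> : S4 (fun a b c d => de c * (- Fab c d * (Fab a b * ph a b d))) = 0.
  rewrite sw; transitivity (\sum_(c < 7) (delta c j)%:~R * \sum_(d < 7) - (Fab c d * S d)).
    apply: eq_bigr => c _; rewrite mulr_sumr; apply: eq_bigr => d _.
    rewrite -mulNr !mulr_sumr; apply: eq_bigr => a _; rewrite !mulr_sumr; apply: eq_bigr => b _.
    by rewrite deE.
  by rewrite (sum_delta (fun a => \sum_(b < 7) - (Fab a b * S b))) // sumrN Z oppr0.
have -> : S4 (fun a b c d => de d * (Fab c d * (Fab a b * ph a b c))) = 0.
  rewrite sw; transitivity (\sum_(d < 7) (delta d j)%:~R * \sum_(c < 7) (Fab c d * S c)).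
    rewrite exchange_big; apply: eq_bigr => d _; rewrite mulr_sumr; apply: eq_bigr => c _.
    rewrite !mulr_sumr; apply: eq_bigr => a _; rewrite !mulr_sumr; apply: eq_bigr => b _.
    by rewrite deE.
  by rewrite (sum_delta (fun b => \sum_(a < 7) (Fab a b * S a))) // Z'.
by rewrite !addr0.
Qed.

Lemma g2_dDT_std_coef : (forall V, g2_dDT_std V = 0) ->
  forall d, (d < 7)%N -> 2^-1 * S d + beta d = 0.
Proof.
move=> H d d7; rewrite -g2_dDT_std_star // (@extC_hodge1 6 1) big1 ?mulr0 // => f _.
by rewrite H mul0r.
Qed.

(* The derivations by antisymmetric matrices map the model 4-form into the span
   of the forms lambda47; this makes the space Lambda47 independent of the frame. *)
Lemma der_Phi0 (A : 'M[R]_8) : A^T = - A ->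
  der A (@Phi0 R) =1 fun V =>
    \sum_(j < 7) (2^-1 * \sum_(p < 8) \sum_(q < 8) A p q * (ctab p q j)%:~R) *
      combo (n := 7) (lamL j) V.
Proof.
move=> As.
have -> : @Phi0 R = combo PhiL by apply/funext => V; rewrite Phi0E.
have Pl := @combo_mlin R 4 7 PhiL.
apply: (@alt_ext R R idR 4 7).
- exact: mlin_der.
- by apply: mlin_sum => j _; apply: mlinZ; exact: combo_mlin.
- by apply: altn_alt0; apply: altn_der; exact: combo_altn.
- move=> V r1 r2 r12 e; rewrite big1 // => j _.
  by rewrite (@combo_alt0 R 4 7 (lamL j) _ _ _ r12 e) mulr0.
move=> s sS; have [ss sa] := mem_subs sS.
have n2 : 2 != 0 :> R by rewrite pnatr_eq0.
apply: (mulfI n2); rewrite der_antisym // mulr_sumr.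
under [RHS]eq_bigr => j _ do rewrite !mulrA mulfV // mul1r mulr_suml.
rewrite [RHS]exchange_big; apply: eq_bigr => p _ /=.
under [RHS]eq_bigr => j _ do rewrite mulr_suml.
rewrite [RHS]exchange_big; apply: eq_bigr => q _ /=.
under [RHS]eq_bigr => j _ do rewrite -mulrA.
rewrite -mulr_sumr; congr (_ * _).
have sset r x : (r < 4)%N -> (x < 8)%N -> size (set_nth 0%N s r x) = 4 /\ all (fun a => a < 8)%N (set_nth 0%N s r x).
  move=> r4 x8; case: (size4P ss) sa => a [b [c [d ->]]] /and5P[h1 h2 h3 h4 _].
  by move: r r4 => [|[|[|[|]]]] //= _; rewrite ?h1 ?h2 ?h3 ?h4 ?x8.
transitivity ((dertab p q s)%:~R : R).
  rewrite /dertab (foldr_sumE (fun r => (if nth 0%N s r == p then comboi PhiL (set_nth 0%N s r q) else 0)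
                  - (if nth 0%N s r == q then comboi PhiL (set_nth 0%N s r p) else 0))).
  rewrite rmorph_sum -[iota 0 4]/(index_iota 0 4) big_mkord; apply: eq_bigr => r _.
  have sr : (nth 0%N s r < 8)%N by apply: (allP sa); rewrite mem_nth ?ss.
  rewrite rmorphB -!val_eqE /= inordK //; congr (_ - _).
    case: ifP => _; rewrite ?mul0r // mul1r.
    by have [h1 h2] := sset r q (ltn_ord r) (ltn_ord q); rewrite combo_bas.
  case: ifP => _; rewrite ?mul0r // mul1r.
  by have [h1 h2] := sset r p (ltn_ord r) (ltn_ord p); rewrite combo_bas.
rewrite (eqP (allP (all_ltn (all_ltn der_tab (ltn_ord p)) (ltn_ord q)) s sS)).
rewrite (foldr_sumE (fun j => ctab p q j * comboi (lamL j) s)).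
rewrite rmorph_sum -[iota 0 7]/(index_iota 0 7) big_mkord; apply: eq_bigr => j _.
have /andP[oj _] := all_ltn okl_lam (ltn_ord j).
by rewrite rmorphM (@combo_bas R 4 7 _ _ oj).
Qed.

Lemma der_sum0 (A : 'M[R]_8) : (forall V, g2_dDT_std V = 0) -> A^T = - A ->
  \sum_(f : {ffun 'I_4 -> 'I_8}) wedge F' F' (rowsub f 1%:M) *
    iC (der A (@Phi0 R) (rowsub f 1%:M)) = 0.
Proof.
move=> H As.
under eq_bigr => f _ do rewrite (der_Phi0 As) rmorph_sum mulr_sumr.
rewrite exchange_big big1 // => j _ /=.
under eq_bigr => f _ do rewrite rmorphM mulrCA.
by rewrite -mulr_sumr lam_sum0 ?mulr0 // => d; exact: g2_dDT_std_coef.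
Qed.

(** The matrix is the infinitesimal rotation in the planes spanned by [e_0] and the direction [a].
    Its entries (0, q) and (q, 0) contribute equally, which compensates the 1/2 of [der_Phi0]. *)
Lemma lambda47_der (a : 'rV[R]_7) : exists A : 'M[R]_8, A^T = - A /\
  lambda47 a =1 der A (@Phi0 R).
Proof.
pose A : 'M[R]_8 := block_mx 0 a (- a^T) 0 : 'M[R]_(1 + 7).
have As : A^T = - A.
  by rewrite /A (@tr_block_mx _ 1 7 1 7) (@opp_block_mx _ 1 7 1 7) linearN /= !trmxK !trmx0 !oppr0 opprK.
exists A; split=> // V; rewrite lambda47E (der_Phi0 As); apply: eq_bigr => j _.
have l0 : ord0 = lshift 7 ord0 :> 'I_(1 + 7) by apply: val_inj.
have l1 (i : 'I_7) : lift ord0 i = rshift 1 i :> 'I_(1 + 7) by apply: val_inj.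
have A00 : A ord0 ord0 = 0 by rewrite /A l0 (@block_mxEul _ 1 7 1 7) mxE.
have A0q (q : 'I_7) : A ord0 (lift ord0 q) = a 0 q by rewrite /A l1 l0 (@block_mxEur _ 1 7 1 7).
have Ap0 (p : 'I_7) : A (lift ord0 p) ord0 = - a 0 p.
  by rewrite /A l1 l0 (@block_mxEdl _ 1 7 1 7) !mxE.
have Apq (p q : 'I_7) : A (lift ord0 p) (lift ord0 q) = 0.
  by rewrite /A !l1 (@block_mxEdr _ 1 7 1 7) mxE.
have sd (f : 'I_7 -> R) : \sum_(p < 7) f p * (delta p j)%:~R = f j.
  rewrite (bigD1 j) //= /delta eqxx mulr1 big1 ?addr0 // => p.
  by rewrite -val_eqE => /negPf /= ->; rewrite mulr0.
congr (_ * _); rewrite big_ord_recl [X in _ * (X + _)]big_ord_recl A00 mul0r add0r.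
under eq_bigr => q _ do rewrite A0q /=.
rewrite sd [X in _ + X](_ : _ = a 0 j); last first.
  rewrite -[RHS](sd (fun j => a 0 j)); apply: eq_bigr => p _.
  rewrite big_ord_recl Ap0 big1 ?addr0; last by move=> q _; rewrite Apq mul0r.
  by rewrite /= rmorphN mulrNN.
by rewrite -mulr2n -[X in _ * X]mulr_natl mulKf // pnatr_eq0.
Qed.

End Pointwise.
End Complexified.

(** * From the model frame to adapted frames *)

Section Frames.
Variable (R : realType).
Local Notation C := R[i].
Let idR : {rmorphism R -> R} := idfun.
Let iC : {rmorphism R -> C} := real_complex R.

Lemma in_frame_pull K k n (E : 'M[R]_n) (w : form R K k n) :
  E \in unitmx -> w = in_frame E (fun V => w (V *m E)).
Proof. by move=> uE; apply/funext => V; rewrite /in_frame mulmxKV. Qed.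

Lemma wedge_frame (K : fieldType) p q n (E : 'M[R]_n) (a : form R K p n) (b : form R K q n) :
  wedge (in_frame E a) (in_frame E b) = in_frame E (wedge a b).
Proof.
apply/funext => V; rewrite /in_frame /wedge; congr (_ * _); apply: eq_bigr => s _.
by rewrite [row_perm s (V *m _)]row_permE mulmxA -row_permE -mul_usub_mx -mul_dsub_mx.
Qed.

Lemma mlin_Re k n (w : form R C k n) : mlin iC w -> mlin idR (fun V => complex.Re (w V)).
Proof.
move=> wl V V1 V2 r b c H1 H2 H3; rewrite (wl V V1 V2 r b c H1 H2 H3).
by rewrite ReD !ReZ.
Qed.

Lemma mlin_Im k n (w : form R C k n) : mlin iC w -> mlin idR (fun V => complex.Im (w V)).
Proof.
move=> wl V V1 V2 r b c H1 H2 H3; rewrite (wl V V1 V2 r b c H1 H2 H3).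
by rewrite ImD !ImZ.
Qed.

Lemma extC_hodge_frame k m (G E : 'M[R]_(k + m)) (w : form R C k (k + m)) :
  mlin iC w -> oriented_orthonormal G E ->
  extC (hodge G) (in_frame E w) = in_frame E (extC (hodge 1%:M) w).
Proof.
move=> wl [dE EGE]; apply/funext => V; rewrite /extC.
congr Complex.
  rewrite -[RHS](@hodge_frame R k m G E 1%:M _ V (mlin_Re wl) EGE dE) //.
  by rewrite det1.
rewrite -[RHS](@hodge_frame R k m G E 1%:M _ V (mlin_Im wl) EGE dE) //.
by rewrite det1.
Qed.

Definition block1 n (E : 'M[R]_n) : 'M[R]_(1 + n) := block_mx 1%:M 0 0 E.

Lemma block1M n (A B : 'M[R]_n) : block1 A *m block1 B = block1 (A *m B).
Proof. by rewrite mulmx_block !mulmx0 !mul0mx !addr0 !add0r mulmx1. Qed.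
Lemma block1T n (A : 'M[R]_n) : (block1 A)^T = block1 A^T.
Proof. by rewrite tr_block_mx trmx1 !trmx0. Qed.
Lemma block1_1 n : block1 1%:M = 1%:M :> 'M[R]_(1 + n).
Proof. by rewrite /block1 -scalar_mx_block. Qed.
Lemma det_block1 n (A : 'M[R]_n) : \det (block1 A) = \det A.
Proof. by rewrite det_ublock det1 mul1r. Qed.
Lemma block1V n (A : 'M[R]_n) : A \in unitmx -> invmx (block1 A) = block1 (invmx A).
Proof.
move=> uA; have u8 : block1 A \in unitmx by rewrite unitmxE det_block1 -unitmxE.
by apply: (can_inj (mulKmx u8)); rewrite mulmxV // block1M mulmxV // block1_1.
Qed.
Lemma rsubmx_block1 k n (V : 'M[R]_(k, 1 + n)) (A : 'M[R]_n) :
  rsubmx (V *m block1 A) = rsubmx V *m A.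
Proof. by rewrite -[V in LHS]hsubmxK mul_row_block !mulmx0 addr0 add0r row_mxKr. Qed.
Lemma lsubmx_block1 k n (V : 'M[R]_(k, 1 + n)) (A : 'M[R]_n) :
  lsubmx (V *m block1 A) = lsubmx V.
Proof. by rewrite -[V in LHS]hsubmxK mul_row_block !mulmx0 addr0 mulmx1 row_mxKl. Qed.

Lemma dx0_block1 n (V : 'M[R]_(1, 1 + n)) (A : 'M[R]_n) : dx 0 (V *m block1 A) = dx 0 V.
Proof.
have E (W : 'M[R]_(1, 1 + n)) : dx 0 W = lsubmx W 0 0.
  by rewrite mxE; congr (W _ _); apply: val_inj.
by rewrite !E lsubmx_block1.
Qed.

Lemma cylinder_form_pull phi psi (V : 'M[R]_(4, 1 + 7)) (A : 'M[R]_7) :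
  cylinder_form phi psi (V *m block1 A) =
  cylinder_form (fun U => phi (U *m A)) (fun U => psi (U *m A)) V.
Proof.
rewrite /cylinder_form (@wedge_pull R R 1 3 8 8); congr (_ + _).
  apply: (@wedge_pull_eq R 1 3 8 R) => U; first exact: dx0_block1.
  by rewrite /form_pr2 rsubmx_block1.
by rewrite /form_pr2 rsubmx_block1.
Qed.

Variables (G E : 'M[R]_7) (phi : form R R 3 7).
Hypothesis (fE : g2_frame phi G E).
Let G8 := block1 G.
Let E8 := block1 E.
Let Phi := cylinder_form phi (star_phi G phi).

Let dE : 0 < \det E. Proof. by case: fE => -[]. Qed.
Let uE : E \in unitmx. Proof. by rewrite unitmxE unitfE gt_eqF. Qed.
Let EGE : E *m G *m E^T = 1%:M. Proof. by case: fE => -[]. Qed.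

Lemma phi0_mlin : mlin idR (@phi0 R).
Proof.
rewrite (_ : @phi0 R = combo phiL); first exact: combo_mlin.
by apply/funext => V; rewrite phi0E.
Qed.

Lemma star_phi_frame : star_phi G phi = in_frame E (@psi0 R).
Proof.
have -> : phi = in_frame E (@phi0 R) by apply/funext => V; case: fE => _ ->.
apply/funext => V; rewrite /star_phi (@hodge_frame R 3 4 G E 1%:M) ?det1 //; last exact: phi0_mlin.
by rewrite /in_frame -star_phi0.
Qed.

Lemma oriented_orthonormal_block1 : oriented_orthonormal G8 E8.
Proof. by split; rewrite ?det_block1 // block1T !block1M EGE block1_1. Qed.

Lemma u8 : E8 \in unitmx.
Proof. by rewrite unitmxE det_block1 -unitmxE. Qed.

Lemma Phi_frame : Phi = in_frame E8 (@Phi0 R).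
Proof.
apply/funext => V; rewrite /in_frame /E8 block1V // /Phi0 cylinder_form_pull /Phi.
congr (cylinder_form _ _ V); apply/funext => U; first by case: fE => _ ->.
by rewrite star_phi_frame /in_frame star_phi0.
Qed.

Lemma spin7_frame_block1 : spin7_frame Phi G8 E8.
Proof. by split; [exact: oriented_orthonormal_block1|move=> V; rewrite Phi_frame]. Qed.

Variable F : form R C 2 7.
Hypotheses (Fl : mlin iC F) (F0 : alt0 F).
Let Fs : form R C 2 7 := fun V => F (V *m E).
Let Fsl : mlin iC Fs. Proof. exact: mlin_pull. Qed.
Let Fs0 : alt0 Fs. Proof. exact: alt0_pull. Qed.

Definition g2_dDT_at : form R C 6 7 := fun V =>
  wedge (formC (star_phi G phi)) F V + 6^-1 * wedge (wedge F F) F V.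

Let F' : form R C 2 (1 + 7) := form_pr2 F.

Definition spin7_F1_at : form R C 2 (1 + 7) := extC (pi27 Phi G8) (fun V =>
    F' V + 6^-1 * extC (hodge (k := 6) (m := 2) G8) (wedge (wedge F' F') F') V).

Definition spin7_F2_at : form R C 4 (1 + 7) := extC (pi47 Phi G8) (wedge F' F').

Lemma F_frame : F = in_frame E Fs. Proof. exact: in_frame_pull. Qed.

Lemma F'_frame : F' = in_frame E8 (form_pr2 (m := 1) Fs).
Proof.
apply/funext => V; rewrite /F' F_frame /in_frame /form_pr2 /E8 block1V //.
by rewrite rsubmx_block1.
Qed.

Lemma g2_dDT_frame V : g2_dDT_at V = in_frame E (g2_dDT_std Fs) V.
Proof.
rewrite /g2_dDT_at star_phi_frame {1 2 3 4}F_frame !wedge_frame /in_frame /g2_dDT_std; congr (_ + _).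
have -> : formC (fun V => @psi0 R (V *m invmx E)) = in_frame E (formC (@psi0 R)) by [].
by rewrite (@wedge_frame C 4 2).
Qed.

Lemma spin7_F1_frame V : spin7_F1_at V = in_frame E8 (spin7_F1_std Fs) V.
Proof.
have ooE := oriented_orthonormal_block1.
rewrite /spin7_F1_at F'_frame !wedge_frame.
rewrite (@extC_hodge_frame 6 2 G8 E8) //; last first.
  apply: (@mlin_wedge R C iC 4 2 8); last exact: (@mlin_pr2 R 2 1 7).
  by apply: (@mlin_wedge R C iC 2 2 8); exact: (@mlin_pr2 R 2 1 7).
have -> : (fun V0 => in_frame E8 (form_pr2 (m := 1) Fs) V0 + 6^-1 *
     in_frame E8 (extC (hodge (k := 6) (m := 2) 1%:M) (wedge (wedge (form_pr2 (m := 1) Fs) (form_pr2 Fs)) (form_pr2 Fs))) V0)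
  = in_frame E8 (spin7_alpha Fs) by [].
rewrite extC_pi27 /in_frame /spin7_F1_std extC_pi27; congr (_ * (_ + _)).
have -> : formC Phi = in_frame E8 (formC (@Phi0 R)) by rewrite Phi_frame.
have -> : (fun V0 => spin7_alpha Fs (V0 *m invmx E8)) = in_frame E8 (spin7_alpha Fs) by [].
rewrite (@wedge_frame C 4 2 8) (@extC_hodge_frame 6 2 G8 E8) //.
apply: (@mlin_wedge R C iC 4 2 8); last exact: mlin_alpha.
apply: (@mlin_idC R 4 8 iC (@Phi0 R)).
have -> : @Phi0 R = combo PhiL by apply/funext => U; rewrite Phi0E.
exact: (@combo_mlin R 4 7).
Qed.

Lemma g2_dDT_F1_at : (forall V, g2_dDT_at V = 0) <-> (forall V, spin7_F1_at V = 0).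
Proof.
split=> H V.
  rewrite spin7_F1_frame; apply: g2_dDT_std_F1 => // U.
  by have := H (U *m E); rewrite g2_dDT_frame /in_frame mulmxK.
rewrite g2_dDT_frame; apply: F1_std_g2_dDT => // U.
by have := H (U *m E8); rewrite spin7_F1_frame /in_frame mulmxK // u8.
Qed.

Lemma lambda47_mlin (a : 'rV[R]_7) : mlin idR (lambda47 a).
Proof.
rewrite (_ : lambda47 a = fun V => \sum_j a 0 j * combo (n := 7) (lamL j) V).
  by apply: mlin_sum => j _; apply: mlinZ; exact: combo_mlin.
by apply/funext => V; rewrite lambda47E.
Qed.

Lemma Lambda47_mlin w : Lambda47 Phi G8 w -> mlin idR w.
Proof.
move=> [E1 [a [_ wE]]].
have -> : w = in_frame E1 (lambda47 a) by apply/funext => V; rewrite wE.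
by apply: (@mlin_pull R R idR 4 8 8); exact: lambda47_mlin.
Qed.

(** The element [w] is given in an arbitrary adapted frame [E1] and is rewritten in the frame [E8]
    of the product. There it is still a derivation of the model 4-form by an antisymmetric matrix,
    so [der_sum0] gives the orthogonality. *)
Lemma Lambda47_sum0 w : (forall V, g2_dDT_at V = 0) -> Lambda47 Phi G8 w ->
  form_inner G8 (fun V => complex.Re (wedge F' F' V)) w = 0 /\
  form_inner G8 (fun V => complex.Im (wedge F' F' V)) w = 0.
Proof.
move=> H wL; have wl := Lambda47_mlin wL.
case: wL => E1 [a [[[d1 EE1] PE1] wE]].
have u1 : E1 \in unitmx by rewrite unitmxE unitfE gt_eqF.
have H0 V : g2_dDT_std Fs V = 0.
  by have := H (V *m E); rewrite g2_dDT_frame /in_frame mulmxK.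
(* The transition between the two adapted frames: orthogonal because both are orthonormal for [G8],
   and preserving [Phi0] because both express the same [Phi]. *)
pose Q := E8 *m invmx E1.
have uQ : Q \in unitmx by rewrite unitmx_mul unitmx_inv u1 u8.
have QQ : Q *m Q^T = 1%:M.
  have [_ <-] := oriented_orthonormal_block1.
  rewrite /Q trmx_mul !mulmxA; congr (_ *m _); rewrite -!mulmxA; congr (_ *m _).
  apply: (can_inj (mulKmx u1)); apply: (can_inj (mulmxK (_ : E1^T \in unitmx))).
    by rewrite unitmx_tr.
  by rewrite EE1 mulmxA mulmxV // mul1mx -trmx_mul mulmxV // trmx1.
have QV : invmx Q = Q^T by apply: (can_inj (mulKmx uQ)); rewrite mulmxV.
pose w0 : form R R 4 8 := fun V => w (V *m E8).
have w0l : mlin idR w0 by exact: (@mlin_pull R R idR 4 8 8).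
have [A [As lA]] := lambda47_der a.
pose A' := Q *m A *m Q^T.
have A's : A'^T = - A'.
  rewrite /A' [LHS]trmx_mul trmxK [(Q *m A)^T]trmx_mul As mulNmx mulmxN mulmxA.
  by [].
have w0E V : w0 V = der A' (@Phi0 R) V.
  rewrite /w0 wE /in_frame -mulmxA -/Q lA der_conj // QV -/A'.
  rewrite (_ : (fun U => @Phi0 R (U *m Q)) = @Phi0 R) //; apply/funext => U.
  have := PE1 (U *m E8); rewrite Phi_frame /in_frame mulmxK ?u8 // => ->.
  by rewrite /Q mulmxA.
have wF : w = in_frame E8 w0 by apply: in_frame_pull; exact: u8.
have FF : wedge F' F' = in_frame E8 (wedge (form_pr2 (m := 1) Fs) (form_pr2 (m := 1) Fs)).
  by rewrite F'_frame wedge_frame.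
have WL : mlin iC (wedge (form_pr2 (m := 1) Fs) (form_pr2 (m := 1) Fs)).
  by apply: (@mlin_wedge R C iC 2 2 8); exact: (@mlin_pr2 R 2 1 7).
have Z := der_sum0 Fsl Fs0 H0 A's.
split; rewrite FF wF.
  rewrite (form_inner_frame (mlin_Re WL) w0l oriented_orthonormal_block1) /form_inner invmx1.
  rewrite -[X in _ * X](_ : complex.Re (0 : C) = _) ?mulr0 // -[in LHS]Z Re_sum; apply: eq_bigr => f _.
  by rewrite mulrC ReZ w0E mulrC.
rewrite (form_inner_frame (mlin_Im WL) w0l oriented_orthonormal_block1) /form_inner invmx1.
rewrite -[X in _ * X](_ : complex.Im (0 : C) = _) ?mulr0 // -[in LHS]Z Im_sum; apply: eq_bigr => f _.
by rewrite mulrC ImZ w0E mulrC.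
Qed.

Lemma form_inner_eq0 k n (w : form R R k n.+1) : mlin idR w ->
  form_inner 1%:M w w = 0 -> forall V, w V = 0.
Proof.
move=> wl /eqP; rewrite /form_inner mulf_eq0 invr_eq0 pnatr_eq0 -[_ == 0%N]negbK -lt0n fact_gt0 /=.
rewrite psumr_eq0 => [/allP H|f _]; last by rewrite invmx1 -expr2 sqr_ge0.
move=> V; rewrite (mlin_expand V wl) big1 // => h _.
have := H h; rewrite mem_index_enum invmx1 => /(_ isT); rewrite mulf_eq0 orbb => /eqP ->.
by rewrite mulr0.
Qed.

(** The default value of [xget] is 0. Otherwise the chosen [c] lies in [Lambda47] and [b - c] is
    orthogonal to it; as [b] is also orthogonal to [c], the norm of [c] vanishes, and positivity in
    the frame of [c] gives [c = 0]. *)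
Lemma pi47_eq0 (b : form R R 4 (1 + 7)) V :
  (forall w, Lambda47 Phi G8 w -> form_inner G8 b w = 0) -> pi47 Phi G8 b V = 0.
Proof.
move=> H; rewrite /pi47; case: xgetP => // c _ [cL cP].
have : form_inner G8 c c = 0.
  have := H c cL; have := cP c cL; rewrite /form_inner => h1 h2.
  apply/eqP; rewrite -oppr_eq0 -[X in X == _]add0r -{1}h2 -[X in _ == X]h1.
  rewrite -mulrBr -sumrB; apply/eqP; congr (_ * _); apply: eq_bigr => f _.
  by rewrite mulrBl.
case: (cL) => E1 [a [[oE _] cE]].
have -> : c = in_frame E1 (lambda47 a) by apply/funext => U; rewrite cE.
rewrite form_inner_frame //; try exact: lambda47_mlin.
by move/(@form_inner_eq0 4 7 _ (lambda47_mlin a)); apply.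
Qed.

Lemma g2_dDT_F2_at : (forall V, g2_dDT_at V = 0) -> forall V, spin7_F2_at V = 0.
Proof.
move=> H V; rewrite /spin7_F2_at /extC !pi47_eq0 //; first by move=> w /(Lambda47_sum0 H) [].
by move=> w /(Lambda47_sum0 H) [].
Qed.

End Frames.

(** * Smooth functions *)

Section Smooth.
Variable R : realType.

Lemma near_differentiable (V W : normedModType R) (f g : V -> W) x :
  (\forall y \near x, f y = g y) -> differentiable f x -> differentiable g x.
Proof.
move=> fg /diff_locallyP[dc dE].
have gE : g \o shift x = cst (g x) + ('d f x : V -> W) +o_ (nbhs 0) id.
  apply/eqaddoP => _ /posnumP[e].
  have /eqaddoP/(_ e%:num (gt0 e)) := dE.
  have : \forall h \near (0 : V), f (h + x) = g (h + x).
    by rewrite (near_shift x 0) /=; apply: filterS fg => y /=; rewrite ?subr0 ?sub0r ?opprK ?addrNK ?subrK.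
  apply: filterS2 => h /= fgh.
  by rewrite !fctE /= fgh (nbhs_singleton fg).
apply/diff_locallyP; rewrite (diff_unique dc gE); split=> //.
Qed.

Section Level.
Variables (n : nat).
Implicit Type U : set 'rV[R]_n.

Lemma near_partials (W : normedModType R) (f g : 'rV[R]_n -> W) s (x : 'rV[R]_n) :
  (\forall y \near x, f y = g y) -> \forall y \near (x : 'rV[R]_n), partials s f y = partials s g y.
Proof.
elim: s => //= i s IH /IH /near_join; apply: filterS => y; exact: near_eq_derive.
Qed.

(** A bounded order of differentiation permits induction: the derivative of a product, an inverse or
    a square root involves the same kind of expression with one derivative less available. *)
Definition Ck (W : normedModType R) k U (f : 'rV[R]_n -> W) :=
  forall s x, (size s <= k)%N -> U x -> differentiable (partials s f) x.

Lemma partials_rcons (W : normedModType R) s i (f : 'rV[R]_n -> W) :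
  partials (rcons s i) f = partials s ('D_(delta_mx 0 i) f).
Proof. by elim: s => //= j s ->. Qed.

(** The derivative split off is the innermost one, the last element of the sequence, so that the
    induction hypothesis applies to ['D f] as a new function. *)
Lemma CkS (W : normedModType R) k U (f : 'rV[R]_n -> W) :
  Ck k.+1 U f <->
  (forall x, U x -> differentiable f x) /\ forall i, Ck k U ('D_(delta_mx 0 i) f).
Proof.
split=> [H|[H0 H] s x].
  split=> [x Ux|i s x sk Ux]; first exact: (H [::]).
  by rewrite -partials_rcons; apply: H; rewrite ?size_rcons.
case/lastP: s => [|s i] sk Ux; first exact: H0.
by rewrite partials_rcons; apply: H => //; rewrite size_rcons in sk.
Qed.

Lemma Ck0 (W : normedModType R) U (f : 'rV[R]_n -> W) :
  Ck 0 U f <-> forall x, U x -> differentiable f x.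
Proof. by split=> [H x Ux|H [|//] x _ Ux]; [exact: (H [::])|exact: H]. Qed.

Lemma CkW (W : normedModType R) k U (f : 'rV[R]_n -> W) : Ck k.+1 U f -> Ck k U f.
Proof. by move=> H s x sk; apply: H; apply: leqW. Qed.

Lemma Ck_diff (W : normedModType R) k U (f : 'rV[R]_n -> W) x :
  Ck k U f -> U x -> differentiable f x.
Proof. by move=> H; apply: (H [::]). Qed.

Lemma smooth_CkP (W : normedModType R) U (f : 'rV[R]_n -> W) :
  smooth_on U f <-> forall k, Ck k U f.
Proof.
split=> [H k s x _|H s x]; first exact: H.
by apply: (H (size s)).
Qed.

Lemma Ck_sub (W : normedModType R) k (U U' : set 'rV[R]_n) (f : 'rV[R]_n -> W) :
  U' `<=` U -> Ck k U f -> Ck k U' f.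
Proof. by move=> UU H s x sk /UU; apply: H. Qed.

Lemma eq_Ck (W : normedModType R) k U (f g : 'rV[R]_n -> W) : open U ->
  (forall x, U x -> f x = g x) -> Ck k U f -> Ck k U g.
Proof.
move=> oU fg H s x sk Ux; apply: near_differentiable (H s x sk Ux).
by apply: near_partials; apply: filterS (open_nbhs_nbhs (conj oU Ux)).
Qed.

Lemma Ck_cst (W : normedModType R) k U (c : W) : Ck k U (fun=> c).
Proof.
elim: k c => [|k IH] c; first by apply/Ck0 => x _; exact: differentiable_cst.
apply/CkS; split=> [x _|i]; first exact: differentiable_cst.
rewrite (_ : 'D_(delta_mx 0 i) _ = fun=> 0) //.
by apply/funext => x; rewrite (_ : (fun=> c) = cst c) // derive_cst.
Qed.

Lemma CkD (W : normedModType R) k U (f g : 'rV[R]_n -> W) : open U ->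
  Ck k U f -> Ck k U g -> Ck k U (fun x => f x + g x).
Proof.
move=> oU; elim: k f g => [|k IH] f g; rewrite ?Ck0 ?CkS.
  by move=> df dg x Ux; apply: differentiableD; [exact: df|exact: dg].
move=> [df Df] [dg Dg]; split=> [x Ux|i].
  by apply: differentiableD; [exact: df|exact: dg].
apply: (eq_Ck (f := fun x => 'D_(delta_mx 0 i) f x + 'D_(delta_mx 0 i) g x)) => //.
  move=> x Ux; rewrite -deriveD //; apply: diff_derivable; [exact: df|exact: dg].
exact: IH.
Qed.

Lemma Ck_lin (W W' : normedModType R) (L : {linear W -> W'}) k U (f : 'rV[R]_n -> W) :
  open U -> continuous L -> Ck k U f -> Ck k U (fun x => L (f x)).
Proof.
move=> oU Lc; elim: k f => [|k IH] f; rewrite ?Ck0 ?CkS.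
  by move=> df x Ux; apply: differentiable_comp; [exact: df|exact: linear_differentiable].
move=> [df Df]; split=> [x Ux|i].
  by apply: differentiable_comp; [exact: df|exact: linear_differentiable].
apply: (eq_Ck (f := fun x => L ('D_(delta_mx 0 i) f x))) => //; last exact: IH.
move=> x Ux; have dfx := df x Ux; have dL : differentiable L (f x) by exact: linear_differentiable.
rewrite !deriveE //; last exact: differentiable_comp.
by rewrite (diff_comp dfx dL) /= diff_lin.
Qed.

(** Regularity is a property of germs. This is what is needed for the chart changes of the circle,
    which are translations only locally. *)
Lemma Ck_near (W : normedModType R) k U (f : 'rV[R]_n -> W) :
  (forall x, U x -> exists g, (\forall y \near x, f y = g y) /\ Ck k [set x] g) -> Ck k U f.
Proof.
move=> H s x sk Ux; have [g [fg gk]] := H x Ux.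
apply: (near_differentiable (f := partials s g)); last exact: gk.
by apply: near_partials; apply: filterS fg => y ->.
Qed.

Lemma Ck_sum (W : normedModType R) (I : Type) (r : seq I) (P : pred I) k U (f : I -> 'rV[R]_n -> W) : open U ->
  (forall i, P i -> Ck k U (f i)) -> Ck k U (fun x => \sum_(i <- r | P i) f i x).
Proof.
move=> oU H; rewrite (_ : (fun x => _) = \big[(fun g h x => g x + h x)/(fun=> 0)]_(i <- r | P i) f i).
  elim/big_ind: _ => //; first exact: Ck_cst.
  by move=> *; exact: CkD.
by apply/funext => x; elim/big_rec2: _ => // i y1 y2 _ ->.
Qed.

Lemma CkZ (W : normedModType R) k U (f : 'rV[R]_n -> W) (c : R) : open U ->
  Ck k U f -> Ck k U (fun x => c *: f x).
Proof. by move=> oU; apply: (Ck_lin (L := ( *:%R c : {linear W -> W}))) => //; exact: scaler_continuous. Qed.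

Lemma derive_coord (W : normedModType R) (f : 'rV[R]_n -> W) x u : differentiable f x ->
  'D_u f x = \sum_i u 0 i *: 'D_(delta_mx 0 i) f x.
Proof.
move=> df; rewrite deriveE // {1}[u]row_sum_delta linear_sum.
by apply: eq_bigr => i _; rewrite linearZ /= deriveE.
Qed.

Lemma Ck_derive (W : normedModType R) k U (f : 'rV[R]_n -> W) u : open U ->
  Ck k.+1 U f -> Ck k U ('D_u f).
Proof.
move=> oU /CkS[df Df].
apply: (eq_Ck (f := fun x => \sum_i u 0 i *: 'D_(delta_mx 0 i) f x)) => //.
  by move=> x Ux; rewrite [RHS]derive_coord //; exact: df.
by apply: Ck_sum => // i _; exact: CkZ.
Qed.

Implicit Types f g : 'rV[R]_n -> R^o.

Lemma CkM k U f g : open U -> Ck k U f -> Ck k U g -> Ck k U (fun x => f x * g x : R^o).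
Proof.
move=> oU; elim: k f g => [|k IH] f g.
  by rewrite !Ck0 => df dg x Ux; apply: differentiableM; [exact: df|exact: dg].
move=> fk gk; have /CkS[df Df] := fk; have /CkS[dg Dg] := gk.
apply/CkS; split=> [x Ux|i]; first by apply: differentiableM; [exact: df|exact: dg].
apply: (eq_Ck (f := fun x => (f x * 'D_(delta_mx 0 i) g x : R^o) + (g x * 'D_(delta_mx 0 i) f x : R^o) : R^o)) => //.
  move=> x Ux; rewrite (_ : (fun x => f x * g x) = f * g) // deriveM //; apply: diff_derivable; [exact: df|exact: dg].
by apply: CkD => //; apply: IH => //; exact: CkW.
Qed.

Lemma CkV k U f : open U -> (forall x, U x -> f x != 0) ->
  Ck k U f -> Ck k U (fun x => (f x)^-1 : R^o).
Proof.
move=> oU f0; elim: k f f0 => [|k IH] f f0.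
  by rewrite !Ck0 => df x Ux; apply: differentiableV; [exact: df|exact: f0].
move=> fk; have /CkS[df Df] := fk; apply/CkS; split=> [x Ux|i].
  by apply: differentiableV; [exact: df|exact: f0].
apply: (eq_Ck (f := fun x => (-1 * ((f x)^-1 * (f x)^-1 : R^o) : R^o) * 'D_(delta_mx 0 i) f x : R^o)) => //.
  move=> x Ux; rewrite deriveV ?f0 //; last exact/diff_derivable/df.
  by rewrite expr2 invfM mulN1r.
have fi : Ck k U (fun x => (f x)^-1 : R^o) by apply: IH => //; exact: CkW.
by apply: CkM => //; apply: CkM => //; [exact: Ck_cst|exact: CkM].
Qed.

Lemma Ck_sqrt k U f : open U -> (forall x, U x -> 0 < f x) ->
  Ck k U f -> Ck k U (fun x => Num.sqrt (f x) : R^o).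
Proof.
move=> oU f0.
have ds x : U x -> differentiable f x -> differentiable (fun x => Num.sqrt (f x) : R^o) x.
  move=> Ux df; apply: (differentiable_comp (g := Num.sqrt : R -> R^o)) => //.
  apply/derivable1_diffP; have := is_derive1_sqrt (f0 x Ux); by case.
elim: k => [|k IH]; first by rewrite !Ck0 => df x Ux; apply: ds => //; exact: df.
move=> fk; have /CkS[df Df] := fk; apply/CkS; split=> [x Ux|i].
  by apply: ds => //; exact: df.
have sk : Ck k U (fun x => Num.sqrt (f x) : R^o) by apply: IH; exact: CkW.
apply: (eq_Ck (f := fun x => 'D_(delta_mx 0 i) f x * (2 * Num.sqrt (f x) : R^o)^-1 : R^o)) => //.
  move=> x Ux; have s0 : Num.sqrt (f x) != 0 by rewrite gt_eqF // sqrtr_gt0 f0.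
  have dsx := ds x Ux (df x Ux).
  (* The derivative of the square root is found by differentiating the identity
     [sqrt f * sqrt f = f], valid near [x]. *)
  have E : 'D_(delta_mx 0 i) f x = Num.sqrt (f x) * 'D_(delta_mx 0 i) (fun x => Num.sqrt (f x) : R^o) x
     + Num.sqrt (f x) * 'D_(delta_mx 0 i) (fun x => Num.sqrt (f x) : R^o) x.
    have <- := deriveM (diff_derivable dsx) (diff_derivable dsx).
    apply: near_eq_derive; apply: filterS (open_nbhs_nbhs (conj oU Ux)) => y Uy.
    by rewrite fctE -expr2 sqr_sqrtr // ltW // f0.
  by rewrite E; field.
apply: CkM => //; apply: CkV => //.
  by move=> x Ux; rewrite mulf_neq0 ?pnatr_eq0 // gt_eqF // sqrtr_gt0 f0.
by apply: CkM => //; exact: Ck_cst.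
Qed.

Lemma is_derive_line f p w t : differentiable f (p + t *: w) ->
  is_derive t 1 (fun t : R => f (p + t *: w)) ('D_w f (p + t *: w)).
Proof.
move=> df; have := @diff_derivable _ _ _ f (p + t *: w) w df; rewrite /derivable => dv.
have E : (fun h : R => h^-1 *: (((fun t : R => f (p + t *: w)) \o shift t) (h *: 1) - f (p + t *: w)))
   = (fun h => h^-1 *: ((f \o shift (p + t *: w)) (h *: w) - f (p + t *: w))).
  apply/funext => h /=; congr (_ *: (f _ - _)).
  by rewrite [h *: 1]mulr1 scalerDl addrCA.
by split; [rewrite /derivable E|rewrite /derive E].
Qed.

Lemma MVT_line f p w h : 0 < h -> (forall t, 0 <= t <= h -> differentiable f (p + t *: w)) ->
  exists2 c, 0 <= c <= h & f (p + h *: w) - f p = 'D_w f (p + c *: w) * h.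
Proof.
move=> h0 df.
have := @MVT R (fun t => f (p + t *: w)) (fun t => 'D_w f (p + t *: w)) 0 h h0.
case=> [||c].
- move=> t; rewrite in_itv /= => /andP[t0 th]; apply: is_derive_line; apply: df; by rewrite !ltW.
- apply: derivable_within_continuous => t; rewrite in_itv /= => th.
  by have [] := is_derive_line (df t th).
rewrite in_itv /= => /andP[c0 ch]; rewrite scale0r addr0 subr0 => E.
by exists c => //; rewrite !ltW.
Qed.

Lemma derive_shift f x u c : 'D_u (fun y => f (y + c)) x = 'D_u f (x + c).
Proof.
rewrite /derive (_ : (fun h : R => h^-1 *: (((fun y => f (y + c)) \o shift x) (h *: u) - f (x + c)))
  = (fun h => h^-1 *: ((f \o shift (x + c)) (h *: u) - f (x + c)))) //.
by apply/funext => h /=; rewrite addrA.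
Qed.

(** The second difference is the increment along [u] of [g y = f (y + h v) - f y]; one mean value
    theorem along [u], and a second one along [v] for ['D_u f], evaluate it. *)
Lemma MVT_square f x u v (h : R) : 0 < h ->
  (forall s t : R, 0 <= s <= h -> 0 <= t <= h -> differentiable f (x + s *: u + t *: v) /\
     differentiable ('D_u f : _ -> R^o) (x + s *: u + t *: v)) ->
  exists s t : R, [/\ 0 <= s <= h, 0 <= t <= h &
    f (x + h *: u + h *: v) - f (x + h *: u) - (f (x + h *: v) - f x) =
    'D_v ('D_u f) (x + s *: u + t *: v) * h * h].
Proof.
move=> h0 df.
have z0 : 0 <= (0 : R) <= h by rewrite lexx ltW.
have zh : (0 : R) <= h <= h by rewrite lexx ltW.
pose g := (fun y => f (y + h *: v)) - f : 'rV[R]_n -> R^o.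
have dg s : 0 <= s <= h -> differentiable (fun y => f (y + h *: v)) (x + s *: u).
  move=> hs; apply: (differentiable_comp (f := fun y => y + h *: v)).
    by apply: differentiableD => //; exact: differentiable_cst.
  exact: (df _ _ hs zh).1.
have df0 s : 0 <= s <= h -> differentiable f (x + s *: u).
  by move=> hs; have := (df _ _ hs z0).1; rewrite scale0r addr0.
have [s hs E] := @MVT_line g x u h h0 (fun s hs => differentiableB (dg s hs) (df0 s hs)).
have [t ht E'] := @MVT_line ('D_u f) (x + s *: u) v h h0 (fun t ht => (df s t hs ht).2).
exists s, t; split=> //; rewrite -E'.
transitivity (g (x + h *: u) - g x); first by rewrite /g !fctE.
rewrite E; congr (_ * _); rewrite deriveB; [|exact/diff_derivable/dg|exact/diff_derivable/df0].
by rewrite derive_shift.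
Qed.

(** If the mixed derivatives differed at [x], a number [m] would separate them strictly on a ball.
    Both orders of [MVT_square] evaluate the same second difference on a small parallelogram in that
    ball, a contradiction. *)
Lemma schwarz U f x u v : open U -> smooth_on U f -> U x ->
  'D_u ('D_v f) x = 'D_v ('D_u f) x.
Proof.
move=> oU /smooth_CkP fk.
have D1 w : Ck 1 U ('D_w f : _ -> R^o) by exact: Ck_derive (fk 2%N).
have D2 w w' : Ck 0 U ('D_w ('D_w' f) : _ -> R^o) by exact: Ck_derive (D1 w').
suff le a b : U x -> 'D_a ('D_b f) x <= 'D_b ('D_a f) x.
  by move=> Ux; apply/eqP; rewrite eq_le; apply/andP; split; exact: le.
move=> Ux; rewrite leNgt; apply/negP => ba.
pose m := ('D_b ('D_a f) x + 'D_a ('D_b f) x) / 2.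
have bm : 'D_b ('D_a f) x < m by rewrite /m midf_lt.
have ma : m < 'D_a ('D_b f) x by rewrite /m midf_lt.
have cb : {for x, continuous ('D_b ('D_a f) : _ -> R^o)} by apply: differentiable_continuous; exact: (Ck_diff (D2 _ _)).
have ca : {for x, continuous ('D_a ('D_b f) : _ -> R^o)} by apply: differentiable_continuous; exact: (Ck_diff (D2 _ _)).
have nb : \forall y \near x, [/\ U y, 'D_b ('D_a f) y < m & m < 'D_a ('D_b f) y].
  near=> y; split.
  - by near: y; exact: open_nbhs_nbhs.
  - by near: y; apply: (cvgr_lt _ cb).
  - by near: y; apply: (cvgr_gt _ ca).
move/nbhs_ballP: nb => [e /= e0 He].
(* With this side the parallelogram stays within distance [e / 2] of [x]; the summand 1 keeps the
   denominator positive when [a] and [b] vanish. *)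
pose h := e / (2 * (`|a| + `|b| + 1)).
have k0 : 0 < `|a| + `|b| + 1 by rewrite ltr_wpDl // addr_ge0.
have h0 : 0 < h by rewrite divr_gt0 // mulr_gt0.
have inb s t : 0 <= s <= h -> 0 <= t <= h -> ball x e (x + s *: a + t *: b).
  move=> /andP[s0 sh] /andP[t0 th]; rewrite -ball_normE /= -addrA opprD addrA subrr sub0r normrN.
  apply: le_lt_trans (ler_normD _ _) _; rewrite !normrZ !ger0_norm //.
  apply: (@le_lt_trans _ _ (h * (`|a| + `|b| + 1))).
    by rewrite mulrDr mulrDr -[leLHS]addr0 lerD ?lerD ?ler_wpM2r // mulr1 ltW.
  rewrite /h invfM mulrA mulrVK ?unitfE ?gt_eqF // ltr_pdivrMr // mulr_natr mulr2n ltrDl; exact: e0.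
have [s [t [hs ht E]]] := @MVT_square f x a b h h0 (fun s t hs ht =>
  conj (Ck_diff (fk 0%N) (let: And3 Uy _ _ := He _ (inb s t hs ht) in Uy))
       (Ck_diff (D1 a) (let: And3 Uy _ _ := He _ (inb s t hs ht) in Uy))).
have inb' s1 t1 : 0 <= s1 <= h -> 0 <= t1 <= h -> ball x e (x + s1 *: b + t1 *: a).
  by move=> h1 h2; rewrite addrAC; exact: inb.
have [s' [t' [hs' ht' E']]] := @MVT_square f x b a h h0 (fun s t hs ht =>
  conj (Ck_diff (fk 0%N) (let: And3 Uy _ _ := He _ (inb' s t hs ht) in Uy))
       (Ck_diff (D1 b) (let: And3 Uy _ _ := He _ (inb' s t hs ht) in Uy))).
have [_ lt1 _] := He _ (inb s t hs ht).
have [_ _ lt2] := He _ (inb' s' t' hs' ht').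
have : 'D_b ('D_a f) (x + s *: a + t *: b) * h * h = 'D_a ('D_b f) (x + s' *: b + t' *: a) * h * h.
  have sub4 (p q r s0 : R) : p - q - (r - s0) = p - r - (q - s0) by ring.
  apply: etrans (esym E) _; apply: etrans _ E'; rewrite (addrAC x (h *: b)); exact: sub4.
move=> /(mulIf (lt0r_neq0 h0))/(mulIf (lt0r_neq0 h0)) e1.
by move: (lt_trans lt1 lt2); rewrite e1 ltxx.
Unshelve. all: by end_near. Qed.

End Level.

Lemma derive_compL (W : normedModType R) m n (L : {linear 'rV[R]_m -> 'rV[R]_n})
    (f : 'rV[R]_n -> W) u : 'D_u (f \o L) = 'D_(L u) f \o L.
Proof.
apply/funext => x; rewrite /derive /= (_ : (fun h : R => h^-1 *: ((f \o L \o shift x) (h *: u) - f (L x)))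
  = (fun h => h^-1 *: ((f \o shift (L x)) (h *: L u) - f (L x)))) //.
by apply/funext => h /=; rewrite (linearP L).
Qed.

Lemma Ck_compL (W : normedModType R) m n (L : {linear 'rV[R]_m -> 'rV[R]_n}) k
    (U : set 'rV[R]_n) (f : 'rV[R]_n -> W) : open U -> continuous L ->
  Ck k U f -> Ck k (L @^-1` U) (f \o L).
Proof.
move=> oU Lc; have dc (g : 'rV[R]_n -> W) x : differentiable g (L x) -> differentiable (g \o L) x.
  by move=> dg; apply: differentiable_comp => //; exact: linear_differentiable.
elim: k f => [|k IH] f; first by rewrite !Ck0 => df x Ux; apply: dc; exact: df.
move=> fk; apply/CkS; split=> [x Ux|i]; first by apply: dc; exact: (Ck_diff fk).
by rewrite derive_compL; apply: IH; exact: Ck_derive.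
Qed.
End Smooth.

(** * Parallel forms *)

Section ClosedClass.
Variable R : realType.

(** The closure properties used to build inverse matrices, determinants and the volume factor.
    Conditions such as nonvanishing are required on [U] only; the two instances are [Ck_class] and
    [jet_class]. *)
Record closed_class (T : Type) (U : set T) (P : (T -> R) -> Prop) : Prop :=
  ClosedClass {
    class_eq : forall f g, (forall x, U x -> f x = g x) -> P f -> P g;
    class_cst : forall c, P (fun=> c);
    classD : forall f g, P f -> P g -> P (fun x => f x + g x);
    classM : forall f g, P f -> P g -> P (fun x => f x * g x);
    classV : forall f, (forall x, U x -> f x != 0) -> P f -> P (fun x => (f x)^-1);
    class_sqrt : forall f, (forall x, U x -> 0 < f x) -> P f ->
      P (fun x => Num.sqrt (f x)) }.

Section Theory.
Variables (T : Type) (U : set T) (P : (T -> R) -> Prop).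
Hypothesis cl : closed_class U P.

Lemma class_sum (I : Type) (r : seq I) (Q : pred I) (f : I -> T -> R) :
  (forall i, Q i -> P (f i)) -> P (fun x => \sum_(i <- r | Q i) f i x).
Proof.
move=> H; rewrite (_ : (fun x => _) = \big[(fun g h x => g x + h x)/(fun=> 0)]_(i <- r | Q i) f i).
  by elim/big_ind: _ => //; [exact: (class_cst cl)|exact: (classD cl)].
by apply/funext => x; elim/big_rec2: _ => // i y1 y2 _ ->.
Qed.

Lemma class_prod (I : Type) (r : seq I) (Q : pred I) (f : I -> T -> R) :
  (forall i, Q i -> P (f i)) -> P (fun x => \prod_(i <- r | Q i) f i x).
Proof.
move=> H; rewrite (_ : (fun x => _) = \big[(fun g h x => g x * h x)/(fun=> 1)]_(i <- r | Q i) f i).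
  by elim/big_ind: _ => //; [exact: (class_cst cl)|exact: (classM cl)].
by apply/funext => x; elim/big_rec2: _ => // i y1 y2 _ ->.
Qed.

Lemma class_det n (M : T -> 'M[R]_n) :
  (forall i j, P (fun x => M x i j)) -> P (fun x => \det (M x)).
Proof.
move=> H; apply: class_sum => s _; apply: (classM cl); first exact: (class_cst cl).
by apply: class_prod.
Qed.

(** The cofactor formula describes [invmx] only where the determinant is nonzero, hence the appeal
    to equality on [U]. *)
Lemma class_invmx n (M : T -> 'M[R]_n) : (forall x, U x -> 0 < \det (M x)) ->
  (forall i j, P (fun x => M x i j)) -> forall i j, P (fun x => invmx (M x) i j).
Proof.
move=> M0 H i j.
apply: (class_eq cl (f := fun x => (\det (M x))^-1 * ((-1) ^+ (j + i) * \det (row' j (col' i (M x)))))).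
  by move=> x Ux; rewrite /invmx unitmxE unitfE gt_eqF ?M0 // !mxE.
apply: (classM cl).
  by apply: (classV cl); [move=> x Ux; rewrite gt_eqF ?M0|exact: class_det].
apply: (classM cl); first exact: (class_cst cl).
apply: class_det => a b; rewrite (_ : (fun x => _) = (fun x => M x (lift j a) (lift i b))) //.
by apply/funext => x; rewrite !mxE.
Qed.

Lemma class_form k n (w : T -> form R R k n) (W : T -> 'M[R]_(k, n)) :
  (forall x, U x -> mlin idfun (w x)) -> (forall V, P (fun x => w x V)) ->
  (forall i j, P (fun x => W x i j)) -> P (fun x => w x (W x)).
Proof.
move=> wl Hw HW.
apply: (class_eq cl (f := fun x => \sum_(h : {ffun 'I_k -> 'I_n}) (\prod_r W x r (h r)) * w x (rowsub h 1%:M))).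
  by move=> x Ux; rewrite (mlin_expand _ (wl x Ux)).
apply: class_sum => h _; apply: (classM cl) => //.
by apply: class_prod.
Qed.

Lemma class_hodge k m (G : T -> 'M[R]_(k + m)) (w : T -> form R R k (k + m)) V :
  (forall x, U x -> 0 < \det (G x)) -> (forall i j, P (fun x => G x i j)) ->
  (forall x, U x -> mlin idfun (w x)) -> (forall V, P (fun x => w x V)) ->
  P (fun x => hodge (G x) (w x) V).
Proof.
move=> G0 HG wl Hw; apply: (classM cl); first exact: (class_cst cl).
apply: class_sum => f _; apply: (classM cl).
  apply: class_form => // i j.
  rewrite (_ : (fun x => _) = (fun x => invmx (G x) (f i) j)); first exact: class_invmx.
  by apply/funext => x; rewrite !mxE.
apply: (classM cl); last exact: (class_cst cl).
by apply: (class_sqrt cl) => //; exact: class_det.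
Qed.

Lemma class_cylinder (phi : T -> form R R 3 7) (psi : T -> form R R 4 7) V :
  (forall V, P (fun x => phi x V)) -> (forall V, P (fun x => psi x V)) ->
  P (fun x => cylinder_form (phi x) (psi x) V).
Proof.
move=> Hphi Hpsi; refine (classD cl _ (Hpsi (rsubmx V))).
apply: (classM cl); first exact: (class_cst cl).
apply: class_sum => s _; exact: (classM cl (class_cst cl _) (Hphi _)).
Qed.

End Theory.

Lemma Ck_class n k (U : set 'rV[R]_n) : open U ->
  closed_class U (fun f => Ck k U (f : 'rV[R]_n -> R^o)).
Proof.
move=> oU; split.
- by move=> f g fg; exact: eq_Ck.
- by move=> c; exact: Ck_cst.
- by move=> f g; exact: CkD.
- by move=> f g; exact: CkM.
- by move=> f; exact: CkV.
- by move=> f; exact: Ck_sqrt.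
Qed.

(* One-jets at [0] of pairs of curves: [true] and [false] index two curves with
   the same value and the same derivative at [0]. *)
Definition jet (f : bool * R -> R) := exists d : R,
  [/\ is_derive (0 : R) (1 : R) (fun t : R => f (true, t) : R) d,
      is_derive (0 : R) (1 : R) (fun t : R => f (false, t) : R) d &
      f (true, 0) = f (false, 0)].

Local Notation deriv0 f d := (is_derive (0 : R) (1 : R) (f : R -> R) (d : R)).

Lemma deriv0_cst (c : R) : deriv0 (fun=> c) 0.
Proof. exact: is_derive_cst. Qed.

Lemma deriv0D (f g : R -> R) a b :
  deriv0 f a -> deriv0 g b -> deriv0 (fun t => f t + g t) (a + b).
Proof. exact: is_deriveD. Qed.

Lemma deriv0M (f g : R -> R) a b :
  deriv0 f a -> deriv0 g b -> deriv0 (fun t => f t * g t) (f 0 * b + g 0 * a).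
Proof. exact: is_deriveM. Qed.

Lemma deriv0Ml (f : R -> R) c a : deriv0 f a -> deriv0 (fun t => c * f t) (c * a).
Proof. exact: is_deriveZ. Qed.

Lemma deriv0_sum (I : Type) (r : seq I) (Q : pred I) (f : I -> R -> R) d :
  (forall i, deriv0 (f i) (d i)) ->
  deriv0 (fun t => \sum_(i <- r | Q i) f i t) (\sum_(i <- r | Q i) d i).
Proof.
move=> H; rewrite (_ : (fun x => _) = \big[(fun g h x => g x + h x)/(fun=> 0)]_(i <- r | Q i) f i).
  by elim/big_rec2: _ => [|i y1 y2 _ Hy]; [exact: deriv0_cst|exact: deriv0D].
by apply/funext => x; elim/big_rec2: _ => // i y1 y2 _ ->.
Qed.

Lemma deriv0_affine (a b : R) : deriv0 (fun t => a + t * b) b.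
Proof.
have := deriv0D (deriv0_cst a) (deriv0Ml b (is_derive_id (0 : R) (1 : R))).
rewrite add0r mulr1; congr (is_derive _ _ _ _).
by apply/funext => t; rewrite mulrC.
Qed.

Lemma deriv0_prod k (a b : 'I_k -> R) :
  deriv0 (fun t => \prod_r (a r + t * b r))
    (\sum_r \prod_s (if s == r then b s else a s)).
Proof.
elim: k a b => [|k IH] a b.
  rewrite big_ord0 (_ : (fun t => _) = fun=> 1); first exact: deriv0_cst.
  by apply/funext => t; rewrite big_ord0.
have := deriv0M (deriv0_affine (a ord0) (b ord0)) (IH (fun r => a (lift ord0 r)) (fun r => b (lift ord0 r))).
rewrite (_ : (fun t => \prod_r _) = (fun t => (a ord0 + t * b ord0) * \prod_r (a (lift ord0 r) + t * b (lift ord0 r)))); last first.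
  by apply/funext => t; rewrite big_ord_recl.
move=> H; apply: (is_derive_eq H).
rewrite /= big_ord_recl addrC; congr (_ + _).
  rewrite big_ord_recl /= mulrC; congr (_ * _).
  by apply: eq_bigr => r _; rewrite mul0r addr0.
rewrite mul0r addr0 big_distrr /=; apply: eq_bigr => r _.
rewrite [RHS]big_ord_recl /=; congr (_ * _).
Qed.

Lemma deriv0_uniq (f : R -> R) a b : deriv0 f a -> deriv0 f b -> a = b.
Proof. by move=> /@derive_val <- /@derive_val <-. Qed.

Lemma deriv0_cylinder (phi : R -> form R R 3 7) (psi : R -> form R R 4 7) phi' psi' V :
  (forall V, deriv0 (fun t => phi t V) (phi' V)) ->
  (forall V, deriv0 (fun t => psi t V) (psi' V)) ->
  deriv0 (fun t => cylinder_form (phi t) (psi t) V) (cylinder_form phi' psi' V).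
Proof.
move=> Hphi Hpsi; refine (deriv0D _ (Hpsi (rsubmx V))).
refine (deriv0Ml _ _); apply: deriv0_sum => s; exact: deriv0Ml (Hphi _).
Qed.

Lemma mlin_cylinder phi psi : mlin (idfun : {rmorphism R -> R}) phi ->
  mlin (idfun : {rmorphism R -> R}) psi -> mlin (idfun : {rmorphism R -> R}) (@cylinder_form R phi psi).
Proof.
have pr k (w : form R R k 7) : mlin (idfun : {rmorphism R -> R}) w ->
    mlin (idfun : {rmorphism R -> R}) (form_pr2 (m := 1) w).
  move=> wl V V1 V2 r b c H1 H2 H3; apply: (wl _ _ _ r).
  - by apply/rowP => j; move/rowP/(_ (rshift 1 j)): H1; rewrite !mxE.
  - by apply/matrixP => i j; move/matrixP/(_ i (rshift 1 j)): H2; rewrite !mxE.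
  - by apply/matrixP => i j; move/matrixP/(_ i (rshift 1 j)): H3; rewrite !mxE.
move=> phil psil; apply: mlinD; last exact: pr.
apply: (mlin_wedge (p := 1) (q := 3)); last exact: pr.
move=> V V1 V2 r b c /rowP/(_ 0); rewrite !mxE !ord1 => H _ _.
by move: H; rewrite /dx.
Qed.

Lemma deriv0_form k n (w : form R R k n) (A : 'M[R]_n) V : mlin idfun w ->
  deriv0 (fun t => w (V *m (1%:M + t *: A))) (der A w V).
Proof.
move=> wl.
rewrite (_ : (fun t => _) = (fun t => \sum_(h : {ffun 'I_k -> 'I_n})
   w (rowsub h 1%:M) * \prod_r (V r (h r) + t * (V *m A) r (h r)))); last first.
  apply/funext => t; rewrite (mlin_expand _ wl); apply: eq_bigr => h _.
  rewrite mulrC; congr (_ * _); apply: eq_bigr => r _.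
  by rewrite mulmxDr mulmx1 -scalemxAr !mxE.
rewrite (_ : der A w V = \sum_(h : {ffun 'I_k -> 'I_n}) w (rowsub h 1%:M) *
   \sum_r \prod_s (if s == r then (V *m A) s (h s) else V s (h s))).
  by apply: deriv0_sum => h; apply: deriv0Ml; exact: deriv0_prod.
under eq_bigr do rewrite big_distrr.
rewrite exchange_big; apply: eq_bigr => r _ /=.
rewrite (mlin_expand _ wl); apply: eq_bigr => h _; rewrite mulrC; congr (_ * _).
apply: eq_bigr => s _; rewrite !mxE; case: eqP => [->|_]; rewrite !mxE //.
by apply: eq_bigr => c _; rewrite !mxE.
Qed.

Lemma jet_class (U : set (bool * R)) :
  (\forall t \near (0 : R), forall b, U (b, t)) -> closed_class U jet.
Proof.
move=> nU; have U0 := nbhs_singleton nU; split.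
- move=> f g fg [d [f1 f2 f0]]; exists d; split.
  + by apply: near_eq_is_derive f1; apply: filterS nU => t Ut; exact: fg.
  + by apply: near_eq_is_derive f2; apply: filterS nU => t Ut; exact: fg.
  + by rewrite -!fg.
- by move=> c; exists 0; split=> //; exact: deriv0_cst.
- move=> f g [d [f1 f2 f0]] [e [g1 g2 g0]]; exists (d + e); split; rewrite ?f0 ?g0 //; exact: deriv0D.
- move=> f g [d [f1 f2 f0]] [e [g1 g2 g0]]; exists (f (false, 0) * e + g (false, 0) * d).
  split; rewrite ?f0 ?g0 //; last exact: deriv0M.
  by rewrite -f0 -g0; exact: deriv0M.
- move=> f fn0 [d [f1 f2 f0]]; exists (- f (false, 0) ^- 2 *: d); split; rewrite ?f0 //.
    by rewrite -f0; apply: is_deriveV => //; exact: fn0.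
  by apply: is_deriveV => //; exact: fn0.
- move=> f fp [d [f1 f2 f0]]; exists ((2 * Num.sqrt (f (false, 0)))^-1 * d); split; rewrite ?f0 //.
    rewrite -f0; apply: (@is_derive1_comp _ Num.sqrt (fun t => f (true, t))) => //.
    by apply: is_derive1_sqrt; exact: fp.
  apply: (@is_derive1_comp _ Num.sqrt (fun t => f (false, t))) => //.
  by apply: is_derive1_sqrt; exact: fp.
Qed.

Lemma deriv0_quad (a b c : R) : deriv0 (fun t => a + t * b + t * t * c) b.
Proof.
have := deriv0D (deriv0_affine a b) (deriv0M (deriv0_affine 0 1) (deriv0_affine 0 c)).
rewrite !(mul0r, addr0); congr (is_derive _ _ _ _).
by apply/funext => t; rewrite !add0r mulr1 mulrA.
Qed.

Lemma derive0_near_gt0 (f : R -> R) d : deriv0 f d -> 0 < f 0 ->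
  \forall t \near (0 : R), 0 < f t.
Proof.
move=> [df _] f0.
have cf : {for 0, continuous (f : R -> R^o)}.
  by apply: differentiable_continuous; apply/derivable1_diffP.
exact: (cvgr_gt _ cf).
Qed.

Lemma hodge_derive p k m (U : set 'rV[R]_p) (G : 'rV[R]_p -> 'M[R]_(k + m))
    (w : 'rV[R]_p -> form R R k (k + m)) y v (A : 'M[R]_(k + m)) V :
  open U -> U y -> (forall z, U z -> 0 < \det (G z)) ->
  (forall z, U z -> mlin idfun (w z)) ->
  (forall i j, differentiable (fun z => G z i j : R^o) y) ->
  (forall V, differentiable (fun z => w z V : R^o) y) ->
  (forall i j, 'D_v (fun z => G z i j : R^o) y = (A *m G y + G y *m A^T) i j) ->
  (forall V, 'D_v (fun z => w z V : R^o) y = der A (w y) V) ->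
  differentiable (fun z => hodge (G z) (w z) V : R^o) y ->
  'D_v (fun z => hodge (G z) (w z) V : R^o) y = der A (hodge (G y) (w y)) V.
Proof.
move=> oU Uy G0 wl dG dw DG Dw dh.
pose M t : 'M[R]_(k + m) := 1%:M + t *: A.
(* The first curve follows the metric and the form along the line in direction [v]; the second
   transports their values at [y] by the linear maps [1 + t A]. *)
pose Gt (bt : bool * R) := if bt.1 then G (y + bt.2 *: v) else M bt.2 *m G y *m (M bt.2)^T.
pose wt (bt : bool * R) : form R R k (k + m) :=
  if bt.1 then w (y + bt.2 *: v) else fun V => w y (V *m M bt.2).
pose Ut := [set bt : bool * R | U (y + bt.2 *: v) /\ 0 < \det (M bt.2)].
have M0 : M 0 = 1%:M by rewrite /M scale0r addr0.
have line (f : 'rV[R]_p -> R^o) : differentiable f y ->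
    deriv0 (fun t => f (y + t *: v)) ('D_v f y).
  move=> df; have := @is_derive_line _ _ f y v 0; rewrite scale0r addr0; exact.
have nM : \forall t \near (0 : R), 0 < \det (M t).
  have H := deriv0_form A 1%:M (det_mlin (idfun : {rmorphism R -> R}) (k := k + m)).
  apply: filterS (derive0_near_gt0 H _) => [t|]; rewrite /= !mul1mx //.
  by rewrite scale0r addr0 det1.
have nU : \forall t \near (0 : R), forall b, Ut (b, t).
  near=> t; move=> b; split=> /=; last by near: t.
  near: t; have cl : {for 0, continuous (fun t : R => y + t *: v)}.
    by apply: cvgD; [exact: cvg_cst|apply: cvgZr_tmp].
  by apply: cl; rewrite /= scale0r addr0; exact: open_nbhs_nbhs.
have cl := jet_class nU.
(* The hypotheses on derivatives say that the two curves of metrics, and those of forms, have the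
   same one-jet; this passes to the Hodge star. *)
have [d [D1 D2 _]] : jet (fun bt => hodge (Gt bt) (wt bt) V).
  apply: (class_hodge cl).
  - move=> [[] t] [/= U1 Mt]; rewrite /Gt /=; first exact: G0.
    by rewrite !det_mulmx det_tr !mulr_gt0 // G0.
  - move=> i j; exists ('D_v (fun z => G z i j : R^o) y); split; last first.
    + by rewrite /Gt /= scale0r addr0 M0 mul1mx trmx1 mulmx1.
    + rewrite (_ : (fun t => _) = fun t => G y i j + t * (A *m G y + G y *m A^T) i j
         + t * t * (A *m G y *m A^T) i j); first by rewrite DG; exact: deriv0_quad.
      apply/funext => t; rewrite /Gt /= /M mulmxDl mul1mx linearD /= trmx1 linearZ /=.
      rewrite mulmxDr mulmx1 mulmxDl -!scalemxAr -!scalemxAl scalerA.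
      by rewrite !mxE; ring.
    + exact: (line (fun z => G z i j)).
  - move=> [[] t] [/= U1 Mt]; rewrite /wt /=; first exact: wl.
    exact: mlin_pull (wl y Uy).
  - move=> W; exists ('D_v (fun z => w z W : R^o) y); split.
    + exact: (line (fun z => w z W)).
    + by rewrite Dw; exact: deriv0_form (wl y Uy).
    + by rewrite /wt /= scale0r addr0 M0 mulmx1.
(* Along the second curve, naturality identifies the Hodge star with the fixed form at [y] evaluated
   on [V *m M t], whose derivative is [der A]. *)
have D3 : deriv0 (fun t => hodge (G y) (w y) (V *m M t)) d.
  apply: near_eq_is_derive D2; apply: filterS nM => t Mt; rewrite /Gt /wt /=.
  have uM : M t \in unitmx by rewrite unitmxE unitfE gt_eqF.
  have := @hodge_frame _ k m (G y) (M t) _ (fun W => w y (W *m M t)) (V *m M t)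
     (mlin_pull _ (wl y Uy)) erefl Mt _.
  rewrite -(in_frame_pull _ uM) => ->; last by rewrite !det_mulmx det_tr !mulr_gt0 // G0.
  by rewrite /in_frame mulmxK.
rewrite -(deriv0_uniq D1 (line _ dh)).
exact: deriv0_uniq D3 (deriv0_form A V (mlin_hodge _ _)).
Unshelve. all: by end_near. Qed.

(** * Christoffel symbols and parallel forms *)

Definition christoffel_mx n (G : 'rV[R]_n -> 'M[R]_n) x a : 'M[R]_n :=
  \matrix_(b, c) christoffel G x c a b.

(** This is the metric compatibility of the Levi-Civita connection. The matrix of Christoffel
    symbols has the lower index as row and the upper as column, since vectors are rows. *)
Lemma christoffel_metric n (U : set 'rV[R]_n) (G : 'rV[R]_n -> 'M[R]_n) x a :
  open U -> U x -> (forall z, U z -> (G z)^T = G z) -> G x \in unitmx ->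
  forall b e, 'D_(delta_mx 0 a) (fun z => G z b e : R^o) x =
    (christoffel_mx G x a *m G x + G x *m (christoffel_mx G x a)^T) b e.
Proof.
move=> oU Ux sG uG b e.
have sp i j k : partial i (fun z => G z j k) x = partial i (fun z => G z k j) x.
  apply: near_eq_derive; apply: filterS (open_nbhs_nbhs (conj oU Ux)) => z Uz.
  by rewrite -{1}(sG z Uz) mxE.
pose X i j k := partial i (fun z => G z j k) x + partial j (fun z => G z i k) x
  - partial k (fun z => G z i j) x.
(* Contraction with the metric lowers the upper index and leaves the Koszul combination of three
   derivatives. *)
have L i j k : \sum_c christoffel G x c i j * G x c k = 2^-1 * X i j k.
  transitivity (2^-1 * \sum_d (\sum_c G x k c * invmx (G x) c d) * X i j d).
    rewrite !big_distrr /=; under [RHS]eq_bigr do rewrite mulr_suml mulr_sumr.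
    rewrite exchange_big; apply: eq_bigr => c _ /=.
    rewrite /christoffel -mulrA mulr_suml mulr_sumr; apply: eq_bigr => d _.
    have -> : G x c k = G x k c by rewrite -[in LHS](sG x Ux) mxE.
    by rewrite -/(X i j d); ring.
  have I d : \sum_c G x k c * invmx (G x) c d = (d == k)%:R.
    by have /matrixP/(_ k d) := mulmxV uG; rewrite !mxE eq_sym.
  under eq_bigr do rewrite I; rewrite (bigD1 k) //= eqxx mul1r big1 ?addr0 // => d dk.
  by rewrite (negPf dk) mul0r.
rewrite !mxE; under eq_bigr do rewrite mxE.
under [X in _ + X]eq_bigr => c _ do rewrite !mxE mulrC -[G x]sG // mxE.
rewrite !L /X -/(partial a (fun z => G z b e) x) (sp a e b) (sp b a e) (sp e a b) (sp b e a).
by rewrite (sp e b a); field.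
Qed.

(** The components on coordinate vectors determine the covariant derivative; multilinearity extends
    the equation to all arguments [V], the form in which it can be compared with curves
    [1 + t A]. *)
Lemma levi_civita_der k n (G : 'rV[R]_n -> 'M[R]_n) (U : set 'rV[R]_n)
    (w : 'rV[R]_n -> form R R k n) x a : open U -> U x ->
  (forall z, U z -> mlin idfun (w z)) ->
  (forall V, differentiable (fun z => w z V : R^o) x) ->
  (forall f, levi_civita G w x a f = 0) <->
  (forall V, 'D_(delta_mx 0 a) (fun z => w z V : R^o) x = der (christoffel_mx G x a) (w x) V).
Proof.
move=> oU Ux wl dw.
have E f : levi_civita G w x a f =
   'D_(delta_mx 0 a) (fun z => w z (rowsub f 1%:M) : R^o) x
   - der (christoffel_mx G x a) (w x) (rowsub f 1%:M).
  congr (_ - _); apply: eq_bigr => r _.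
  have -> : row r (rowsub f 1%:M) *m christoffel_mx G x a =
      \sum_c christoffel G x c a (f r) *: delta_mx 0 c.
    rewrite [LHS]row_sum_delta; apply: eq_bigr => c _; congr (_ *: _).
    rewrite !mxE (bigD1 (f r)) //= !mxE eqxx mul1r big1 ?addr0 // => d dr.
    by rewrite !mxE eq_sym (negPf dr) mul0r.
  rewrite (mlin_row _ _ _ (mlin_setr r _ (wl x Ux))); apply: eq_bigr => c _.
  congr (_ * w x _); apply/row_matrixP => s; rewrite row_setr.
  by case: (eqVneq s r) => [->|sr]; apply/rowP => d; rewrite !mxE ?eqxx ?(negPf sr) // eq_sym.
split=> H; last by move=> f; rewrite E H subrr.
have dl : mlin (idfun : {rmorphism R -> R}) (der (christoffel_mx G x a) (w x)).
  exact: mlin_der (wl x Ux).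
move=> V; rewrite (mlin_expand V dl).
transitivity ('D_(delta_mx 0 a) (fun z => \sum_(h : {ffun 'I_k -> 'I_n})
    (\prod_r V r (h r)) * w z (rowsub h 1%:M) : R^o) x).
  apply: near_eq_derive; apply: filterS (open_nbhs_nbhs (conj oU Ux)) => z Uz.
  exact: (mlin_expand V (wl z Uz)).
rewrite (_ : (fun z => _) = \sum_(h : {ffun 'I_k -> 'I_n})
    (\prod_r V r (h r)) \*: (fun z => w z (rowsub h 1%:M) : R^o)); last first.
  by apply/funext => z; rewrite fct_sumE.
apply: derive_val.
elim/big_rec2: _ => [|h y1 y2 _ Hy]; first exact: is_derive_cst.
apply: is_deriveD => //; apply: is_deriveZ.
apply: is_derive_eq; first exact: derivableP (diff_derivable (dw _)).
by have := E h; rewrite H => /esym/eqP; rewrite subr_eq0 => /eqP.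
Qed.

Section Block.
Variables (n : nat) (G : 'rV[R]_n -> 'M[R]_n) (x : 'rV[R]_(1 + n)).
Let G8 (z : 'rV[R]_(1 + n)) := block1 (G (rsubmx z)).
Hypothesis uG : G (rsubmx x) \in unitmx.

Lemma rsubmx_delta_l (a : 'I_1) : rsubmx (delta_mx 0 (lshift n a) : 'rV[R]_(1 + n)) = 0.
Proof. by apply/rowP => j; rewrite !mxE eq_rlshift andbF. Qed.

Lemma rsubmx_delta_r (a : 'I_n) :
  rsubmx (delta_mx 0 (rshift 1 a) : 'rV[R]_(1 + n)) = delta_mx 0 a.
Proof. by apply/rowP => j; rewrite !mxE eq_rshift. Qed.

Lemma derive_rsubmx (f : 'rV[R]_n -> R^o) u :
  'D_u (fun z : 'rV[R]_(1 + n) => f (rsubmx z)) x = 'D_(rsubmx u) f (rsubmx x).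
Proof. by have /(congr1 (@^~ x)) := @derive_compL R R^o _ _ (@rsubmx R 1 1 n) f u. Qed.

Lemma partial_lsh a (f : 'rV[R]_n -> R^o) : partial (lshift n a) (fun z => f (rsubmx z)) x = 0.
Proof. by rewrite /partial derive_rsubmx rsubmx_delta_l derive0. Qed.

Lemma partial_rsh a (f : 'rV[R]_n -> R^o) :
  partial (rshift 1 a) (fun z => f (rsubmx z)) x = partial a f (rsubmx x).
Proof. by rewrite /partial derive_rsubmx rsubmx_delta_r. Qed.

Lemma partial_cst m a (c : R) (z : 'rV[R]_m) : partial a (fun=> c) z = 0.
Proof. exact: derive_cst. Qed.

Lemma G8_ll a b z : G8 z (lshift n a) (lshift n b) = (a == b)%:R.
Proof. by rewrite /G8 /block1 block_mxEul mxE. Qed.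
Lemma G8_lr a b z : G8 z (lshift n a) (rshift 1 b) = 0.
Proof. by rewrite /G8 /block1 block_mxEur mxE. Qed.
Lemma G8_rl a b z : G8 z (rshift 1 a) (lshift n b) = 0.
Proof. by rewrite /G8 /block1 block_mxEdl mxE. Qed.
Lemma G8_rr a b z : G8 z (rshift 1 a) (rshift 1 b) = G (rsubmx z) a b.
Proof. by rewrite /G8 /block1 block_mxEdr. Qed.

Lemma partial_G8_l a b c : partial a (fun z => G8 z (lshift n b) c) x = 0.
Proof.
case: (split_ordP c) => d ->.
  rewrite (_ : (fun z => _) = fun=> (b == d)%:R) ?partial_cst //.
  by apply/funext => z; exact: G8_ll.
rewrite (_ : (fun z => _) = fun=> 0) ?partial_cst //.
by apply/funext => z; exact: G8_lr.
Qed.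

Lemma partial_G8_r a b c : partial a (fun z => G8 z b (lshift n c)) x = 0.
Proof.
case: (split_ordP b) => d ->; first exact: partial_G8_l.
rewrite (_ : (fun z => _) = fun=> 0) ?partial_cst //.
by apply/funext => z; exact: G8_rl.
Qed.

Lemma partial_G8_rr a b c : partial a (fun z => G8 z (rshift 1 b) (rshift 1 c)) x =
  partial a (fun z => G (rsubmx z) b c) x.
Proof. by congr (partial a _ x); apply/funext => z; exact: G8_rr. Qed.

Lemma partial_G8_d a b c : partial (lshift n a) (fun z => G8 z b c) x = 0.
Proof.
case: (split_ordP b) => b' ->; first exact: partial_G8_l.
case: (split_ordP c) => c' ->; first exact: partial_G8_r.
by rewrite partial_G8_rr; exact: (partial_lsh a (fun z => G z b' c')).
Qed.

(** The product metric does not vary along the circle and its circle row and column are constant, so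
    a symbol with any circle index vanishes; the block form of the inverse metric leaves the others
    unchanged. *)
Lemma christoffel_mx_block1 a : christoffel_mx G8 x a =
  block_mx 0 0 0 (if fintype.split a is inr a' then christoffel_mx G (rsubmx x) a' else 0).
Proof.
have uM c d : invmx (G8 x) c d = block1 (invmx (G (rsubmx x))) c d by rewrite block1V.
have E0 a0 b c : (forall d, invmx (G8 x) c d = 0 \/
    partial a0 (fun y => G8 y b d) x + partial b (fun y => G8 y a0 d) x
    - partial d (fun y => G8 y a0 b) x = 0) -> christoffel G8 x c a0 b = 0.
  move=> H; rewrite /christoffel big1 ?mulr0 // => d _.
  by case: (H d) => ->; rewrite ?mul0r ?mulr0.
apply/matrixP => b c; rewrite mxE.
case: (split_ordP b) => b' ->.
  have -> : christoffel G8 x c a (lshift n b') = 0.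
    by apply: E0 => d; right; rewrite partial_G8_l partial_G8_d partial_G8_r subr0 addr0.
  by case: (split_ordP c) => c' ->; rewrite ?block_mxEul ?block_mxEur mxE.
case: (split_ordP c) => c' ->.
  rewrite block_mxEdl mxE; apply: E0 => d.
  case: (split_ordP d) => d' ->; last by left; rewrite uM block_mxEur mxE.
  by right; rewrite !partial_G8_r partial_G8_d subr0 addr0.
rewrite block_mxEdr; case: (split_ordP a) => a' ->.
  transitivity (0 : R); last by rewrite mxE.
  apply: E0 => d; right.
  by rewrite partial_G8_d (partial_G8_l (rshift 1 b')) (partial_G8_l d) subr0 addr0.
rewrite mxE /christoffel; congr (_ * _).
rewrite big_split_ord /= big1 ?add0r => [|d _]; last by rewrite uM block_mxEdl mxE mul0r.
apply: eq_bigr => d _; rewrite uM block_mxEdr; congr (_ * _).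
have E i j k : partial (rshift 1 i) (fun z => G8 z (rshift 1 j) (rshift 1 k)) x =
    partial i (fun z => G z j k) (rsubmx x).
  by rewrite partial_G8_rr; exact: (partial_rsh i (fun z => G z j k)).
by rewrite !E.
Qed.

End Block.

(** Both sides are the derivative at 0 of one curve, because [1 + t A] on the product is the block
    matrix of 1 and [1 + t A]. *)
Lemma der_cylinder (phi : form R R 3 7) (psi : form R R 4 7) (A : 'M[R]_7) V :
  mlin idfun phi -> mlin idfun psi ->
  der (block_mx 0 0 0 A : 'M[R]_(1 + 7)) (cylinder_form phi psi) V =
  cylinder_form (der A phi) (der A psi) V.
Proof.
move=> phil psil.
have := deriv0_cylinder V (fun U => deriv0_form A U phil) (fun U => deriv0_form A U psil).
apply: deriv0_uniq.
have := deriv0_form (block_mx 0 0 0 A : 'M[R]_(1 + 7)) V (mlin_cylinder phil psil).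
congr (is_derive _ _ _ _); apply/funext => t.
rewrite -cylinder_form_pull /block1; congr (cylinder_form _ _ (V *m _)).
rewrite (scalar_mx_block 1 7 1) scale_block_mx add_block_mx !scaler0 !addr0.
by [].
Qed.

Section CylinderParallel.
Variables (U : set 'rV[R]_7) (G : 'rV[R]_7 -> 'M[R]_7) (phi : 'rV[R]_7 -> form R R 3 7).
Hypotheses (oU : open U) (sG : forall z, U z -> (G z)^T = G z)
  (G0 : forall z, U z -> 0 < \det (G z))
  (dG : forall i j, smooth_on U (fun z => G z i j : R^o))
  (phil : forall z, U z -> mlin idfun (phi z))
  (dphi : forall V, smooth_on U (fun z => phi z V : R^o)).
Let psi z := star_phi (G z) (phi z).
Let G8 (z : 'rV[R]_(1 + 7)) := block1 (G (rsubmx z)).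
Let Phi (z : 'rV[R]_(1 + 7)) := cylinder_form (phi (rsubmx z)) (psi (rsubmx z)).

Lemma smooth_psi V : smooth_on U (fun z => psi z V : R^o).
Proof.
apply/smooth_CkP => k; apply: (class_hodge (k := 3) (m := 4) (Ck_class k oU)) => //.
  by move=> i j; have /smooth_CkP := dG i j; exact.
by move=> W; have /smooth_CkP := dphi W; exact.
Qed.

Lemma smooth_Phi V : smooth_on (@rsubmx R 1 1 7 @^-1` U) (fun z => Phi z V : R^o).
Proof.
have H : smooth_on U (fun z => cylinder_form (phi z) (psi z) V : R^o).
  apply/smooth_CkP => k; apply: (class_cylinder (Ck_class k oU)) => W.
    by have /smooth_CkP := dphi W; exact.
  by have /smooth_CkP := @smooth_psi W; exact.
have /smooth_CkP Hk := H; apply/smooth_CkP => k.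
exact: (@Ck_compL _ _ _ _ (@rsubmx R 1 1 7) k U
  (fun z => cylinder_form (phi z) (psi z) V) oU (@continuous_rsubmx _ _ _ _) (Hk k)).
Qed.

Lemma mlin_psi z : mlin idfun (psi z).
Proof. exact: (mlin_hodge (k := 3) (m := 4)). Qed.

Lemma mlin_Phi z : U (rsubmx z) -> mlin idfun (Phi z).
Proof. by move=> Uz; apply: mlin_cylinder; [exact: phil|exact: mlin_psi]. Qed.

Lemma parallel_cylinder x : U (rsubmx x) ->
  (forall a f, levi_civita G phi (rsubmx x) a f = 0) ->
  forall a f, levi_civita G8 Phi x a f = 0.
Proof.
move=> Ux Hphi a.
have oU8 : open (@rsubmx R 1 1 7 @^-1` U).
  by apply: open_comp => // y _; exact: continuous_rsubmx.
have uG : G (rsubmx x) \in unitmx by rewrite unitmxE unitfE gt_eqF ?G0.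
apply/(levi_civita_der G8 a oU8 Ux mlin_Phi) => [V|V].
  exact: (@smooth_Phi V [::]  x Ux).
pose A := if fintype.split a is inr a' then christoffel_mx G (rsubmx x) a' else 0.
rewrite christoffel_mx_block1 // der_cylinder; [|exact: phil|exact: mlin_psi].
set v := rsubmx (delta_mx 0 a : 'rV[R]_(1 + 7)).
have key W W' : 'D_v (fun z => phi z W : R^o) (rsubmx x) = der A (phi (rsubmx x)) W /\
             'D_v (fun z => psi z W' : R^o) (rsubmx x) = der A (psi (rsubmx x)) W'.
  have d0 k n (w : form R R k n) W0 : mlin idfun w -> der (0 : 'M[R]_n) w W0 = 0.
    move=> wl; rewrite /der big1 // => r _; apply: (mlin_row0 (r := r) wl).
    by rewrite row_setr eqxx mulmx0.
  (* In the circle direction both the projected vector and the matrix vanish; in a direction of [Y]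
     the claim is the parallelism of [phi] and its transfer to the Hodge dual. *)
  rewrite /v /A; case: (split_ordP a) => a' ->.
    by rewrite rsubmx_delta_l !derive0 !d0 //; [exact: mlin_psi|exact: phil].
  rewrite rsubmx_delta_r.
  have Dphi := (levi_civita_der G a' oU Ux phil (fun W0 => dphi W0 [::] Ux)).1 (Hphi a').
  split; first exact: Dphi.
  apply: (hodge_derive (k := 3) (m := 4) oU Ux G0 phil) => //.
  - by move=> i j; exact: (dG i j [::]).
  - by move=> W0; exact: (dphi W0 [::]).
  - exact: (christoffel_metric a' oU Ux sG uG).
  - exact: (@smooth_psi W' [::]).
rewrite (derive_rsubmx x (fun z => cylinder_form (phi z) (psi z) V)) -/v.
have line (f : 'rV[R]_7 -> R^o) : differentiable f (rsubmx x) ->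
    deriv0 (fun t => f (rsubmx x + t *: v)) ('D_v f (rsubmx x)).
  move=> df; have := @is_derive_line _ _ f (rsubmx x) v 0; rewrite scale0r addr0; exact.
have L := line (fun z => cylinder_form (phi z) (psi z) V).
apply: deriv0_uniq; first apply: L.
  have cl := Ck_class 0 oU.
  have := class_cylinder cl (phi := phi) (psi := psi) V.
  move=> H; apply: (Ck_diff (k := 0) (U := U)) => //; apply: H => W.
    by have /smooth_CkP := dphi W; exact.
  by have /smooth_CkP := @smooth_psi W; exact.
apply: deriv0_cylinder => W.
  by rewrite -(key W 0).1; apply: (line (fun z => phi z W)); exact: (dphi W [::]).
by rewrite -(key 0 W).2; apply: (line (fun z => psi z W)); exact: (@smooth_psi W [::]).
Qed.

End CylinderParallel.
End ClosedClass.

(** * The cylinder as a Spin(7)-manifold *)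

Section Charts.
Variables (R : realType).

Lemma trans_eq n (A : atlas R n) (i j : ix A) x y :
  {in dom j &, injective (par j)} -> dom j y -> par j y = par i x ->
  trans i j x = y.
Proof.
move=> inj jy xy; rewrite /trans; apply: xget_unique => // z [jz zx].
by apply: inj; rewrite ?inE // zx.
Qed.

Lemma overlapP n (A : atlas R n) (i j : ix A) x : overlap i j x ->
  dom j (trans i j x) /\ par j (trans i j x) = par i x.
Proof.
move=> [ix [y jy yx]].
by case: (xgetPex 0 (P := [set y | dom j y /\ par j y = par i x])) => //; exists y.
Qed.

Lemma derive_jacobian m n (f : 'rV[R]_m -> 'rV[R]_n) x (J : 'M[R]_(m, n)) :
  differentiable f x -> (forall v, 'D_v f x = v *m J) -> 'J f x = J.
Proof.
move=> df H; apply/row_matrixP => i; rewrite !rowE -H.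
by rewrite deriveEjacobian.
Qed.

Lemma Ck_id n k (U : set 'rV[R]_n) : open U -> Ck k U (fun x => x).
Proof.
move=> oU; case: k => [|k].
  by apply/Ck0 => x _; exact: ex_diff.
apply/CkS; split=> [x _|i]; first exact: ex_diff.
rewrite (_ : 'D_(delta_mx 0 i) _ = fun=> delta_mx 0 i); first exact: Ck_cst.
by apply/funext => x; exact: derive_id.
Qed.

Lemma mulmxr_continuous m n (M : 'M[R]_(m, n)) :
  continuous (mulmxr M : {linear 'rV[R]_m -> 'rV[R]_n}).
Proof.
suff H (r : seq 'I_m) (x : 'rV[R]_m) :
    {for x, continuous (fun u : 'rV[R]_m => \sum_(i <- r) u 0 i *: row i M)}.
  move=> x; have := H (index_enum _) x.
  rewrite (_ : (fun u => _) = (fun u => u *m M)) //.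
  by apply/funext => u; rewrite -mulmx_sum_row.
have FF := nbhs_filter x.
elim: r => [|i r IH].
  rewrite (_ : (fun u => _) = fun=> 0); last by apply/funext => u; rewrite big_nil.
  exact: cvg_cst.
rewrite (_ : (fun u => _) = fun u : 'rV[R]_m =>
    u 0 i *: row i M + \sum_(j <- r) u 0 j *: row j M); last first.
  by apply/funext => u; rewrite big_cons.
by apply: cvgD; [apply: cvgZr_tmp; exact: coord_continuous|exact: IH].
Qed.

(** * Products of oriented manifolds *)

Section Product.
Variables (m n : nat) (A : atlas R m) (B : atlas R n).
Let X := prod_atlas A B.
Let lft : {linear 'rV[R]_(m + n) -> 'rV[R]_m} := @lsubmx R 1 m n.
Let rgt : {linear 'rV[R]_(m + n) -> 'rV[R]_n} := @rsubmx R 1 m n.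
Let inl' : {linear 'rV[R]_m -> 'rV[R]_(m + n)} := mulmxr (row_mx 1%:M 0).
Let inr' : {linear 'rV[R]_n -> 'rV[R]_(m + n)} := mulmxr (row_mx 0 1%:M).

Let lftc : continuous lft. Proof. exact: continuous_lsubmx. Qed.
Let rgtc : continuous rgt. Proof. exact: continuous_rsubmx. Qed.

Lemma open_prod U V : open U -> open V -> open (lft @^-1` U `&` rgt @^-1` V).
Proof.
by move=> oU oV; apply: openI; apply: open_comp => // x _; (exact: lftc || exact: rgtc).
Qed.

Lemma prod_row_mx a b : inl' a + inr' b = row_mx a b.
Proof.
by rewrite /= !mul_mx_row !mulmx1 !mulmx0 add_row_mx addr0 add0r.
Qed.

Lemma overlap_prod (s t : ix X) x :
  overlap s t x <-> overlap s.1 t.1 (lsubmx x) /\ overlap s.2 t.2 (rsubmx x).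
Proof.
split.
  move=> [[s1 s2] [y [t1 t2] [e1 e2]]].
  by split; split=> //; [exists (lsubmx y)|exists (rsubmx y)].
move=> [[s1 [y1 t1 e1]] [s2 [y2 t2 e2]]]; split=> //.
exists (row_mx y1 y2); first by split; rewrite /= ?row_mxKl ?row_mxKr.
by rewrite /= row_mxKl row_mxKr e1 e2.
Qed.

Hypotheses (iA : forall i : ix A, {in dom i &, injective (par i)})
  (iB : forall i : ix B, {in dom i &, injective (par i)}).

Lemma prod_inj (s : ix X) : {in dom s &, injective (par s)}.
Proof.
move=> x y /set_mem[x1 x2] /set_mem[y1 y2] [e1 e2].
rewrite -[x]hsubmxK -[y]hsubmxK; congr row_mx.
  by apply: (@iA s.1); rewrite ?inE.
by apply: (@iB s.2); rewrite ?inE.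
Qed.

Lemma trans_prod (s t : ix X) x : overlap s t x ->
  trans s t x = row_mx (trans s.1 t.1 (lsubmx x)) (trans s.2 t.2 (rsubmx x)).
Proof.
move=> /overlap_prod[/overlapP[d1 e1] /overlapP[d2 e2]].
apply: trans_eq; first exact: prod_inj.
  by split; rewrite /= ?row_mxKl ?row_mxKr.
by rewrite /= row_mxKl row_mxKr e1 e2.
Qed.

Hypotheses (oA : forall i j : ix A, open (overlap i j))
  (oB : forall i j : ix B, open (overlap i j))
  (sA : forall i j : ix A, smooth_on (overlap i j) (trans i j))
  (sB : forall i j : ix B, smooth_on (overlap i j) (trans i j)).

Lemma overlap_prodE (s t : ix X) : overlap s t =
  lft @^-1` (overlap s.1 t.1) `&` rgt @^-1` (overlap s.2 t.2).
Proof. by apply/seteqP; split=> x /overlap_prod. Qed.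

Lemma open_overlap_prod (s t : ix X) : open (overlap s t).
Proof. by rewrite overlap_prodE; exact: open_prod. Qed.

(** The pair of transition maps is written as a sum of compositions with linear maps, for which
    [C^k] regularity and derivatives are available. *)
Let tr (s t : ix X) x := inl' (trans s.1 t.1 (lft x)) + inr' (trans s.2 t.2 (rgt x)).

Lemma smooth_trans_prod (s t : ix X) : smooth_on (overlap s t) (trans s t).
Proof.
apply/smooth_CkP => k; have oO := @open_overlap_prod s t.
apply: (eq_Ck (f := tr s t)) => //.
  by move=> x Ox; rewrite trans_prod // -prod_row_mx.
have cm p q (M : 'M[R]_(p, q)) : continuous (mulmxr M : {linear 'rV[R]_p -> 'rV[R]_q}).
  exact: mulmxr_continuous.
apply: CkD => //.
  apply: (Ck_lin (L := inl')) => //; first exact: cm.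
  apply: (Ck_sub (U := lft @^-1` overlap s.1 t.1)); first by rewrite overlap_prodE => x [].
  by apply: (Ck_compL (L := lft)) => //; have /smooth_CkP := @sA s.1 t.1; exact.
apply: (Ck_lin (L := inr')) => //; first exact: cm.
apply: (Ck_sub (U := rgt @^-1` overlap s.2 t.2)); first by rewrite overlap_prodE => x [].
by apply: (Ck_compL (L := rgt)) => //; have /smooth_CkP := @sB s.2 t.2; exact.
Qed.

Lemma jacobian_trans_prod (s t : ix X) x : overlap s t x ->
  'J (trans s t) x = block_mx ('J (trans s.1 t.1) (lsubmx x)) 0 0
                              ('J (trans s.2 t.2) (rsubmx x)).
Proof.
move=> Ox; apply: derive_jacobian; first exact: (@smooth_trans_prod s t [::] x Ox).
have [Ox1 Ox2] := (overlap_prod s t x).1 Ox.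
have d1 := @sA s.1 t.1 [::] _ Ox1; have d2 := @sB s.2 t.2 [::] _ Ox2.
move=> v; rewrite -[v in RHS]hsubmxK mul_row_block !mulmx0 addr0 add0r.
rewrite -!deriveEjacobian //.
have -> : 'D_v (trans s t) x = 'D_v (tr s t) x.
  apply: near_eq_derive; apply: filterS (open_nbhs_nbhs (conj (@open_overlap_prod s t) Ox)).
  by move=> y Oy; rewrite trans_prod // -prod_row_mx.
have e1 := diff_derivable (v := v).
have cL p q (M : 'M[R]_(p, q)) y : differentiable (mulmxr M : {linear 'rV[R]_p -> 'rV[R]_q}) y.
  by apply: linear_differentiable; exact: mulmxr_continuous.
have dlft y : differentiable lft y by exact: linear_differentiable.
have drgt y : differentiable rgt y by exact: linear_differentiable.
have dA : differentiable (trans s.1 t.1 \o lft) x by exact: differentiable_comp (dlft x) d1.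
have dB : differentiable (trans s.2 t.2 \o rgt) x by exact: differentiable_comp (drgt x) d2.
have D1 : differentiable (inl' \o (trans s.1 t.1 \o lft)) x := differentiable_comp dA (cL _ _ _ _).
have D2 : differentiable (inr' \o (trans s.2 t.2 \o rgt)) x := differentiable_comp dB (cL _ _ _ _).
rewrite [LHS](deriveD (e1 _ _ _ D1) (e1 _ _ _ D2)) -prod_row_mx.
congr (_ + _).
  rewrite deriveE // (diff_comp dA (cL _ _ _ _)) /= diff_lin; last exact: mulmxr_continuous.
  apply: (congr1 inl'); apply: etrans (esym (deriveE v dA)) _.
  exact: (congr1 (@^~ x) (derive_compL lft (trans s.1 t.1) v)).
rewrite deriveE // (diff_comp dB (cL _ _ _ _)) /= diff_lin; last exact: mulmxr_continuous.
apply: (congr1 inr'); apply: etrans (esym (deriveE v dB)) _.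
exact: (congr1 (@^~ x) (derive_compL rgt (trans s.2 t.2) v)).
Qed.

End Product.

Lemma oriented_manifold_prod m n (A : atlas R m) (B : atlas R n) :
  oriented_manifold A -> oriented_manifold B -> oriented_manifold (prod_atlas A B).
Proof.
move=> [iA [CA cA coverA] hA oA sA] [iB [CB cB coverB] hB oB sB].
have injA i := (iA i).2; have injB i := (iB i).2.
have smA i j := (sA i j).1; have smB i j := (sB i j).1.
split.
- move=> s; split; last exact: prod_inj.
  exact: open_prod (iA s.1).1 (iB s.2).1.
- exists (CA `*` CB); first exact: countableX.
  move=> [p q]; have [i Ci [x ix xp]] := coverA p; have [j Cj [y jy yq]] := coverB q.
  exists (i, j) => //; exists (row_mx x y); first by split; rewrite /= ?row_mxKl ?row_mxKr.
  by rewrite /= row_mxKl row_mxKr xp yq.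
- move=> [p1 p2] [q1 q2] pq.
  (* Two distinct points differ in one of the factors, and open sets separating them there are
     pulled back by the projection. *)
  case: (pselect (p1 = q1)) => [e1|n1]; last first.
    have [U [V [oU oV Up Vq UV]]] := hA _ _ n1.
    exists [set z | U z.1], [set z | V z.1]; split=> //.
    + move=> s; rewrite (_ : [set x | _] = lsubmx @^-1` [set x | dom s.1 x /\ U (par s.1 x)]
         `&` rsubmx @^-1` dom s.2); first exact: open_prod (oU _) (iB s.2).1.
      by apply/seteqP; split=> x /=; tauto.
    + move=> s; rewrite (_ : [set x | _] = lsubmx @^-1` [set x | dom s.1 x /\ V (par s.1 x)]
         `&` rsubmx @^-1` dom s.2); first exact: open_prod (oV _) (iB s.2).1.
      by apply/seteqP; split=> x /=; tauto.
    + by apply/seteqP; split=> // z [Uz Vz]; have : (U `&` V) z.1 := conj Uz Vz; rewrite UV.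
  have n2 : p2 <> q2 by move=> e2; apply: pq; rewrite e1 e2.
  have [U [V [oU oV Up Vq UV]]] := hB _ _ n2.
  exists [set z | U z.2], [set z | V z.2]; split=> //.
  + move=> s; rewrite (_ : [set x | _] = lsubmx @^-1` dom s.1 `&`
       rsubmx @^-1` [set x | dom s.2 x /\ U (par s.2 x)]); first exact: open_prod (iA s.1).1 (oU _).
    by apply/seteqP; split=> x /=; tauto.
  + move=> s; rewrite (_ : [set x | _] = lsubmx @^-1` dom s.1 `&`
       rsubmx @^-1` [set x | dom s.2 x /\ V (par s.2 x)]); first exact: open_prod (iA s.1).1 (oV _).
    by apply/seteqP; split=> x /=; tauto.
  + by apply/seteqP; split=> // z [Uz Vz]; have : (U `&` V) z.2 := conj Uz Vz; rewrite UV.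
- exact: open_overlap_prod.
- move=> s t; split; first exact: smooth_trans_prod.
  move=> x Ox; rewrite jacobian_trans_prod // det_ublock.
  have [Ox1 Ox2] := (overlap_prod s t x).1 Ox.
  by apply: mulr_gt0; [exact: (sA s.1 t.1).2|exact: (sB s.2 t.2).2].
Qed.

(** * The circle as an oriented manifold *)

Section Circle.
Let C := circle R.

(** The half-angle formula: [cos d = 1] forces [sin (d / 2) = 0], while [d / 2] lies in [0, pi). *)
Lemma cos_eq1 (d : R) : 0 <= d < 2 * pi -> cos d = 1 -> d = 0.
Proof.
move=> /andP[d0 d2] c1; apply/eqP; rewrite eq_le d0 andbT leNgt; apply/negP => dp.
have : 0 < sin (d / 2) by apply: sin_gt0_pi; rewrite divr_gt0 //= ltr_pdivrMr // mulrC.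
have E := cos_mulr2n (d / 2); rewrite (_ : d / 2 *+ 2 = d) ?c1 in E; last first.
  by rewrite -mulr_natr divfK.
have E2 := cos2Dsin2 (d / 2); move=> s0.
have : 0 < sin (d / 2) ^+ 2 by rewrite exprn_gt0.
by move: E E2; rewrite -mulr_natr; lra.
Qed.

Lemma period_eq (t y y' : R) : t < y < t + 2 * pi -> t < y' < t + 2 * pi ->
  cos y = cos y' -> sin y = sin y' -> y = y'.
Proof.
wlog le : y y' / y' <= y.
  move=> H; case: (leP y' y) => [|/ltW] le h h' c s; first exact: H.
  by apply/esym; apply: H.
move=> /andP[y1 y2] /andP[y3 y4] c s; apply/eqP; rewrite -subr_eq0; apply/eqP.
apply: cos_eq1; first by apply/andP; split; lra.
by rewrite cosB c s -!expr2 cos2Dsin2.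
Qed.

Lemma circle_par (s t : R) (x y : 'rV[R]_1) :
  cos (y 0 0) = cos (x 0 0) -> sin (y 0 0) = sin (x 0 0) ->
  @par _ _ C t y = @par _ _ C s x.
Proof. by move=> c s'; apply: val_inj; rewrite /= c s'. Qed.

Lemma circle_inj (t : ix C) : {in dom t &, injective (par t)}.
Proof.
move=> x y /set_mem tx /set_mem ty e; have /= := congr1 val e.
move=> [ce se]; apply/rowP => i; rewrite (ord1 i); exact: period_eq tx ty ce se.
Qed.

Lemma open_coord (U : set R) : open U -> open [set x : 'rV[R]_1 | U (x 0 0)].
Proof.
move=> oU; apply: (@open_comp 'rV[R]_1 R (fun x => x 0 0) U) => // x _.
exact: coord_continuous.
Qed.

Lemma circle_dom_open (t : ix C) : open (dom t).
Proof.
rewrite (_ : dom t = [set x | `]t, t + 2 * pi[%classic (x 0 0)]).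
  by apply: open_coord; exact: interval_open.
by apply/seteqP; split=> x /=; rewrite in_itv.
Qed.

(** The displacement [c] at [x] satisfies [cos c = 1] and [sin c = 0], so translation by [c]
    preserves points of the circle. Near [x] it also stays in the open chart domain, where the
    parametrisation is injective. *)
Lemma circle_trans_near (s t : ix C) x : overlap s t x ->
  \forall y \near x, overlap s t y /\ trans s t y = y + (trans s t x - x).
Proof.
move=> Ox; have [tx e] := overlapP Ox; set c := trans s t x - x.
have [ce se] : cos ((trans s t x) 0 0) = cos (x 0 0) /\ sin ((trans s t x) 0 0) = sin (x 0 0).
  by have /= := congr1 val e; case.
have cc : cos (c 0 0) = 1 by rewrite !mxE cosB ce se -!expr2 cos2Dsin2.
have sc : sin (c 0 0) = 0 by rewrite !mxE sinB ce se mulrC subrr.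
have ns : nbhs x (dom s) by apply: open_nbhs_nbhs; split; [exact: circle_dom_open|case: Ox].
have nt : \forall y \near x, dom t (y + c).
  have cD : {for x, continuous (fun y : 'rV[R]_1 => y + c)}.
    apply: differentiable_continuous; apply: (Ck_diff (k := 0) (U := setT)) => //.
    by apply: CkD; [exact: openT|exact: Ck_id openT|exact: Ck_cst].
  by apply: cD; rewrite /= addrC subrK; apply: open_nbhs_nbhs; split=> //; exact: circle_dom_open.
apply: filterS2 ns nt => y sy ty.
have pe : @par _ _ C t (y + c) = @par _ _ C s y.
  by apply: circle_par; rewrite mxE ?cosD ?sinD cc sc ?mulr0 ?mulr1 ?subr0 ?addr0 ?add0r.
split; first by split=> //; exists (y + c).
by apply: trans_eq => //; exact: circle_inj.
Qed.

Lemma circle_overlap_open (s t : ix C) : open (overlap s t).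
Proof.
rewrite openE => x Ox; apply: filterS (circle_trans_near Ox) => y; by case.
Qed.

Lemma circle_trans_smooth (s t : ix C) : smooth_on (overlap s t) (trans s t).
Proof.
apply/smooth_CkP => k; apply: Ck_near => x Ox.
exists (fun y => y + (trans s t x - x)); split.
  by apply: filterS (circle_trans_near Ox) => y [].
apply: (Ck_sub (U := setT)) => //; apply: CkD; [exact: openT|exact: Ck_id openT|].
exact: Ck_cst.
Qed.

Lemma circle_jacobian (s t : ix C) x : overlap s t x -> 'J (trans s t) x = 1%:M.
Proof.
move=> Ox; apply: derive_jacobian; first exact: (@circle_trans_smooth s t [::] x Ox).
move=> v; rewrite mulmx1.
rewrite (near_eq_derive (g := fun y => y + (trans s t x - x))); last first.
  by apply: filterS (circle_trans_near Ox) => y [].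
rewrite (deriveD (f := id) (g := cst _)) ?derive_id ?derive_cst ?addr0 //.
Qed.

(** The chart 0 reaches every point except (1, 0), which the chart [pi] reaches at the angle
    [2 * pi]. The angle is [acos c] for a nonnegative sine and [2 * pi - acos c] for a negative
    one. *)
Lemma circle_cover (p : circle_pt R) :
  exists2 t, [set 0; pi] t & @chart_image _ _ C t p.
Proof.
case: p => -[c s] /= cs; have /eqP cs1 := cs; rewrite /= in cs1.
have c1 : -1 <= c <= 1.
  by apply/andP; split; nra.
have pp := pi_gt0 R.
set a := acos c; have ca : cos a = c by apply: acosK; rewrite in_itv.
have a0 : 0 <= a by exact: acos_ge0.
have api : a <= pi by exact: acos_lepi.
have sa : sin a = `|s|.
  rewrite sin_acos // (_ : 1 - c ^+ 2 = s ^+ 2) ?sqrtr_sqr //; lra.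
have mk t (y : R) : t < y < t + 2 * pi -> cos y = c -> sin y = s ->
    @chart_image _ _ C t (exist _ (c, s) cs).
  by move=> ty cy sy; exists (const_mx y); rewrite /= ?mxE //; apply: val_inj; rewrite /= ?mxE cy sy.
have p2 : (2 * pi : R) = pi *+ 2 by rewrite mulr_natl.
have cosN2 : cos (2 * pi - a) = c by rewrite p2 addrC cosD2pi cosN.
have sinN2 : sin (2 * pi - a) = - `|s| by rewrite p2 addrC sinD2pi sinN sa.
have [a00|ap] := eqVneq a 0.
  exists pi; first by right.
  apply: (mk _ (2 * pi - a)); rewrite ?cosN2 ?sinN2 ?a00 //; first by apply/andP; split; lra.
  by move: sa; rewrite a00 sin0 => /esym/eqP; rewrite normr_eq0 => /eqP ->; rewrite normr0 oppr0.
have {}ap : 0 < a by rewrite lt_neqAle eq_sym ap.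
exists 0; first by left.
have [s0|s0] := leP 0 s.
  by apply: (mk _ a); rewrite ?sa ?ger0_norm //; apply/andP; split; lra.
apply: (mk _ (2 * pi - a)); rewrite ?sinN2 ?ltr0_norm ?opprK //; apply/andP; split; lra.
Qed.

Lemma circle_open_pre (f : R * R -> R) (t : ix C) (U : set R) :
  continuous (fun x : R => f (cos x, sin x)) -> open U ->
  open [set x | dom t x /\ U (f (val (par t x)))].
Proof.
move=> fc oU; apply: openI; first exact: circle_dom_open.
apply: (open_coord (U := (fun x : R => f (cos x, sin x)) @^-1` U)).
by apply: open_comp => // x _; exact: fc.
Qed.

(** One of the two plane coordinates, up to sign, takes a smaller value at [p] than at [q]; the
    half-planes on either side of the midpoint separate the points. *)
Lemma circle_hausdorff (p q : pt C) : p <> q -> exists U V : set (pt C),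
  [/\ open_in U, open_in V, U p, V q & U `&` V = set0].
Proof.
move=> pq.
suff sep (f : R * R -> R) : continuous (fun x : R => f (cos x, sin x)) -> f (val p) < f (val q) ->
    exists U V : set (pt C), [/\ open_in U, open_in V, U p, V q & U `&` V = set0].
  have [|n1] := eqVneq (val p).1 (val q).1; last first.
    have [lt|lt|eq] := ltgtP (val p).1 (val q).1.
    - by apply: (sep fst) => //; exact: continuous_cos.
    - apply: (sep (fun z => - z.1)); rewrite /= ?ltrN2 // => x.
      by apply: cvgN; exact: continuous_cos.
    - by rewrite eq eqxx in n1.
  move=> e1; have [lt|lt|eq] := ltgtP (val p).2 (val q).2.
  - by apply: (sep snd) => //; exact: continuous_sin.
  - apply: (sep (fun z => - z.2)); rewrite /= ?ltrN2 // => x.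
    by apply: cvgN; exact: continuous_sin.
  - case: pq; apply: val_inj; move: e1 eq; case: (val p) (val q) => ? ? [? ?] /=.
    by move=> -> ->.
move=> fc lt; pose m := (f (val p) + f (val q)) / 2.
exists [set z | f (val z) < m], [set z | m < f (val z)]; split.
- by move=> t; exact: (@circle_open_pre f t [set y | y < m] fc (@open_lt _ _)).
- by move=> t; exact: (@circle_open_pre f t [set y | m < y] fc (@open_gt _ _)).
- by rewrite /= /m; lra.
- by rewrite /= /m; lra.
- by apply/seteqP; split=> // z /= [h1 h2]; have := lt_trans h1 h2; rewrite ltxx.
Qed.

Lemma oriented_manifold_circle : oriented_manifold C.
Proof.
split.
- by move=> t; split; [exact: circle_dom_open|exact: circle_inj].
- exists [set 0; pi]; last exact: circle_cover.
  by apply: finite_set_countable; exact: finite_set2.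
- exact: circle_hausdorff.
- exact: circle_overlap_open.
- move=> s t; split; first exact: circle_trans_smooth.
  by move=> x Ox; rewrite circle_jacobian // det1.
Qed.
End Circle.

Lemma hodge_pull k m (G M : 'M[R]_(k + m)) (w : form R R k (k + m)) V :
  mlin idfun w -> 0 < \det M -> 0 < \det G ->
  hodge (M *m G *m M^T) (fun U => w (U *m M)) V = hodge G w (V *m M).
Proof.
move=> wl M0 G0; have uM : M \in unitmx by rewrite unitmxE unitfE gt_eqF.
have := @hodge_frame R k m G M _ (fun U => w (U *m M)) (V *m M) (mlin_pull M wl) erefl M0.
rewrite -(in_frame_pull w uM) => ->; last by rewrite !det_mulmx det_tr !mulr_gt0.
by rewrite /in_frame mulmxK.
Qed.

Lemma alt0_cylinder (phi : form R R 3 7) (psi : form R R 4 7) :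
  alt0 psi -> alt0 (cylinder_form phi psi).
Proof.
move=> psi0 V r1 r2 r12 e; rewrite /cylinder_form.
rewrite (@alt0_wedge R R 1 3 8 _ _ V r1 r2 r12 e) add0r; apply: (psi0 _ r1 r2) => //.
by apply/rowP => j; move/rowP/(_ (rshift 1 j)): e; rewrite !mxE.
Qed.

(** * Transfer of the [G_2]-structure to the cylinder *)

Section Cylinder.
Variables (Y : atlas R 7) (phi : form_field R 3 Y) (g : metric_field Y).
Hypothesis H : g2_manifold phi g.
Let X := cylinder Y.

Let Yman : oriented_manifold Y. Proof. by case: H. Qed.
Let oY (i : ix Y) : open (dom i). Proof. by case: Yman => h _ _ _ _; case: (h i). Qed.
Let iY (i : ix Y) : {in dom i &, injective (par i)}.
Proof. by case: Yman => h _ _ _ _; case: (h i). Qed.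
Let sphi : smooth_form phi. Proof. by case: H. Qed.
Let phil i x : dom i x -> mlin idfun (phi i x).
Proof. by case: sphi => h _ _ /h[]. Qed.
Let rg : riemannian_metric g. Proof. by case: H. Qed.
Let sg i x : dom i x -> (g i x)^T = g i x. Proof. by case: rg => h _ _ _; exact: h. Qed.
Let fr i x : dom i x -> exists E, g2_frame (phi i x) (g i x) E.
Proof. by case: H => _ _ _ h _; exact: h. Qed.
Let g0 i x : dom i x -> 0 < \det (g i x).
Proof.
move=> /fr[E [[dE EGE] _]]; have := congr1 determinant EGE.
rewrite !det_mulmx det_tr det1 => e.
have : 0 < \det E * \det (g i x) * \det E by rewrite e.
by rewrite pmulr_lgt0 // pmulr_rgt0.
Qed.

Lemma cylinder_manifold : oriented_manifold X.
Proof. exact: oriented_manifold_prod oriented_manifold_circle Yman. Qed.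

Lemma cylinder_overlap (s t : ix X) x : overlap s t x ->
  overlap s.2 t.2 (rsubmx x) /\ rsubmx (trans s t x) = trans s.2 t.2 (rsubmx x).
Proof.
move=> Ox; split; first by have [] := (overlap_prod s t x).1 Ox.
rewrite (trans_prod _ iY Ox) ?row_mxKr //; exact: circle_inj.
Qed.

Lemma cylinder_jacobian (s t : ix X) x : overlap s t x ->
  'J (trans s t) x = block1 ('J (trans s.2 t.2) (rsubmx x)).
Proof.
move=> Ox; have [Ox1 Ox2] := (overlap_prod s t x).1 Ox.
have [_ _ _ oO tO] := Yman.
rewrite (jacobian_trans_prod circle_inj iY circle_overlap_open oO circle_trans_smooth
  (fun i j => (tO i j).1) Ox).
by rewrite circle_jacobian.
Qed.

Lemma cylinder_smooth_form : smooth_form (cylinder_Phi phi g).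
Proof.
have [_ dphi tphi] := sphi; have [_ _ dg tg] := rg.
split.
- move=> s x [_ dx]; split.
    apply: mlin_cylinder; first exact: phil.
    exact: (mlin_hodge (k := 3) (m := 4)).
  by apply: alt0_cylinder; exact: (alt0_hodge (k := 3) (m := 4)).
- move=> s V p x [_ dx].
  exact: (smooth_Phi (@oY s.2) (g0 (i := s.2)) (dg s.2) (phil (i := s.2)) (dphi s.2) V p dx).
- move=> s t x V Ox; have [Oy _] := cylinder_overlap Ox.
  rewrite /cylinder_Phi (cylinder_overlap Ox).2 cylinder_jacobian // cylinder_form_pull.
  have J0 : 0 < \det ('J (trans s.2 t.2) (rsubmx x)) by have [_ _ _ _ h] := Yman; exact: (h _ _).2.
  have [ty _] := overlapP Oy.
  congr (cylinder_form _ _ V); apply/funext => U; first exact: tphi.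
  (* The Hodge star commutes with the change of coordinates because the Jacobian has positive
     determinant; this is where the orientation of the atlas enters. *)
  rewrite /star_phi -(hodge_pull (k := 3) (m := 4) _ (phil ty) J0 (g0 ty)) -(tg _ _ _ Oy).
  by congr (hodge _ _ _); apply/funext => W; exact: tphi.
Qed.

Lemma cylinder_riemannian_metric : riemannian_metric (cylinder_metric g).
Proof.
have [_ pg dg tg] := rg.
split.
- by move=> s x [_ dx]; rewrite /cylinder_metric -/(block1 _) block1T sg.
- move=> s x u [_ dx] u0; rewrite /cylinder_metric -[u]hsubmxK tr_row_mx.
  rewrite mul_row_block !mulmx0 addr0 add0r mulmx1 mul_row_col mxE.
  have l0 : 0 <= (lsubmx u *m (lsubmx u)^T) 0 0.
    by rewrite mxE sumr_ge0 // => j _; rewrite [_^T _ _]mxE -expr2 sqr_ge0.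
  (* A nonzero vector tangent to the circle has zero [Y]-part, so strict positivity must then come
     from its circle component. *)
  have [r0|r0] := eqVneq (rsubmx u) 0; last by apply: ltr_wpDl => //; exact: pg.
  rewrite r0 !mul0mx [(0 : 'M[R]_1) 0 0]mxE addr0 lt_neqAle l0 andbT.
  apply: contra_neq u0 => e; rewrite -[u]hsubmxK r0; suff -> : lsubmx u = 0 by rewrite row_mx0.
  apply/rowP => j; rewrite (ord1 j) [RHS]mxE; apply/eqP.
  by have /esym/eqP := e; rewrite mxE big_ord1 [_^T _ _]mxE -expr2 sqrf_eq0.
- move=> s a b; have oX : open (dom s) by have [h _ _ _ _] := cylinder_manifold; case: (h s).
  have cst c : smooth_on (dom s) (fun=> c : R^o).
    by apply/smooth_CkP => k; exact: Ck_cst.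
  case: (split_ordP a) => a' ->; case: (split_ordP b) => b' ->.
  + rewrite (_ : (fun x => _) = fun=> (1%:M : 'M[R]_1) a' b'); first exact: cst.
    by apply/funext => x; rewrite /cylinder_metric block_mxEul.
  + rewrite (_ : (fun x => _) = fun=> 0); first exact: cst.
    by apply/funext => x; rewrite /cylinder_metric block_mxEur mxE.
  + rewrite (_ : (fun x => _) = fun=> 0); first exact: cst.
    by apply/funext => x; rewrite /cylinder_metric block_mxEdl mxE.
  + rewrite (_ : (fun x => _) = (fun z => g s.2 z a' b' : R^o) \o @rsubmx R 1 1 7); last first.
      by apply/funext => x; rewrite /cylinder_metric block_mxEdr.
    apply/smooth_CkP => k; apply: (Ck_sub (U := @rsubmx R 1 1 7 @^-1` dom s.2)); first by move=> x [].
    apply: (Ck_compL (L := @rsubmx R 1 1 7)) => //; first exact: continuous_rsubmx.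
    by have /smooth_CkP := dg s.2 a' b'; exact.
- move=> s t x Ox; rewrite cylinder_jacobian // /cylinder_metric (cylinder_overlap Ox).2.
  by rewrite -!/(block1 _) block1T !block1M -tg //; exact: (cylinder_overlap Ox).1.
Qed.

Lemma spin7_cylinder : spin7_manifold (cylinder_Phi phi g) (cylinder_metric g).
Proof.
split.
- exact: cylinder_manifold.
- exact: cylinder_smooth_form.
- exact: cylinder_riemannian_metric.
- move=> s x [_ /fr[E fE]]; exists (block1 E); exact: spin7_frame_block1.
- move=> s x [_ dx].
  have [_ dphi _] := sphi; have [_ _ dg _] := rg.
  have [_ _ _ _ par] := H.
  have P := (parallel_cylinder (@oY s.2) (sg (i := s.2)) (g0 (i := s.2)) (dg s.2)
    (phil (i := s.2)) (dphi s.2) dx).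
  by apply: P; exact: par.
Qed.

End Cylinder.
End Charts.

(** * Curvature of line bundle connections *)

Section ComplexDerivative.
Variables (R : realType) (n : nat).
Local Notation C := R[i].
Implicit Types F G : 'rV[R]_n -> C.

Definition deriveC F (x u : 'rV[R]_n) : C :=
  'D_u (fun y => complex.Re (F y) : R^o) x +i* 'D_u (fun y => complex.Im (F y) : R^o) x.

Definition diffC F x := differentiable (fun y => complex.Re (F y) : R^o) x /\
  differentiable (fun y => complex.Im (F y) : R^o) x.

Definition smoothC (U : set 'rV[R]_n) F := smooth_on U (fun y => complex.Re (F y) : R^o) /\
  smooth_on U (fun y => complex.Im (F y) : R^o).

Lemma smoothC_diff U F x : smoothC U F -> U x -> diffC F x.
Proof. by move=> [h1 h2] Ux; split; [exact: (h1 [::])|exact: (h2 [::])]. Qed.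

Lemma near_deriveC F G x u : (\forall y \near x, F y = G y) -> deriveC F x u = deriveC G x u.
Proof.
by move=> FG; congr (_ +i* _); apply: near_eq_derive; apply: filterS FG => y ->.
Qed.

Lemma eq_smoothC U F G : open U -> (forall x, U x -> F x = G x) -> smoothC U F -> smoothC U G.
Proof.
move=> oU FG [/smooth_CkP h1 /smooth_CkP h2]; split; apply/smooth_CkP => k.
  by apply: (eq_Ck _ _ (h1 k)) => // x Ux; rewrite FG.
by apply: (eq_Ck _ _ (h2 k)) => // x Ux; rewrite FG.
Qed.

Lemma smoothC_cst U (c : C) : smoothC U (fun=> c).
Proof. by split; apply/smooth_CkP => k; exact: Ck_cst. Qed.

Lemma smoothC_sub (U U' : set 'rV[R]_n) F : U' `<=` U -> smoothC U F -> smoothC U' F.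
Proof. by move=> UU [h1 h2]; split=> s x /UU; [exact: h1|exact: h2]. Qed.

Lemma ReM (a b : C) : complex.Re (a * b) = complex.Re a * complex.Re b - complex.Im a * complex.Im b.
Proof. by case: a b => [? ?] [? ?]. Qed.
Lemma ImM (a b : C) : complex.Im (a * b) = complex.Re a * complex.Im b + complex.Im a * complex.Re b.
Proof. by case: a b => [? ?] [? ?]. Qed.

Lemma deriveCD F G x u : diffC F x -> diffC G x ->
  deriveC (fun y => F y + G y) x u = deriveC F x u + deriveC G x u.
Proof.
move=> [f1 f2] [g1 g2]; congr (_ +i* _).
  have <- := deriveD (diff_derivable (v := u) f1) (diff_derivable g1).
  by congr ('D_u _ x); apply/funext => y; rewrite ReD.
have <- := deriveD (diff_derivable (v := u) f2) (diff_derivable g2).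
by congr ('D_u _ x); apply/funext => y; rewrite ImD.
Qed.

Lemma deriveCM F G x u : diffC F x -> diffC G x ->
  deriveC (fun y => F y * G y) x u = deriveC F x u * G x + F x * deriveC G x u.
Proof.
move=> [f1 f2] [g1 g2].
have M (f g : 'rV[R]_n -> R^o) : differentiable f x -> differentiable g x ->
    'D_u (fun y => f y * g y : R^o) x = f x * 'D_u g x + g x * 'D_u f x.
  by move=> df dg; exact: (deriveM (diff_derivable df) (diff_derivable dg)).
have dM (f g : 'rV[R]_n -> R^o) : differentiable f x -> differentiable g x ->
    derivable (fun y => f y * g y : R^o) x u.
  by move=> df dg; apply: diff_derivable; exact: differentiableM.
apply: complexP; rewrite /deriveC /=.
  rewrite (_ : (fun y => _) = (fun y => complex.Re (F y) * complex.Re (G y) : R^o)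
    - (fun y => complex.Im (F y) * complex.Im (G y) : R^o)); last first.
    by apply/funext => y; rewrite ReM.
  rewrite deriveB ?(M _ _ f1 g1) ?(M _ _ f2 g2); try exact: dM.
  by rewrite ReD !ReM /=; ring.
rewrite (_ : (fun y => _) = (fun y => complex.Re (F y) * complex.Im (G y) : R^o)
    + (fun y => complex.Im (F y) * complex.Re (G y) : R^o)); last first.
  by apply/funext => y; rewrite ImM.
rewrite deriveD ?(M _ _ f1 g2) ?(M _ _ f2 g1); try exact: dM.
by rewrite ImD !ImM /=; ring.
Qed.

Lemma diffCM F G x : diffC F x -> diffC G x -> diffC (fun y => F y * G y) x.
Proof.
move=> [f1 f2] [g1 g2]; split.
  rewrite (_ : (fun y => _) = (fun y => complex.Re (F y) : R^o) * (fun y => complex.Re (G y) : R^o)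
    - (fun y => complex.Im (F y) : R^o) * (fun y => complex.Im (G y) : R^o)); last first.
    by apply/funext => y; rewrite ReM.
  by apply: differentiableB; exact: differentiableM.
rewrite (_ : (fun y => _) = (fun y => complex.Re (F y) : R^o) * (fun y => complex.Im (G y) : R^o)
    + (fun y => complex.Im (F y) : R^o) * (fun y => complex.Re (G y) : R^o)); last first.
  by apply/funext => y; rewrite ImM.
by apply: differentiableD; exact: differentiableM.
Qed.

Lemma deriveC_lin F x (c : R) u v : diffC F x ->
  deriveC F x (c *: u + v) = c%:C * deriveC F x u + deriveC F x v.
Proof.
move=> [f1 f2].
have E (f : 'rV[R]_n -> R^o) : differentiable f x ->
    'D_(c *: u + v) f x = c * 'D_u f x + 'D_v f x.
  by move=> df; rewrite !deriveE // linearP.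
by apply: complexP; rewrite ?ReD ?ReM ?ImD ?ImM /deriveC /= !E //; ring.
Qed.

Lemma deriveC_cst (c : C) x u : deriveC (fun=> c) x u = 0.
Proof. by apply: complexP; exact: derive_cst. Qed.

Lemma smoothC_derive U F u : open U -> smoothC U F -> smoothC U (fun x => deriveC F x u).
Proof.
move=> oU [/smooth_CkP h1 /smooth_CkP h2].
by split; apply/smooth_CkP => k; apply: Ck_derive.
Qed.

Lemma deriveC_schwarz U F x u v : open U -> smoothC U F -> U x ->
  deriveC (fun y => deriveC F y u) x v = deriveC (fun y => deriveC F y v) x u.
Proof. move=> oU [h1 h2] Ux.
by apply: complexP; [exact: (@schwarz R n U _ x v u oU h1 Ux)|exact: (@schwarz R n U _ x v u oU h2 Ux)]. Qed.

End ComplexDerivative.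

(** The commutator of covariant derivatives on [f e]: second derivatives of [f] cancel by Schwarz,
    the first-order and quadratic terms are symmetric, and the exterior derivative of the connection
    form is left. *)
Lemma leibniz_commutator (K : comNzRingType) (f ddf ddf' fu fv tu tv dtu dtv : K) :
  ddf = ddf' ->
  (ddf + fu * tv + f * dtv + (fv + f * tv) * tu)
  - (ddf' + fv * tu + f * dtu + (fu + f * tu) * tv) = (dtv - dtu) * f.
Proof. by move=> ->; ring. Qed.

(** * Connections in a local frame *)

Section Bundle.
Variables (R : realType) (n : nat) (A : atlas R n) (L : line_bundle A).
Hypotheses (oover : forall i j : ix A, open (overlap i j)) (sL : smooth_line_bundle L).
Local Notation C := R[i].

Lemma smooth_lframe (a : lix L) : smooth_section (lset a) (lframe a).
Proof.
have [_ _ _ h] := sL; move=> b.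
by rewrite setIC; exact: h.
Qed.

Lemma coefE (a : lix L) p (v : fib L p) : lset a p -> v = coef (lframe a p) v *: lframe a p.
Proof.
have [_ _ h _] := sL => lp; have [c [cv _]] := h a p lp v.
by rewrite {1}(xgetPex 0 (P := [set c | v = c *: lframe a p])) //; exists c.
Qed.

Lemma coef_uniq (a : lix L) p (c d : C) : lset a p ->
  c *: lframe a p = d *: lframe a p -> c = d.
Proof.
have [_ _ h _] := sL => lp e; have [b [_ bu]] := h a p lp (c *: lframe a p).
by rewrite -(bu c) // -(bu d).
Qed.

Lemma coefZ (a : lix L) p (c : C) : lset a p -> coef (lframe a p) (c *: lframe a p) = c.
Proof. by move=> lp; apply: (coef_uniq lp); rewrite -coefE. Qed.

Lemma open_inI (U V : set (pt A)) : open_in U -> open_in V -> open_in (U `&` V).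
Proof.
move=> oU oV i; rewrite (_ : [set x | _] = [set x | dom i x /\ U (par i x)] `&`
  [set x | dom i x /\ V (par i x)]); first exact: openI.
by apply/seteqP; split=> x /=; [move=> [? []]|move=> [[? ?] [? ?]]].
Qed.

Lemma open_chart_image (i : ix A) : open_in (chart_image i).
Proof. by move=> j; exact: oover. Qed.

Lemma smooth_section_sub (U V : set (pt A)) (s : section L) :
  V `<=` U -> smooth_section U s -> smooth_section V s.
Proof.
by move=> VU h a i; apply: (smoothC_sub _ (h a i)) => x [? [? ?]]; split=> //; split=> //; exact: VU.
Qed.

Lemma eq_smooth_section (U : set (pt A)) (s t : section L) : open_in U ->
  (forall p, U p -> s p = t p) -> smooth_section U s -> smooth_section U t.
Proof.
move=> oU st h a i; have [_ ol _ _] := sL.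
apply: (eq_smoothC _ _ (h a i)); first exact: open_inI.
by move=> x [_ [Ux _]]; rewrite st.
Qed.

Variable D : cov_derivative L.
Hypothesis cD : is_connection D.

(* Locality follows from the Leibniz rule for the indicator function of [U]. *)
Lemma connection_local i u (U : set (pt A)) (s t : section L) x : open_in U ->
  smooth_section U s -> (forall p, U p -> s p = t p) -> dom i x -> U (par i x) ->
  D i u s (par i x) = D i u t (par i x).
Proof.
move=> oU Us st ix Ux.
pose f p : C := if `[<U p>] then 1 else 0.
have sf : smooth_fun U f.
  move=> j; apply: (eq_smoothC (F := fun=> 1)) => //; first by move=> y [_ Uy]; rewrite /f asboolT.
  exact: smoothC_cst.
have df : dfun f i x u = 0.
  rewrite -(deriveC_cst 1 x u); apply: near_deriveC.
  have := open_nbhs_nbhs (conj (oU i) (conj ix Ux)).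
  by apply: filterS => y [_ Uy]; rewrite /f asboolT.
have E : (fun p => f p *: s p) = (fun p => f p *: t p).
  apply: functional_extensionality_dep => p; rewrite /f.
  by case: asboolP => [/st ->//|_]; rewrite !scale0r.
have := conn_leibniz cD u ix oU Ux sf Us; rewrite E.
rewrite (conn_leibniz cD u ix oU Ux sf (eq_smooth_section oU st Us)) df !scale0r !add0r.
by rewrite /f asboolT // !scale1r.
Qed.

Section Local.
Variables (a : lix L) (i : ix A).
Let e := lframe a.

Definition conn_form (u : 'rV[R]_n) (x : 'rV[R]_n) : C :=
  coef (e (par i x)) (D i u e (par i x)).

Let W := [set x | dom i x /\ lset a (par i x)].

Lemma open_conn_dom : open W.
Proof. by have [_ h _ _] := sL; exact: h. Qed.

Lemma smooth_at_lframe x : W x -> smooth_at (par i x) e.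
Proof. by move=> [ix lx]; exists (lset a); split=> //; [have [_ h _ _] := sL; exact: h|exact: smooth_lframe]. Qed.

Lemma conn_formE u x : W x -> D i u e (par i x) = conn_form u x *: e (par i x).
Proof. by move=> [_ lx]; exact: coefE. Qed.

Lemma smooth_conn_form u : smoothC W (conn_form u).
Proof.
have [_ ol _ _] := sL.
have h := conn_smooth cD i u (ol a) (@smooth_lframe a) a i.
apply: smoothC_sub h => x [ix lx]; split=> //; split=> //; split=> //; exact: imageP.
Qed.

Lemma conn_form_lin c u v x : W x ->
  conn_form (c *: u + v) x = c%:C * conn_form u x + conn_form v x.
Proof.
move=> Wx; have [ix lx] := Wx; apply: (coef_uniq lx).
rewrite -conn_formE // (conn_linear cD) //; last exact: smooth_at_lframe.
by rewrite !conn_formE // scalerDl scalerA.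
Qed.

(** A section equals its coefficient times the frame only over [lset a]; locality allows the
    replacement before the Leibniz rule is applied. *)
Lemma connection_coef u (U : set (pt A)) (s : section L) x : open_in U -> smooth_section U s ->
  W x -> U (par i x) ->
  let f y := coef (e (par i y)) (s (par i y)) in
  D i u s (par i x) = (deriveC f x u + f x * conn_form u x) *: e (par i x).
Proof.
move=> oU Us Wx Ux f; have [ix lx] := Wx; have [_ ol _ _] := sL.
have oUl : open_in (U `&` lset a) by exact: open_inI.
have sUl : smooth_section (U `&` lset a) s by apply: smooth_section_sub Us => p [].
rewrite (connection_local u oUl sUl (t := fun p => coef (e p) (s p) *: e p)) //; last first.
  by move=> p [_ lp]; exact: coefE.
have el : smooth_section (U `&` lset a) e by apply: (smooth_section_sub _ (@smooth_lframe a)) => p [].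
rewrite (conn_leibniz cD u ix oUl (conj Ux lx) (Us a) el) conn_formE //.
by rewrite scalerA -scalerDl.
Qed.

Definition curv u v x := deriveC (conn_form v) x u - deriveC (conn_form u) x v.

Lemma curvature_spec s x u v : W x -> smooth_at (par i x) s ->
  D i u (D i v s) (par i x) - D i v (D i u s) (par i x) = curv u v x *: s (par i x).
Proof.
move=> Wx [U [oU Ux Us]]; have [ix lx] := Wx; have [_ ol _ _] := sL.
pose f y := coef (e (par i y)) (s (par i y)).
(* After one covariant derivative, smoothness is guaranteed only inside the image of the chart, so
   the second derivative is taken there. *)
have oV : open_in (U `&` chart_image i) by apply: open_inI => //; exact: open_chart_image.
have Vx : (U `&` chart_image i) (par i x) by split=> //; exact: imageP.
pose N := [set y | dom i y /\ (U `&` lset a) (par i y)].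
have oN : open N by exact: open_inI.
have Nx : N x by [].
have sf : smoothC N f := Us a i.
have df := smoothC_diff sf Nx.
have dth w : diffC (conn_form w) x := smoothC_diff (smooth_conn_form w) Wx.
have E w w' : D i w (D i w' s) (par i x) =
    (deriveC (fun y => deriveC f y w') x w + deriveC f x w * conn_form w' x
     + f x * deriveC (conn_form w') x w
     + (deriveC f x w' + f x * conn_form w' x) * conn_form w x) *: e (par i x).
  rewrite (connection_coef w oV (conn_smooth cD i w' oU Us) Wx Vx).
  have H y : N y -> coef (e (par i y)) (D i w' s (par i y)) =
      deriveC f y w' + f y * conn_form w' y.
    move=> [iy [Uy ly]]; rewrite (connection_coef w' oU Us) //; exact: coefZ.
  rewrite H // (near_deriveC (G := fun y => deriveC f y w' + f y * conn_form w' y)); last first.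
    exact: (filterS H (open_nbhs_nbhs (conj oN Nx))).
  rewrite deriveCD; [|exact: smoothC_diff (smoothC_derive w' oN sf) Nx|exact: diffCM].
  by rewrite deriveCM // addrA.
rewrite !E -scalerBl [s (par i x) in RHS](coefE (a := a)) // scalerA; congr (_ *: _).
exact: leibniz_commutator (deriveC_schwarz v u oN sf Nx).
Qed.

(** The chosen value is determined because any admissible scalar can be tested on the frame, which
    does not vanish. *)
Lemma curvatureE V x : W x -> curvature D i x V = curv (row 0 V) (row 1 V) x.
Proof.
move=> Wx; have [ix lx] := Wx; apply: xget_unique => /=.
  by move=> s; exact: curvature_spec.
move=> c /(_ e (smooth_at_lframe Wx)); rewrite curvature_spec //; last exact: smooth_at_lframe.
by move/(coef_uniq lx).
Qed.

Lemma curv_lin c u u' v x : W x ->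
  curv (c *: u + u') v x = c%:C * curv u v x + curv u' v x.
Proof.
move=> Wx; rewrite /curv; have dth w := smoothC_diff (smooth_conn_form w) Wx.
rewrite deriveC_lin //.
(* Linearity of the connection form in its vector holds at every point near [x], hence may be
   differentiated. *)
rewrite (near_deriveC (F := conn_form (c *: u + u'))
   (G := fun y => c%:C * conn_form u y + conn_form u' y)); last first.
  by apply: filterS (open_nbhs_nbhs (conj open_conn_dom Wx)) => y; exact: conn_form_lin.
have dc : diffC (fun=> c%:C) x by apply: smoothC_diff (smoothC_cst setT _) I.
rewrite deriveCD ?deriveCM ?deriveC_cst // ?mul0r ?add0r; last exact: diffCM.
by rewrite mulrBr opprD addrACA.
Qed.

Lemma curv0 v x : W x -> curv 0 v x = 0.
Proof.
move=> Wx; have := curv_lin 1 0 0 v Wx; rewrite scale1r addr0 mul1r => /eqP.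
by rewrite -subr_eq0 opprD addrA subrr sub0r oppr_eq0 => /eqP.
Qed.

Lemma curvC u v x : curv u v x = - curv v u x.
Proof. by rewrite /curv opprB. Qed.

End Local.

Lemma curvature_mlin i x : dom i x -> mlin (real_complex R) (curvature D i x).
Proof.
move=> ix V V1 V2 r b c H1 /row'P H2 /row'P H3.
have [cov _ _ _] := sL; have [a la] := cov (par i x).
have Wx : [set x | dom i x /\ lset a (par i x)] x by [].
rewrite !(curvatureE _ Wx).
have lin w u1 u2 v v1 v2 : w = b *: u1 + c *: u2 -> v1 = v -> v2 = v ->
    curv a i w v x = b%:C * curv a i u1 v1 x + c%:C * curv a i u2 v2 x.
  move=> -> -> ->; rewrite curv_lin //; congr (_ + _).
  by rewrite -[c *: u2]addr0 curv_lin // curv0 // addr0.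
have lin' w u1 u2 v v1 v2 : w = b *: u1 + c *: u2 -> v1 = v -> v2 = v ->
    curv a i v w x = b%:C * curv a i v1 u1 x + c%:C * curv a i v2 u2 x.
  move=> e1 e2 e3; rewrite curvC (lin _ _ _ _ _ _ e1 e2 e3) opprD -!mulrN.
  by rewrite [curv a i v1 u1 x]curvC [curv a i v2 u2 x]curvC.
case: r H1 H2 H3 => -[|[|//]] rr H1 H2 H3.
  have E (U : 'M[R]_(2, n)) : row (Ordinal rr) U = row 0 U by congr (row _ U); exact: val_inj.
  move: H1; rewrite (E V) (E V1) (E V2) => H1.
  exact: lin H1 (H2 1 isT) (H3 1 isT).
have E (U : 'M[R]_(2, n)) : row (Ordinal rr) U = row 1 U by congr (row _ U); exact: val_inj.
move: H1; rewrite (E V) (E V1) (E V2) => H1.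
exact: lin' H1 (H2 0 isT) (H3 0 isT).
Qed.

Lemma curvature_alt0 i x : dom i x -> alt0 (curvature D i x).
Proof.
move=> ix V r1 r2 r12 e.
have [cov _ _ _] := sL; have [a la] := cov (par i x).
have Wx : [set x | dom i x /\ lset a (par i x)] x by [].
rewrite (curvatureE _ Wx).
have -> : row 0 V = row 1 V.
  have E0 h : row (@Ordinal 2 0 h) V = row 0 V by congr (row _ V); exact: val_inj.
  have E1 h : row (@Ordinal 2 1 h) V = row 1 V by congr (row _ V); exact: val_inj.
  by case: r1 r2 r12 e => -[|[|//]] h1 [] [|[|//]] h2 //= _; rewrite E0 E1.
by rewrite /curv subrr.
Qed.

End Bundle.

(** * The curvature of the pullback connection *)

Section Pullback.
Variables (R : realType) (Y : atlas R 7) (L : line_bundle Y).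
Let X := cylinder Y.
Let rgt : {linear 'rV[R]_(1 + 7) -> 'rV[R]_7} := @rsubmx R 1 1 7.
Hypotheses (Yman : oriented_manifold Y) (sL : smooth_line_bundle L).

Let ooY (i j : ix Y) : open (overlap i j). Proof. by case: Yman => _ _ _ h _; exact: h. Qed.
Let Xman : oriented_manifold X. Proof. exact: oriented_manifold_prod (oriented_manifold_circle R) Yman. Qed.
Let ooX (i j : ix X) : open (overlap i j). Proof. by case: Xman => _ _ _ h _; exact: h. Qed.

Lemma smoothC_rsubmx (U : set 'rV[R]_7) (F : 'rV[R]_7 -> R[i]) : open U ->
  smoothC U F -> smoothC (rgt @^-1` U) (fun x => F (rgt x)).
Proof.
move=> oU [/smooth_CkP h1 /smooth_CkP h2]; have rc : continuous rgt by exact: continuous_rsubmx.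
split; apply/smooth_CkP => k.
  exact: (Ck_compL (L := rgt) oU rc (h1 k)).
exact: (Ck_compL (L := rgt) oU rc (h2 k)).
Qed.

Lemma deriveC_rsubmx (F : 'rV[R]_7 -> R[i]) x u :
  deriveC (fun y => F (rgt y)) x u = deriveC F (rgt x) (rgt u).
Proof.
congr (_ +i* _).
  exact: (congr1 (@^~ x) (derive_compL rgt (fun y => complex.Re (F y) : R^o) u)).
exact: (congr1 (@^~ x) (derive_compL rgt (fun y => complex.Im (F y) : R^o) u)).
Qed.

Lemma smooth_pullback_bundle : smooth_line_bundle (pullback_bundle L).
Proof.
have [cov ol fr cf] := sL; split.
- by move=> p; exact: cov.
- move=> a; change (lix L) in a; case=> [t i]; rewrite (_ : [set x | _] = lsubmx @^-1` dom t `&`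
    rsubmx @^-1` [set y | dom i y /\ lset a (par i y)]).
    by apply: open_prod; [exact: circle_dom_open|exact: ol].
  by apply/seteqP; split=> x /=; tauto.
- by move=> a p; exact: fr.
- move=> a b; change (lix L) in a, b; case=> [t i].
  have oU : open [set y | dom i y /\ (lset a `&` lset b) (par i y)] by apply: open_inI; exact: ol.
  apply: (smoothC_sub _ (smoothC_rsubmx oU (cf a b i))).
  by move=> x [[_ ix] ab]; split.
Qed.

(** The curvature is tested on all sections of the pullback bundle, whereas the hypothesis concerns
    pulled-back ones. The frame is pulled back, so the two connection forms agree near the point,
    and they determine the curvatures. *)
Lemma curvature_pullback (D : cov_derivative L) (D' : cov_derivative (pullback_bundle L))
    (ti : ix X) x V : is_connection D -> is_pullback_connection D D' -> dom ti x ->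
  curvature D' ti x V = form_pr2 (curvature D ti.2 (rsubmx x)) V.
Proof.
move=> cD [cD' pb] dx; have [_ iy] := dx.
have [cov ol _ _] := sL; have [a la] := cov (par ti.2 (rsubmx x)).
rewrite (curvatureE ooX smooth_pullback_bundle cD' (a := a)) //.
rewrite /form_pr2 (curvatureE ooY sL cD (i := ti.2) (a := a) _ (conj iy la)).
pose W := [set y : 'rV[R]_(1 + 7) | dom ti y /\ lset a (par ti.2 (rsubmx y))].
have oW : open W by have [_ h _ _] := smooth_pullback_bundle; exact: (h a ti).
have E u : \forall y \near x, @conn_form R (1 + 7) X (pullback_bundle L) D' a ti u y =
    conn_form D a ti.2 (rsubmx u) (rgt y).
  apply: filterS (open_nbhs_nbhs (conj oW (conj dx la))) => y [dy ly].
  rewrite /conn_form (pb ti y u (lframe a)) //.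
  by exists (lset a); split=> //; exact: smooth_lframe.
have rr (k : 'I_2) : row k (rsubmx V) = rsubmx (row k V) by apply/rowP => j; rewrite !mxE.
rewrite /curv (near_deriveC _ (E _)) (near_deriveC _ (E (row 0 V))).
by rewrite !deriveC_rsubmx !rr.
Qed.

End Pullback.

Theorem lemma7p1 (R : realType) (Y : atlas R 7)
    (phi : form_field R 3 Y) (g : metric_field Y) :
  let X := cylinder Y in
  let Phi := cylinder_Phi phi g in
  let gX := cylinder_metric g in
  g2_manifold phi g ->
  spin7_manifold (A := X) Phi gX /\
  forall (L : line_bundle Y) (h : forall p, fib L p -> fib L p -> R[i]%C)
    (D : cov_derivative L) (D' : cov_derivative (pullback_bundle L)),
    smooth_line_bundle L ->
    hermitian_metric h ->
    hermitian_connection h D ->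
    is_pullback_connection D D' ->
    (g2_dDT phi g D <-> form_field_vanishes (spin7_F1 Phi gX D')) /\
    (form_field_vanishes (spin7_F1 Phi gX D') <->
     form_field_vanishes (spin7_F1 Phi gX D') /\
     form_field_vanishes (spin7_F2 Phi gX D')).
Proof.
move=> X Phi gX HY; split; first exact: spin7_cylinder.
move=> L h D D' sL _ [cD _] pb.
have [Yman _ _ fr _] := HY.
have ooY (i j : ix Y) : open (overlap i j) by case: Yman => _ _ _ H _; exact: H.
have Fl (i : ix Y) x : dom i x -> mlin (real_complex R) (curvature D i x) by exact: curvature_mlin.
have F0 (i : ix Y) x : dom i x -> alt0 (curvature D i x) by exact: curvature_alt0.
have cE ti x : dom ti x -> curvature D' ti x = form_pr2 (curvature D ti.2 (rsubmx x)).
  by move=> dx; apply/funext => V; exact: curvature_pullback.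
have F1E ti x : dom ti x -> spin7_F1 Phi gX D' ti x =
    spin7_F1_at (g ti.2 (rsubmx x)) (phi ti.2 (rsubmx x)) (curvature D ti.2 (rsubmx x)).
  by move=> dx; rewrite /spin7_F1 cE.
have F2E ti x : dom ti x -> spin7_F2 Phi gX D' ti x =
    spin7_F2_at (g ti.2 (rsubmx x)) (phi ti.2 (rsubmx x)) (curvature D ti.2 (rsubmx x)).
  by move=> dx; rewrite /spin7_F2 cE.
have F1P : g2_dDT phi g D <-> form_field_vanishes (spin7_F1 Phi gX D').
  split=> H.
    move=> ti x dx V; have [_ iy] := dx; rewrite F1E //.
    have [E fE] := fr _ _ iy.
    exact: ((g2_dDT_F1_at fE (Fl _ _ iy) (F0 _ _ iy)).1 (H _ _ iy)).
  move=> i y iy V; have [E fE] := fr _ _ iy.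
  (* The equation at a point of [Y] is read off at any point above it; the angle 1 lies in the
     domain (0, 2 pi) of the circle chart of index 0. *)
  pose x : 'rV[R]_(1 + 7) := row_mx (const_mx 1) y.
  have dx : @dom _ _ X (0, i) x.
    split=> /=; rewrite ?row_mxKr // row_mxKl mxE add0r ltr01 /=.
    by have := pi_ge2 R; lra.
  have Hx W : spin7_F1_at (g i y) (phi i y) (curvature D i y) W = 0.
    by have := H (0, i) x dx W; rewrite F1E //= row_mxKr.
  exact: ((g2_dDT_F1_at fE (Fl _ _ iy) (F0 _ _ iy)).2 Hx V).
split=> //; split=> [H|[]//]; split=> //.
move=> ti x dx V; have [_ iy] := dx; rewrite F2E //.
have [E fE] := fr _ _ iy.
exact: (g2_dDT_F2_at fE (Fl _ _ iy) (F0 _ _ iy) (F1P.2 H _ _ iy)).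
Qed.
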